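(* Assume the setting and Assumptions 1, 2 and 3 described in the context, and suppose in addition that $\theta<r_B$. Then there exists $\varepsilon_0>0$ such that for each $l=0,1,\dots,\tau-1$, as $n\to\infty$, \[ \bar x(n\tau+l)=\theta^{-n\tau-l}\,c_l+O\big((\theta+\varepsilon_0)^{-(n\tau+l)}\big)e^{\rm t}, \] where \[ c_l=\sum_{\nu=0}^{\tau-1}\frac{1}{(\omega_\tau^{\nu})^{l}}\, \frac{\big[x(0)B^*(\theta\omega_\tau^\nu)-x(1)A(0)\big]\Delta_M(\omega_\tau^\nu)v(\theta)}{(\theta\omega_\tau^\nu-1)\big\{\frac{d}{dy}\delta(A^*(y))|_{y=\theta}-1\big\}}\cdot\mu(\theta)\Delta_M(\omega_\tau^\nu)^{-1}, \] and $c_l>0$ (componentwise) for every $l=0,1,\dots,\tau-1$.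
   Context: Let $M_0,M$ be positive integers. Consider a discrete-time Markov chain $\{(X_n,S_n)\}_{n\ge0}$ of M/G/1 type with state space $\{(0,j):1\le j\le M_0\}\cup\{(k,j):k\ge1,1\le j\le M\}$ (the states with first coordinate $k$ form level $k$), whose transition matrix, with states in lexicographic order, is \[ T=\begin{pmatrix}B(0)&B(1)&B(2)&B(3)&\cdots\\ C(0)&A(1)&A(2)&A(3)&\cdots\\ O&A(0)&A(1)&A(2)&\cdots\\ O&O&A(0)&A(1)&\cdots\\ \vdots&\vdots&\vdots&\vdots&\ddots\end{pmatrix}, \] where $A(k)$ ($k\ge0$) are nonnegative $M\times M$ matrices, $B(0)$ is nonnegative $M_0\times M_0$, $B(k)$ ($k\ge1$) are nonnegative $M_0\times M$, $C(0)$ is nonnegative $M\times M_0$. Let $A=\sum_{k\ge0}A(k)$ (assumed stochastic), $B=\sum_{k\ge1}B(k)$ with $B(0)e+Be=e$, where $e$ is a column vector of ones; let $\pi$ be a row vector with $\pi A=\pi$, $\pi e=1$. Let $A^*(z)=\sum_{k\ge0}z^kA(k)$, $B^*(z)=\sum_{k\ge1}z^kB(k)$, with convergence radii $r_A,r_B$ (the convergence radius of $\sum_k z^kY(k)$, $Y(k)\ge0$, is $\sup\{y>0:\sum_k y^kY(k)<\infty\}$). Put $\Gamma_A^*(z)=z^{-1}A^*(z)$. Assumption 1: (a) $T$ is irreducible; (b) $A$ is irreducible; (c) $\rho:=\pi\sum_{k\ge1}kA(k)e<1$; (d) $\sum_{k\ge1}kB(k)e$ is finite. Assumption 2: $r_A>1$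 and $r_B>1$. For a square complex matrix $X$, $\delta(X)$ denotes a maximum-modulus eigenvalue of $X$ with nonnegative argument whose real part is not less than those of the other maximum-modulus eigenvalues (for $X$ nonnegative irreducible it is the Perron–Frobenius eigenvalue). Assumption 3: there is a finite $\theta$ with $1<\theta<r_A$ and $\theta=\delta(A^*(\theta))$. Under these assumptions the chain has a unique stationary probability vector $x=(x(0),x(1),x(2),\dots)$ partitioned by levels; $\bar x(k)=\sum_{l\ge k+1}x(l)$. Let $\mu(\theta)$, $v(\theta)$ be the Perron–Frobenius left and right eigenvectors of $\Gamma_A^*(\theta)$ (eigenvalue $1$), normalized by $\mu(\theta)e=1$, $\mu(\theta)v(\theta)=1$. Period $\tau$: consider the Markov additive process on $\mathbb Z\times\{1,\dots,M\}$ moving from $(k_0,i)$ to $(k_0+k,j)$ with probability $[\Gamma_A(k)]_{i,j}$, where $\Gamma_A(k)=A(k+1)$ for $k\ge-1$ and $\Gamma_A(k)=O$ for $k\le-2$. Write $(k_1,j_1)\to(k_2,j_2)$ if $(k_2,j_2)$ is reached from $(k_1,j_1)$ with positive probability in some positive number of steps. $\tau$ is the common value over $j$ of $\gcd\{k\neq0:(0,j)\to(k,j)\}$. Fix a function $p:\{1,\dots,M\}\to\{0,\dots,\tau-1\}$ such that $[\Gamma_A(k)]_{i,j}>0$ only if $k\equiv p(j)-p(i)\pmod\tau$ (such a function exists), and let $\Delta_M(z)=\mathrm{diag}(z^{-p(1)},\dots,z^{-p(M)})$. Finally $\omega_x=\exp(2\pi\iota/x)$, $\iota=\sqrt{-1}$,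 superscript ${\rm t}$ denotes transpose, and $O(g(k))e^{\rm t}$ denotes a row vector whose entries are $O(g(k))$. *)

(* Defs.v *)
From HB Require Import structures.
From mathcomp Require Import all_boot all_order all_algebra.
From mathcomp Require Import all_classical all_reals all_analysis.
From mathcomp Require Import complex.
From Stdlib Require Import Relations ClassicalEpsilon.

Set Implicit Arguments.
Unset Strict Implicit.
Unset Printing Implicit Defensive.

Import Order.TTheory GRing.Theory Num.Theory numFieldNormedType.Exports.

Local Open Scope ring_scope.

Section Defs.
Variable R : realType.
Local Notation C := R[i].

Definition rsum (u : nat -> R) : R := limn (series u).
Definition rsum_cvg (u : nat -> R) : Prop := cvgn (series u).

(** sum of a complex series: real and imaginary parts summed separately
    (a complex series converges iff both parts do, and then this is its sum) *)
Definition csum (u : nat -> C) : C :=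
  (rsum (fun k => complex.Re (u k)) +i* rsum (fun k => complex.Im (u k)))%C.

Definition cmx m n (X : 'M[R]_(m, n)) : 'M[C]_(m, n) :=
  map_mx (fun r : R => (r%:C)%C) X.

Definition conv_radius m n (Y : nat -> 'M[R]_(m, n)) : \bar R :=
  ereal_sup [set (y%:E)%E | y in
    [set y : R | 0 < y /\ forall i j, rsum_cvg (fun k => y ^+ k * Y k i j)]].

(** the sequence (B(k))_{k>=1} extended by B(0) := O (the block B(0) of T is the
    separate M0 x M0 matrix B0) *)
Definition Bext m n (B : nat -> 'M[R]_(m, n)) (k : nat) : 'M[R]_(m, n) :=
  if k == 0%N then 0 else B k.

Definition Astar n (A : nat -> 'M[R]_n) (y : R) : 'M[R]_n :=
  \matrix_(i, j) rsum (fun k => y ^+ k * A k i j).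
Definition Bstar m n (B : nat -> 'M[R]_(m, n)) (z : C) : 'M[C]_(m, n) :=
  \matrix_(i, j) csum (fun k => if k == 0%N then 0 else z ^+ k * ((B k i j)%:C)%C).

Definition is_delta n (X : 'M[C]_n) (l : C) : Prop :=
  [/\ root (char_poly X) l,
      (forall m, root (char_poly X) m -> `|m| <= `|l|),
      0 <= complex.Im l &
      (forall m, root (char_poly X) m -> `|m| = `|l| ->
         complex.Re m <= complex.Re l)].
Definition delta n (X : 'M[C]_n) : C :=
  epsilon (inhabits 0) (is_delta X).

Definition mx_irreducible n (X : 'M[R]_n) : Prop :=
  forall i j, clos_refl_trans _ (fun a b => 0 < X a b) i j.

(** states of the chain: level 0 is [inl j], level k >= 1 is [inr (k, j)] *)
Definition state M0 M := ('I_M0 + (nat * 'I_M))%type.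
Definition valid_state M0 M (s : state M0 M) : Prop :=
  match s with inl _ => True | inr (k, _) => (1 <= k)%N end.

Definition Tedge M0 M (A : nat -> 'M[R]_M) (B0 : 'M[R]_M0)
    (B : nat -> 'M[R]_(M0, M)) (C0 : 'M[R]_(M, M0)) (s t : state M0 M) : Prop :=
  match s, t with
  | inl i, inl j => 0 < B0 i j
  | inl i, inr (k, j) => (1 <= k)%N /\ 0 < B k i j
  | inr (k, i), inl j => k = 1%N /\ 0 < C0 i j
  | inr (k, i), inr (k', j) =>
      [/\ (1 <= k)%N, (1 <= k')%N, (k <= k'.+1)%N & 0 < A (k'.+1 - k)%N i j]
  end.

Definition T_irreducible M0 M A B0 B C0 : Prop :=
  forall s t : state M0 M, valid_state s -> valid_state t ->
    clos_refl_trans _ (@Tedge M0 M A B0 B C0) s t.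

(** Markov additive process on Z x {1..M}: (k0,i) -> (k0+k,j) with
    probability [Gamma_A(k)]_{ij}, Gamma_A(k) = A(k+1) for k >= -1 *)
Definition map_step M (A : nat -> 'M[R]_M) (s t : int * 'I_M) : Prop :=
  (-1 <= t.1 - s.1)%R /\ 0 < A (absz (t.1 - s.1 + 1)%R) s.2 t.2.
Definition map_reach M (A : nat -> 'M[R]_M) := clos_trans _ (map_step A).

Definition is_gcd_of (S : int -> Prop) (g : nat) : Prop :=
  (forall k, S k -> (g%:Z %| k)%Z) /\
  (forall d : int, (forall k, S k -> (d %| k)%Z) -> (d %| g%:Z)%Z).

Definition MAP_period M (A : nat -> 'M[R]_M) (tau : nat) : Prop :=
  forall j : 'I_M,
    is_gcd_of (fun k => k != 0 /\ map_reach A (0, j) (k, j)) tau.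

Definition period_fun M (A : nat -> 'M[R]_M) (tau : nat) (p : 'I_M -> nat) : Prop :=
  (forall j, (p j < tau)%N) /\
  (forall (m : nat) i j, 0 < A m i j ->
     (m%:Z - 1 = (p j)%:Z - (p i)%:Z %[mod tau%:Z])%Z).

Definition DeltaM M (p : 'I_M -> nat) (z : C) : 'M[C]_M :=
  diag_mx (\row_j (z ^- p j)).

Definition omega (x nu : nat) : C :=
  ((cos (2 * pi / x%:R) +i* sin (2 * pi / x%:R))%C) ^+ nu.

Definition xbar M (xl : nat -> 'rV[R]_M) (k : nat) : 'rV[R]_M :=
  \row_j rsum (fun l => xl (k.+1 + l)%N 0 j).

Definition c_const M0 M (A : nat -> 'M[R]_M) (B : nat -> 'M[R]_(M0, M))
    (x0 : 'rV[R]_M0) (x1 : 'rV[R]_M) (tau : nat) (p : 'I_M -> nat)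
    (theta : R) (mu : 'rV[R]_M) (v : 'cV[R]_M) (l : nat) : 'rV[C]_M :=
  let ddelta : R :=
    derive1 (fun y : R => complex.Re (delta (cmx (Astar A y)))) theta in
  \sum_(nu < tau)
    let w := omega tau nu in
    ((w ^+ l)^-1 *
      ((cmx x0 *m Bstar B (theta%:C%C * w) - cmx x1 *m cmx (A 0%N))
         *m DeltaM p w *m cmx v) 0 0 /
      ((theta%:C%C * w - 1) * ((ddelta - 1)%:C)%C))
    *: (cmx mu *m invmx (DeltaM p w)).

End Defs.

(* Main.v *)
(** The generating function X(z) = sum_(k >= 1) z^k x(k) satisfies
    X(z) (z I - A^*(z)) = z (x(0) B^*(z) - x(1) A(0)) on the unit disc, so Cramer's rule
    continues it meromorphically beyond |z| = theta.  On 1 < |z| <= theta the determinant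
    vanishes only at the points theta omega_tau^nu: for |z| < theta the geometric interpolation
    between the superharmonic vectors e (at 1) and v(theta) (at theta) is strictly
    superharmonic somewhere, and for |z| = theta equality in the triangle inequality
    forces the phase of z to be a tau-th root of unity.  There the poles are simple, because
    mu(theta) (d/dy A^*(y)) v(theta) = d/dy delta(A^*(y)) at y = theta, which exceeds 1 by
    Jensen's inequality; subtracting their principal parts leaves coefficients of order
    r^-k for some r > theta, and summing them gives the expansion of the tails.

    Positivity of c_l reduces to the principal parts not all vanishing.  If they did, x(k)
    would be O(r^-k) with r > theta, and pairing x with the strictly subharmonic function
    max(0, theta^k v - c s^k h), where 1 < s < theta, gives a contradiction.

    Functions are handled as uniform limits of polynomials on closed discs. *)

Require Import Defs.
From HB Require Import structures.
From mathcomp Require Import all_boot all_order all_algebra.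
From mathcomp Require Import all_classical all_reals all_analysis.
From mathcomp Require Import complex.
From mathcomp Require Import ring lra zify.
From Stdlib Require Import Relations ClassicalEpsilon.

Set Implicit Arguments.
Unset Strict Implicit.
Unset Printing Implicit Defensive.

Import Order.TTheory GRing.Theory Num.Theory numFieldNormedType.Exports.
Local Open Scope ring_scope.

(** * Modulus and roots of unity *)

Section Modulus.
Variable R : realType.
Local Notation C := R[i].
Local Notation toC := (real_complex R).

(** Contour integrals are replaced by finite averages: averaging a polynomial over the n-th roots of
    unity isolates a coefficient, which yields the Cauchy estimate and the maximum principle. The
    order of the poles is not read off from the determinant, whose zeros on |z| = theta are never
    given a multiplicity. The continuation only provides some exponent [m] for which [polar ^+ m]
    clears all poles; pairing the kernel equation with the right eigenvector lowers [m] to 1 and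
    then produces the residues, with [drift - 1] in the denominator. Since [delta] is a choice
    operator, its derivative is obtained by squeezing: an approximate eigenvector at [theta + e]
    bounds it on both sides up to O(e^2). Finally, c_l must be positive in every coordinate,
    although only the simultaneous vanishing of all principal parts can be excluded. Periodicity
    closes the gap: theta^k x(k) is asymptotic to a nonnegative tau-periodic sequence whose sum over
    a period is mu times one scalar. If it vanishes in one coordinate, it vanishes in all. *)

Definition nc (z : C) : R := complex.Re `|z|.

Lemma norm_nc z : `|z| = toC (nc z).
Proof. by rewrite /nc normc_def. Qed.

Lemma nc_ge0 z : 0 <= nc z.
Proof. by rewrite /nc normc_def /= sqrtr_ge0. Qed.

Lemma nc0 : nc 0 = 0.
Proof. by rewrite /nc normr0. Qed.

Lemma nc1 : nc 1 = 1.
Proof. by rewrite /nc normr1. Qed.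

Lemma ncM x y : nc (x * y) = nc x * nc y.
Proof. by apply: (@complexI R); rewrite rmorphM -!norm_nc normrM. Qed.

Lemma ncX x n : nc (x ^+ n) = nc x ^+ n.
Proof. by elim: n => [|n IH]; rewrite ?expr0 ?nc1 // !exprS ncM IH. Qed.

Lemma ncV x : nc x^-1 = (nc x)^-1.
Proof. by apply: (@complexI R); rewrite fmorphV -!norm_nc normfV. Qed.

Lemma ncN x : nc (- x) = nc x.
Proof. by rewrite /nc normrN. Qed.

Lemma ncBC x y : nc (x - y) = nc (y - x).
Proof. by rewrite -ncN opprB. Qed.

Lemma ncD x y : nc (x + y) <= nc x + nc y.
Proof. by rewrite -lecR rmorphD /= -!norm_nc ler_normD. Qed.

Lemma ncB x y : nc (x - y) <= nc x + nc y.
Proof. by rewrite -(ncN y) ncD. Qed.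

Lemma nc_eq0 x : (nc x == 0) = (x == 0).
Proof. by rewrite -(inj_eq (@complexI R)) -norm_nc rmorph0 normr_eq0. Qed.

Lemma nc_gt0 x : (0 < nc x) = (x != 0).
Proof. by rewrite lt_def nc_ge0 andbT nc_eq0. Qed.

Lemma nc_toC x : nc (toC x) = `|x|.
Proof. by rewrite /nc normc_def /= expr0n /= addr0 sqrtr_sqr. Qed.

Lemma nc_nat n : nc n%:R = n%:R.
Proof. by rewrite -(rmorph_nat toC) nc_toC ger0_norm. Qed.

Lemma nc_sum I (s : seq I) (P : pred I) (F : I -> C) :
  nc (\sum_(i <- s | P i) F i) <= \sum_(i <- s | P i) nc (F i).
Proof.
elim/big_ind2: _ => [|x1 x2 y1 y2 h1 h2|//]; first by rewrite nc0.
by apply: le_trans (ncD _ _) _; rewrite lerD.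
Qed.

Lemma nc_prod I (s : seq I) (P : pred I) (F : I -> C) :
  nc (\prod_(i <- s | P i) F i) = \prod_(i <- s | P i) nc (F i).
Proof. by elim/big_ind2: _ => [|x1 x2 y1 y2 <- <-|//]; rewrite ?nc1 ?ncM. Qed.

Lemma nc_lerB x y : nc x - nc y <= nc (x - y).
Proof. by rewrite lerBlDr -{1}(subrK y x) ncD. Qed.

Lemma nc_Re z : `|complex.Re z| <= nc z.
Proof. by rewrite /nc normc_def /= -sqrtr_sqr ler_wsqrtr // lerDl sqr_ge0. Qed.

Lemma nc_Im z : `|complex.Im z| <= nc z.
Proof. by rewrite /nc normc_def /= -sqrtr_sqr ler_wsqrtr // lerDr sqr_ge0. Qed.

Lemma nc_ReIm z : nc z <= `|complex.Re z| + `|complex.Im z|.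
Proof.
rewrite {1}(complexE z) -(nc_toC (complex.Re z)) -(nc_toC (complex.Im z)).
apply: le_trans (ncD _ _) _; rewrite lerD2l ncM.
by rewrite /nc normc_def /= expr0n expr1n add0r sqrtr1 mul1r.
Qed.

Lemma nc_le0 x : nc x <= 0 -> x = 0.
Proof. by move=> h; apply/eqP; rewrite -nc_eq0 eq_le h nc_ge0. Qed.

Lemma nc_le_eps x : (forall e : R, 0 < e -> nc x <= e) -> x = 0.
Proof.
move=> h; apply: nc_le0; apply/ler_addgt0Pr => e e0; rewrite add0r; exact: h.
Qed.

Lemma ler_eps_mul (a c : R) : (forall e : R, 0 < e -> a <= c * e) -> a <= 0.
Proof.
move=> h; apply/ler_addgt0Pr => e e0; rewrite add0r.
have c1 : 0 < `|c| + 1 by rewrite ltr_pwDr.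
apply: le_trans (h (e / (`|c| + 1)) _) _; first by rewrite divr_gt0.
rewrite mulrCA ger_pMr // ler_pdivrMr // mul1r.
by apply: le_trans (ler_norm _) _; rewrite lerDl.
Qed.

Lemma omegaE n k : omega R n k = omega R n 1 ^+ k.
Proof. by rewrite /omega expr1. Qed.

Lemma omega1X n k : omega R n 1 ^+ k =
  (cos (2 * pi / n%:R *+ k) +i* sin (2 * pi / n%:R *+ k))%C.
Proof.
rewrite /omega expr1; move: (2 * pi / n%:R) => x; elim: k => [|k IH].
  by rewrite expr0 !mulr0n cos0 sin0.
rewrite exprSr IH mulrSr cosD sinD.
by rewrite /GRing.mul /=; congr Complex; rewrite addrC.
Qed.

(** The order [m] divides [n]. If it were smaller, the angle [x = 2 pi m / n] would lie strictly
    between 0 and [2 pi] with [cos x = 1], against [cos x = 1 - 2 sin(x/2)^2] and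
    [sin (x/2) > 0]. *)
Lemma omega_prim n : (0 < n)%N -> n.-primitive_root (omega R n 1).
Proof.
move=> n0; have n0' : n%:R != 0 :> R by rewrite pnatr_eq0 -lt0n.
have on : omega R n 1 ^+ n = 1.
  rewrite omega1X -[_ *+ n]mulr_natr mulfVK // mulr_natl.
  by rewrite cos2pi sin2pi.
have [m pm dvd] := prim_order_exists n0 on.
have m0 := prim_order_gt0 pm.
suff e : n = m by move: pm; rewrite -e.
apply/eqP; rewrite eqn_leq (dvdn_leq n0 dvd) andbT leqNgt; apply/negP => mn.
have := prim_expr_order pm; rewrite omega1X => -[c1 _].
set x := 2 * pi / n%:R *+ m in c1.
have [x0 x2] : 0 < x /\ x < 2 * pi.
  rewrite /x -[_ *+ m]mulr_natr -mulrA; split.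
    by rewrite !mulr_gt0 ?pi_gt0 ?invr_gt0 ?ltr0n.
  rewrite gtr_pMr ?mulr_gt0 ?pi_gt0 //.
  by rewrite mulrC ltr_pdivrMr ?ltr0n // mul1r ltr_nat.
have h : cos x = 1 - 2 * sin (x / 2) ^+ 2.
  have this : x = (x / 2) *+ 2 by rewrite -[_ *+ 2]mulr_natr; field.
  rewrite {1}this mulr2n cosD -!expr2 cos2sin2; ring.
have s0 : 0 < sin (x / 2).
  by apply: sin_gt0_pi; lra.
have : 0 < sin (x / 2) ^+ 2 by rewrite exprn_gt0.
by lra.
Qed.

Lemma nc_omega n k : (0 < n)%N -> nc (omega R n k) = 1.
Proof.
move=> n0; rewrite omegaE ncX.
have := congr1 nc (prim_expr_order (omega_prim n0)).
rewrite ncX nc1 => h.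
suff -> : nc (omega R n 1) = 1 by rewrite expr1n.
apply/eqP; rewrite -(@pexpr_eq1 _ _ n) ?nc_ge0 //; exact/eqP.
Qed.

(** Orthogonality of the characters of Z/n, which takes the place of Cauchy's integral formula
    below. *)
Lemma prim_sum n (w : C) k : n.-primitive_root w ->
  \sum_(j < n) w ^+ (k * j) = if (n %| k)%N then n%:R else 0.
Proof.
move=> pw; rewrite (prim_order_dvd pw); case: eqVneq => h.
  under eq_bigr => j _ do rewrite exprM h expr1n.
  by rewrite sumr_const card_ord.
have : (w ^+ k - 1) * \sum_(j < n) w ^+ (k * j) = 0.
  under eq_bigr => j _ do rewrite exprM.
  by rewrite -subrX1 -exprM mulnC exprM (prim_expr_order pw) expr1n subrr.
by move/eqP; rewrite mulf_eq0 subr_eq0 (negbTE h) => /eqP.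
Qed.

End Modulus.

(** * Elementary real estimates *)

Section RealAux.
Variable R : realType.

Lemma bernoulli_ge (d : R) n : 0 <= d -> 1 + n%:R * d <= (1 + d) ^+ n.
Proof.
move=> d0; elim: n => [|n IH]; first by rewrite expr0 mul0r addr0.
rewrite exprS -natr1; apply: le_trans (_ : (1 + d) * (1 + n%:R * d) <= _).
  have : 0 <= n%:R * d ^+ 2 by rewrite mulr_ge0 ?sqr_ge0.
  by rewrite expr2; lra.
by rewrite ler_wpM2l // addr_ge0.
Qed.

Lemma archi_nat (x : R) : exists n : nat, x <= n%:R.
Proof.
exists (Num.bound `|x|); apply: le_trans (ler_norm x) _.
exact/ltW/archi_boundP.
Qed.

Lemma expr_small (q e : R) : 0 <= q -> q < 1 -> 0 < e ->
  exists N, forall n, (N <= n)%N -> q ^+ n <= e.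
Proof.
move=> q0 q1 e0; have [->|qn0] := eqVneq q 0.
  by exists 1%N => -[//|n] _; rewrite exprS mul0r ltW.
have qp : 0 < q by rewrite lt_def qn0.
pose d := q^-1 - 1.
have d0 : 0 < d by rewrite subr_gt0 invf_gt1.
have [N hN] := archi_nat (e^-1 / d); exists N => n Nn.
have h : e^-1 <= (q^-1) ^+ n.
  have -> : q^-1 = 1 + d by rewrite /d; ring.
  apply: le_trans (bernoulli_ge n (ltW d0)).
  have : e^-1 <= n%:R * d.
    rewrite -ler_pdivrMr //; apply: le_trans hN _; by rewrite ler_nat.
  by lra.
by rewrite -[e]invrK -[q ^+ n]invrK lef_pV2 ?posrE ?invr_gt0 ?exprn_gt0 // -exprVn.
Qed.

(** If [a > S], the powers of [S / a] tend to 0 and beat any fixed [K]: a constant loss disappears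
    when n-th roots of high powers are taken. *)
Lemma le_of_expr_le (a S K : R) : 0 <= S ->
  (forall n, a ^+ n <= K * S ^+ n) -> a <= S.
Proof.
move=> S0 h; rewrite leNgt; apply/negP => Sa.
have a0 : 0 < a by apply: le_lt_trans Sa.
have q0 : 0 <= S / a by rewrite divr_ge0 // ltW.
have q1 : S / a < 1 by rewrite ltr_pdivrMr // mul1r.
have K0 : 0 < `|K| + 1 by rewrite ltr_pwDr.
have K1 : 0 < (2 * (`|K| + 1))^-1 by rewrite invr_gt0 mulr_gt0.
have [N hN] := expr_small q0 q1 K1; have {hN} := hN N (leqnn N).
rewrite expr_div_n ler_pdivrMr ?exprn_gt0 // mulrC ler_pdivlMr ?mulr_gt0 //.
have := h N; have aN : 0 < a ^+ N by rewrite exprn_gt0.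
have SN : 0 <= S ^+ N by rewrite exprn_ge0.
have : K * S ^+ N <= `|K| * S ^+ N by rewrite ler_wpM2r // ler_norm.
by nra.
Qed.

Lemma geo_sum_le (q : R) n : 0 <= q -> q < 1 -> \sum_(k < n) q ^+ k <= (1 - q)^-1.
Proof.
move=> q0 q1; have q1' : 0 < 1 - q by rewrite subr_gt0.
rewrite -[(1 - q)^-1]mul1r ler_pdivlMr // mulrC.
have := subrX1 q n; have : 0 <= q ^+ n by rewrite exprn_ge0.
by lra.
Qed.

End RealAux.

(** * The disc algebra *)

Section Disc.
Variable R : realType.
Local Notation C := R[i].
Local Notation toC := (real_complex R).
Implicit Types (r S e : R) (F G : C -> C) (p q : {poly C}).

(* The disc algebra, in place of holomorphic functions: the maximum principle, division by
   [z - x] and the Cauchy estimate pass to the limit from polynomials. *)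
Definition an r F := forall e : R, 0 < e ->
  exists p : {poly C}, forall z, nc z <= r -> nc (F z - p.[z]) <= e.

Lemma an_poly r p : an r (fun z => p.[z]).
Proof. by move=> e e0; exists p => z _; rewrite subrr nc0 ltW. Qed.

Lemma an_ext r F G : (forall z, nc z <= r -> F z = G z) -> an r F -> an r G.
Proof. by move=> h aF e /aF[p hp]; exists p => z zr; rewrite -h // hp. Qed.

Lemma an_le r s F : r <= s -> an s F -> an r F.
Proof. by move=> rs aF e /aF[p hp]; exists p => z zr; rewrite hp ?(le_trans zr). Qed.

Lemma an_cst r (c : C) : an r (fun=> c).
Proof. by apply: an_ext (an_poly r c%:P) => z _; rewrite hornerC. Qed.

Lemma an_id r : an r id.
Proof. by apply: an_ext (an_poly r 'X) => z _; rewrite hornerX. Qed.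

Lemma poly_bounded r p : exists2 S, 0 <= S & forall z, nc z <= r -> nc p.[z] <= S.
Proof.
exists (\sum_(i < size p) nc p`_i * `|r| ^+ i).
  by apply: sumr_ge0 => i _; rewrite mulr_ge0 ?nc_ge0 ?exprn_ge0.
move=> z zr; rewrite horner_coef; apply: le_trans (nc_sum _ _ _) _.
apply: ler_sum => i _; rewrite ncM ncX ler_wpM2l ?nc_ge0 // lerXn2r ?nnegrE ?nc_ge0 //.
by apply: le_trans zr (ler_norm _).
Qed.

Lemma an_bounded r F : an r F ->
  exists2 S, 0 < S & forall z, nc z <= r -> nc (F z) <= S.
Proof.
move=> /(_ 1 ltr01)[p hp]; have [S S0 hS] := poly_bounded r p.
exists (S + 1) => [|z zr]; first by rewrite ltr_wpDl.
rewrite -[F z](subrK p.[z]) addrC; apply: le_trans (ncD _ _) _.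
by rewrite lerD ?hS ?hp.
Qed.

Lemma an_add r F G : an r F -> an r G -> an r (fun z => F z + G z).
Proof.
move=> aF aG e e0; have e2 : 0 < e / 2 by rewrite divr_gt0.
have [p hp] := aF _ e2; have [q hq] := aG _ e2; exists (p + q) => z zr.
rewrite hornerD opprD addrACA; apply: le_trans (ncD _ _) _.
by have := hp z zr; have := hq z zr; lra.
Qed.

Lemma an_mul r F G : an r F -> an r G -> an r (fun z => F z * G z).
Proof.
move=> aF aG e e0; have [SF SF0 hF] := an_bounded aF.
have [SG SG0 hG] := an_bounded aG.
(* The cap at 1 turns the quadratic error [e1 ^+ 2] into a linear one. *)
pose e1 := Num.min 1 (e / (SF + SG + 1)).
have Sp : 0 < SF + SG + 1 by rewrite !addr_gt0.
have e10 : 0 < e1 by rewrite lt_min ltr01 divr_gt0.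
have [p hp] := aF _ e10; have [q hq] := aG _ e10; exists (p * q) => z zr.
have -> : F z * G z - (p * q).[z] = F z * (G z - q.[z]) +
   (F z - p.[z]) * (G z - (G z - q.[z])) by rewrite hornerM; ring.
apply: le_trans (ncD _ _) _; rewrite !ncM.
apply: le_trans (_ : SF * e1 + e1 * (SG + e1) <= _).
  apply: lerD; first by rewrite ler_pM ?nc_ge0 ?hF ?hq.
  rewrite ler_pM ?nc_ge0 ?hp //; apply: le_trans (ncB _ _) _.
  by rewrite lerD ?hG ?hq.
apply: le_trans (_ : e1 * (SF + SG + 1) <= _).
  have : e1 <= 1 by rewrite ge_min lexx.
  by nra.
by rewrite -ler_pdivlMr // ge_min lexx orbT.
Qed.

Lemma an_scale r c F : an r F -> an r (fun z => c * F z).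
Proof. exact/an_mul/an_cst. Qed.

Lemma an_opp r F : an r F -> an r (fun z => - F z).
Proof. by move=> /(an_scale (-1)); apply: an_ext => z _; rewrite mulN1r. Qed.

Lemma an_sub r F G : an r F -> an r G -> an r (fun z => F z - G z).
Proof. by move=> aF aG; apply: an_add aF (an_opp aG). Qed.

Lemma an_sum r I (s : seq I) (P : pred I) (F : I -> C -> C) :
  (forall i, P i -> an r (F i)) -> an r (fun z => \sum_(i <- s | P i) F i z).
Proof.
move=> h; elim: s => [|i s IH].
  by apply: an_ext (an_cst r 0) => z _; rewrite big_nil.
case Pi: (P i); last by apply: an_ext IH => z _; rewrite big_cons Pi.
by apply: an_ext (an_add (h _ Pi) IH) => z _; rewrite big_cons Pi.
Qed.

Lemma an_prod r I (s : seq I) (P : pred I) (F : I -> C -> C) :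
  (forall i, P i -> an r (F i)) -> an r (fun z => \prod_(i <- s | P i) F i z).
Proof.
move=> h; elim: s => [|i s IH].
  by apply: an_ext (an_cst r 1) => z _; rewrite big_nil.
case Pi: (P i); last by apply: an_ext IH => z _; rewrite big_cons Pi.
by apply: an_ext (an_mul (h _ Pi) IH) => z _; rewrite big_cons Pi.
Qed.

Lemma an_exp r F n : an r F -> an r (fun z => F z ^+ n).
Proof.
move=> aF; elim: n => [|n IH]; first exact: an_cst.
by apply: an_ext (an_mul aF IH) => z _; rewrite exprS.
Qed.

Lemma an_det r n (K : C -> 'M[C]_n) :
  (forall i j, an r (fun z => K z i j)) -> an r (fun z => \det (K z)).
Proof.
move=> h; apply: an_sum => s _; apply: an_scale; apply: an_prod => i _; exact: h.
Qed.

Lemma an_adj r n (K : C -> 'M[C]_n) i j :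
  (forall i j, an r (fun z => K z i j)) -> an r (fun z => \adj (K z) i j).
Proof.
move=> h; have := @an_det r n.-1 (fun z => row' j (col' i (K z))).
move=> H; have {}H := H _ .
apply: an_ext (an_scale ((-1) ^+ (j + i)) (H _)).
  by move=> z _; rewrite mxE.
by move=> i' j'; apply: an_ext (h _ _) => z _; rewrite !mxE.
Qed.

(** Cauchy estimate without integration: averaging [p] over [n] equidistant points of the circle
    isolates the coefficient exactly, as soon as [n] exceeds both [k] and the degree. *)
Lemma poly_coef_bound p r S k : 0 < r ->
  (forall z, nc z = r -> nc p.[z] <= S) -> nc p`_k * r ^+ k <= S.
Proof.
move=> r0 hS; have [n [kn pn]] : exists n, (k < n)%N /\ (size p <= n)%N.
  by exists (maxn (size p) k.+1); rewrite leq_maxr leq_maxl.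
have n0 : (0 < n)%N by apply: leq_ltn_trans kn.
have [w [pw nw]] : exists w : C, n.-primitive_root w /\ forall j, nc (w ^+ j) = 1.
  by exists (omega R n 1); split=> [|j]; rewrite ?omega_prim // -omegaE nc_omega.
(* The weight [w ^+ ((n - k) * j)] is [w ^- (k * j)] written with a natural exponent; only the
   coefficient of index [k] survives. *)
have E : \sum_(j < n) p.[toC r * w ^+ j] * w ^+ ((n - k) * j) =
    n%:R * p`_k * toC r ^+ k.
  under eq_bigr => j _.
    rewrite (horner_coef_wide _ pn) mulr_suml.
    under eq_bigr => i _ do
      rewrite exprMn -exprM mulrA -mulrA -exprD [(j * i)%N]mulnC -mulnDl.
    over.
  rewrite exchange_big /=.
  under eq_bigr => i _ do rewrite -mulr_sumr (prim_sum _ pw).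
  rewrite (bigD1 (Ordinal kn)) //=.
  rewrite big1 => [|i]; last first.
    rewrite -val_eqE /= => ik; case: ifPn; rewrite ?mulr0 //.
    move=> /dvdnP[c hc]; exfalso; move/eqP: ik; apply.
    by have := ltn_ord i; have := ltnW kn; move: hc; case: c => [|[|c]]; nia.
  rewrite addr0 (subnKC (ltnW kn)) dvdnn.
  by rewrite mulrC mulrA.
have : nc (n%:R * p`_k * toC r ^+ k) <= n%:R * S.
  rewrite -E; apply: le_trans (nc_sum _ _ _) _.
  apply: le_trans (_ : \sum_(j < n) S <= _).
    apply: ler_sum => j _; rewrite ncM nw mulr1; apply: hS.
    by rewrite ncM nw mulr1 nc_toC gtr0_norm.
  by rewrite sumr_const card_ord mulr_natl.
by rewrite !ncM nc_nat ncX nc_toC gtr0_norm // -mulrA ler_pM2l // ltr0n.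
Qed.

(** Cauchy estimates for all coefficients, summed as a geometric series. *)
Lemma poly_inner_bound p r S z : 0 < r -> nc z < r ->
  (forall z, nc z = r -> nc p.[z] <= S) -> nc p.[z] <= (1 - nc z / r)^-1 * S.
Proof.
move=> r0 zr hS; have S0 : 0 <= S.
  by apply: le_trans (hS (toC r) _); rewrite ?nc_ge0 // nc_toC gtr0_norm.
rewrite horner_coef; apply: le_trans (nc_sum _ _ _) _.
apply: le_trans (_ : \sum_(i < size p) (nc z / r) ^+ i * S <= _).
  apply: ler_sum => i _; rewrite ncM ncX expr_div_n mulrAC.
  rewrite ler_pdivlMr ?exprn_gt0 // -mulrA mulrC -mulrA ler_wpM2l ?exprn_ge0 ?nc_ge0 //.
  by rewrite mulrC poly_coef_bound.
rewrite -mulr_suml ler_wpM2r // geo_sum_le ?divr_ge0 ?nc_ge0 ?(ltW r0) //.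
by rewrite ltr_pdivrMr // mul1r.
Qed.

(* Applying the lossy bound to [p ^+ n] and taking n-th roots removes the loss. *)
Lemma poly_max p r S : 0 < r ->
  (forall z, nc z = r -> nc p.[z] <= S) -> forall z, nc z <= r -> nc p.[z] <= S.
Proof.
move=> r0 hS z; rewrite le_eqVlt => /orP[/eqP|zr]; first exact: hS.
have S0 : 0 <= S.
  by apply: le_trans (hS (toC r) _); rewrite ?nc_ge0 // nc_toC gtr0_norm.
apply: (@le_of_expr_le _ _ _ (1 - nc z / r)^-1) => // n.
rewrite -ncX -horner_exp; apply: poly_inner_bound => // y yr.
by rewrite horner_exp ncX lerXn2r ?nnegrE ?nc_ge0 ?hS.
Qed.

Lemma an_max r F S : 0 < r -> an r F ->
  (forall z, nc z = r -> nc (F z) <= S) -> forall z, nc z <= r -> nc (F z) <= S.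
Proof.
move=> r0 aF hS z zr; apply/ler_addgt0Pr => e e0.
have e2 : 0 < e / 2 by rewrite divr_gt0.
have [p hp] := aF _ e2.
have h : nc p.[z] <= S + e / 2.
  apply: poly_max r0 _ _ zr => y yr; have := hp y; rewrite yr lexx => /(_ isT).
  have := hS _ yr; have := nc_lerB p.[y] (F y); rewrite ncBC.
  by lra.
have := hp _ zr; have := nc_lerB (F z) p.[z]; lra.
Qed.

End Disc.

(** * Compactness and completeness in terms of the modulus *)

Section Compactness.
Variable R : realType.
Local Notation C := R[i].
Local Notation toC := (real_complex R).

Lemma bolzano_weierstrass (u : nat -> C) (r : R) : (forall n, nc (u n) <= r) ->
  exists z, forall e, 0 < e -> forall N, exists2 n, (N <= n)%N & nc (u n - z) <= e.
Proof.
move=> ur; pose f n := (complex.Re (u n), complex.Im (u n)).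
have K := compact_setX (@segment_compact R (- r) r) (@segment_compact R (- r) r).
have FF : ProperFilter (f @ \oo)%classic by exact: fmap_proper_filter.
have [|[x y] [_ cl]] := K _ FF.
  exists 0%N => // n _; rewrite /f /=; split; rewrite /= in_itv /= -ler_norml.
    exact: le_trans (nc_Re _) (ur n).
  exact: le_trans (nc_Im _) (ur n).
exists (Complex x y) => e e0 N.
have [||_ [[n Nn <-]]] := cl (f @` [set n | (N <= n)%N])%classic (ball (x, y) (e / 2)).
  exists N => // n /= Nn; by exists n.
  by apply: nbhsx_ballx; rewrite divr_gt0.
rewrite /f; case=> /=; rewrite /ball /= => b1 b2; exists n => //.
apply: le_trans (nc_ReIm _) _; rewrite distrC in b1; rewrite distrC in b2.
by case: (u n) b1 b2 => a b /= b1 b2; apply/ltW; rewrite [e]splitr ltrD.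
Qed.

Lemma nc_complete (u : nat -> C) :
  (forall e, 0 < e -> exists N, forall m n, (N <= m)%N -> (N <= n)%N ->
     nc (u m - u n) <= e) ->
  exists l, forall e, 0 < e -> exists N, forall n, (N <= n)%N -> nc (u n - l) <= e.
Proof.
move=> cu; have [N1 h1] := cu 1 ltr01.
have ub n : nc (u (N1 + n)%N) <= nc (u N1) + 1.
  have := h1 (N1 + n)%N N1 (leq_addr _ _) (leqnn _).
  by have := nc_lerB (u (N1 + n)%N) (u N1); lra.
have [l hl] := bolzano_weierstrass ub; exists l => e e0.
have e2 : 0 < e / 2 by rewrite divr_gt0.
have [N hN] := cu _ e2; exists N => n Nn.
have [m Nm hm] := hl _ e2 N.
have -> : u n - l = (u n - u (N1 + m)%N) + (u (N1 + m)%N - l) by ring.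
apply: le_trans (ncD _ _) _; rewrite [e]splitr lerD // hN //.
by rewrite (leq_trans Nm) ?leq_addl.
Qed.

End Compactness.

(** * Division, inversion and continuity in the disc algebra *)

Section DiscDivision.
Variable R : realType.
Local Notation C := R[i].
Local Notation toC := (real_complex R).
Implicit Types (r S e : R) (F G : C -> C) (p q : {poly C}).

Lemma nc_le_scaled (K : R) (x : C) : (forall e, 0 < e -> nc x <= K * e) -> x = 0.
Proof. by move=> h; apply: nc_le0; apply: ler_eps_mul h. Qed.

Lemma le_add_eps_mul (a b K : R) :
  (forall e, 0 < e -> a <= b + K * e) -> a <= b.
Proof.
by move=> h; rewrite -subr_le0; apply: (@ler_eps_mul _ _ K) => e /h; rewrite lerBlDl.
Qed.

Lemma null_seq : exists eps : nat -> R, (forall n, 0 < eps n) /\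
  forall e, 0 < e -> exists N, forall n, (N <= n)%N -> eps n <= e.
Proof.
exists (fun n => n.+1%:R^-1); split=> [n|e ep]; first by rewrite invr_gt0 ltr0n.
have [N hN] := archi_nat e^-1; exists N => n Nn.
rewrite -[e]invrK lef_pV2 ?posrE ?invr_gt0 ?ltr0n //.
by apply: le_trans hN _; rewrite ler_nat (leq_trans Nn).
Qed.

Lemma poly_quot p (x : C) :
  { q : {poly C} | (forall z, (z - x) * q.[z] = p.[z] - p.[x]) /\ p^`().[x] = q.[x] }.
Proof.
have : root (p - p.[x]%:P) x by rewrite rootE !hornerE subrr.
move/factor_theorem => /constructive_indefinite_description[q hq]; exists q.
have hp : p = q * ('X - x%:P) + p.[x]%:P by rewrite -hq subrK.
split=> [z|]; last first.
  by rewrite [in LHS]hp derivD derivM derivXsubC derivC !hornerE subrr mulr0 add0r.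
by have := congr1 (fun p => p.[z]) hq; rewrite !hornerE mulrC => ->.
Qed.

(** Division by [z - x] for polynomials passes to the limit because, by the maximum principle,
    quotients need only be compared on the circle, where |z - x| is at least [r - nc x]. The last
    clause makes [G x] the limit of the derivatives of the approximants; it serves to differentiate
    power series. *)
Lemma an_div r F (x : C) : nc x < r -> an r F -> F x = 0 ->
  exists G, [/\ an r G, forall z, nc z <= r -> F z = (z - x) * G z &
    forall p e, (forall z, nc z <= r -> nc (F z - p.[z]) <= e) ->
      nc (G x - p^`().[x]) <= 2 * e / (r - nc x)].
Proof.
move=> xr aF Fx; pose d := r - nc x; have d0 : 0 < d by rewrite subr_gt0.
have r0 : 0 < r by apply: le_lt_trans xr; exact: nc_ge0.
pose q p := sval (poly_quot p x).
have q1 p z : (z - x) * (q p).[z] = p.[z] - p.[x].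
  by rewrite /q; case: poly_quot => ? [].
have q2 p : p^`().[x] = (q p).[x] by rewrite /q; case: poly_quot => ? [].
pose apx p e := forall z, nc z <= r -> nc (F z - p.[z]) <= e.
have Q p1 e1 p2 e2 : apx p1 e1 -> apx p2 e2 -> forall z, nc z <= r ->
    nc ((q p1).[z] - (q p2).[z]) <= 2 * (e1 + e2) / d.
  move=> h1 h2 z zr; rewrite -hornerN -hornerD; apply: poly_max r0 _ _ zr => y yr.
  rewrite hornerD hornerN ler_pdivlMr //.
  apply: le_trans (_ : nc (((q p1).[y] - (q p2).[y]) * (y - x)) <= _).
    rewrite ncM ler_wpM2l ?nc_ge0 //; apply: le_trans (nc_lerB _ _).
    by rewrite yr.
  have -> : ((q p1).[y] - (q p2).[y]) * (y - x) =
     (F x - p1.[x]) - (F y - p1.[y]) + (F y - p2.[y]) - (F x - p2.[x]).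
    by rewrite mulrC mulrBr !q1; ring.
  have yr' : nc y <= r by rewrite yr.
  have xr' := ltW xr.
  have := h1 _ yr'; have := h1 _ xr'; have := h2 _ yr'; have := h2 _ xr'.
  have := ncB ((F x - p1.[x]) - (F y - p1.[y]) + (F y - p2.[y])) (F x - p2.[x]).
  have := ncD ((F x - p1.[x]) - (F y - p1.[y])) (F y - p2.[y]).
  have := ncB (F x - p1.[x]) (F y - p1.[y]).
  by lra.
have [eps [e0 small]] := null_seq.
have [P hP] := boolp.choice (fun n => aF _ (e0 n)).
have [l hl] : exists l, forall e, 0 < e -> exists N, forall n, (N <= n)%N ->
    nc ((q (P n)).[x] - l) <= e.
  apply: nc_complete => e ep.
  have [|N hN] := small (e * d / 4); first by rewrite divr_gt0 ?mulr_gt0.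
  exists N => m n Nm Nn; apply: le_trans (Q _ _ _ _ (hP m) (hP n) _ (ltW xr)) _.
  rewrite ler_pdivrMr //; have := hN _ Nm; have := hN _ Nn; lra.
(* At [x] itself the value is the limit of the polynomial quotients. *)
pose G z := if z == x then l else F z / (z - x).
have GQ p e : apx p e -> forall z, nc z <= r -> nc (G z - (q p).[z]) <= 2 * e / d.
  move=> hp z zr; rewrite /G; case: eqVneq => [->|zx].
    apply: (@le_add_eps_mul _ _ (1 + 2 / d)) => e' e'0.
    have [N1 h1] := hl _ e'0; have [N2 h2] := small _ e'0.
    have n1 := leq_maxl N1 N2; have n2 := leq_maxr N1 N2.
    set n := maxn N1 N2 in n1 n2.
    have := Q _ _ _ _ (hP n) hp _ (ltW xr); have := h1 _ n1; have := h2 _ n2.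
    have -> : l - (q p).[x] = ((q (P n)).[x] - (q p).[x]) - ((q (P n)).[x] - l) by ring.
    have := ncB ((q (P n)).[x] - (q p).[x]) ((q (P n)).[x] - l).
    have : eps n <= e' -> 2 * eps n / d <= 2 / d * e'.
      by move=> h; rewrite mulrAC ler_wpM2l // divr_ge0 // ltW.
    move=> h a /h {}h b c.
    apply: le_trans a _; rewrite mulrDr mulrDl in c.
    by lra.
  have zx0 : z - x != 0 by rewrite subr_eq0.
  apply: (@le_add_eps_mul _ _ (2 / d + 2 / nc (z - x))) => e' e'0.
  have [p' hp'] := aF _ e'0.
  have := Q _ _ _ _ hp' hp _ zr.
  have -> : F z / (z - x) - (q p).[z] =
     ((q p').[z] - (q p).[z]) + ((F z - p'.[z]) - (F x - p'.[x])) / (z - x).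
    rewrite Fx -[(q p').[z]](mulfK zx0) [(q p').[z] * _]mulrC q1.
    by field.
  have : nc (((F z - p'.[z]) - (F x - p'.[x])) / (z - x)) <= 2 / nc (z - x) * e'.
    rewrite ncM ncV mulrAC ler_wpM2r ?invr_ge0 ?nc_ge0 //.
    apply: le_trans (ncB _ _) _; have := hp' _ zr; have := hp' _ (ltW xr); lra.
  have := ncD ((q p').[z] - (q p).[z]) (((F z - p'.[z]) - (F x - p'.[x])) / (z - x)).
  move=> a b c; apply: le_trans a _; rewrite mulrDr mulrDl in c.
  by lra.
exists G; split.
- move=> e ep; have [|p hp] := aF (e * d / 2); first by rewrite divr_gt0 ?mulr_gt0.
  exists (q p) => z zr; apply: le_trans (GQ _ _ hp _ zr) _.
  by rewrite ler_pdivrMr //; lra.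
- by move=> z zr; rewrite /G; case: eqVneq => [->|zx]; rewrite ?Fx ?subrr ?mul0r // mulrC mulfVK // subr_eq0.
- by move=> p e hp; rewrite q2 GQ // ltW.
Qed.

(** Truncated geometric series in [z / x]. *)
Lemma an_inv_lin r (x : C) : 0 < r -> r < nc x -> an r (fun z => (z - x)^-1).
Proof.
move=> r0 rx e e0; have x0 : x != 0 by rewrite -nc_gt0 (lt_trans r0).
have nx0 : 0 < nc x by rewrite nc_gt0.
have d0 : 0 < nc x - r by rewrite subr_gt0.
have q0 : 0 <= r / nc x by rewrite divr_ge0 // ltW.
have q1 : r / nc x < 1 by rewrite ltr_pdivrMr // mul1r.
have [N /(_ N (leqnn N)) hN] := expr_small q0 q1 (mulr_gt0 e0 d0).
exists (\sum_(k < N) (- x^-1 ^+ k.+1) *: 'X^k) => z zr.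
have zx : z - x != 0.
  by rewrite subr_eq0; apply: contraTneq rx => <-; rewrite -leNgt.
have -> : (z - x)^-1 - (\sum_(k < N) - x^-1 ^+ k.+1 *: 'X^k).[z] =
    (z / x) ^+ N / (z - x).
  have -> : (\sum_(k < N) - x^-1 ^+ k.+1 *: 'X^k).[z] =
      - x^-1 * \sum_(k < N) (z / x) ^+ k.
    rewrite horner_sum mulr_sumr; apply: eq_bigr => k _.
    by rewrite hornerZ hornerXn exprMn exprS; ring.
  have := subrX1 (z / x) N; set s := \sum_(k < N) _ => h.
  have -> : (z / x) ^+ N = 1 + (z / x - 1) * s by rewrite -h; ring.
  by field; rewrite x0 zx.
rewrite ncM ncX ncM !ncV ler_pdivrMr ?nc_gt0 //.
apply: le_trans (_ : (r / nc x) ^+ N <= _).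
  by rewrite lerXn2r ?nnegrE ?divr_ge0 ?nc_ge0 ?(ltW r0) // ler_wpM2r ?invr_ge0 ?nc_ge0.
apply: le_trans hN _; rewrite ler_wpM2l ?(ltW e0) //.
by rewrite ncBC; apply: le_trans (nc_lerB _ _); rewrite lerD2l lerN2.
Qed.

(** All roots of [p] lie outside the disc, so the inverse is a product of inverted linear
    factors. *)
Lemma an_inv_poly r p : 0 < r -> (forall z, nc z <= r -> p.[z] != 0) ->
  an r (fun z => p.[z]^-1).
Proof.
move=> r0 hp; have [s hs] := closed_field_poly_normal p.
have E z : p.[z] = lead_coef p * \prod_(x <- s) (z - x).
  rewrite {1}hs hornerZ horner_prod; congr (_ * _); apply: eq_bigr => x _.
  by rewrite !hornerE.
have sr x : x \in s -> r < nc x.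
  move=> xs; rewrite ltNge; apply/negP => /hp; rewrite E.
  by rewrite (big_rem x) //= subrr mul0r mulr0 eqxx.
apply: an_ext (an_scale (lead_coef p)^-1
    (an_prod s (P := mem s) (F := fun x z => (z - x)^-1) _)) => [z _|x /sr].
  by rewrite E invfM -big_seq prodfV.
exact: an_inv_lin.
Qed.

Lemma an_inv r F m : 0 < r -> 0 < m -> an r F ->
  (forall z, nc z <= r -> m <= nc (F z)) -> an r (fun z => (F z)^-1).
Proof.
move=> r0 m0 aF hm e e0.
(* The first bound keeps the polynomial above [m / 2] in modulus, the second makes
   [e1 / (m * (m / 2))] at most [e / 2]. *)
pose e1 := Num.min (m / 2) (e * m ^+ 2 / 4).
have e10 : 0 < e1.
  by rewrite lt_min !divr_gt0 //= ?mulr_gt0 ?exprn_gt0.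
have e1m : e1 <= m / 2 by rewrite ge_min lexx.
have e1e : e1 <= e * m ^+ 2 / 4 by rewrite ge_min lexx orbT.
have [p hp] := aF _ e10.
have pm z : nc z <= r -> m / 2 <= nc p.[z].
  move=> zr; have := hp _ zr; have := hm _ zr; have := nc_lerB (F z) (F z - p.[z]).
  have -> : F z - (F z - p.[z]) = p.[z] by ring.
  by lra.
have p0 z : nc z <= r -> p.[z] != 0.
  by move=> /pm h; rewrite -nc_gt0 (lt_le_trans _ h) // divr_gt0.
have e2 : 0 < e / 2 by rewrite divr_gt0.
have [g hg] := an_inv_poly r0 p0 e2; exists g => z zr.
have Fz : F z != 0 by rewrite -nc_gt0 (lt_le_trans m0) ?hm.
have -> : (F z)^-1 - g.[z] = ((p.[z])^-1 - g.[z]) - (F z - p.[z]) / (F z * p.[z]).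
  by field; rewrite Fz p0.
apply: le_trans (ncB _ _) _; rewrite [e]splitr lerD ?hg //.
rewrite ncM ncV ncM ler_pdivrMr; last by rewrite mulr_gt0 ?nc_gt0 ?p0.
apply: le_trans (hp _ zr) _; apply: le_trans e1e _.
apply: le_trans (_ : e / 2 * (m * (m / 2)) <= _); first by rewrite expr2; lra.
by rewrite ler_wpM2l ?(ltW e2) // ler_pM ?hm ?pm // ?divr_ge0 // ltW.
Qed.

Lemma an_continuous r F (x : C) : an r F -> nc x <= r ->
  forall e, 0 < e -> exists2 d, 0 < d &
    forall z, nc z <= r -> nc (z - x) <= d -> nc (F z - F x) <= e.
Proof.
move=> aF xr e e0; have [p hp] := aF _ (divr_gt0 e0 (ltr0n _ 4)).
have [q [hq _]] := poly_quot p x; have [S S0 hS] := poly_bounded r q.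
have S1 : 0 < S + 1 by rewrite ltr_wpDl.
exists (e / 2 / (S + 1)) => [|z zr zx]; first by rewrite !divr_gt0.
have -> : F z - F x = (F z - p.[z]) - (F x - p.[x]) + (z - x) * q.[z].
  by rewrite hq; ring.
have h1 : nc ((z - x) * q.[z]) <= e / 2.
  rewrite ncM -[e / 2](mulfVK (lt0r_neq0 S1)) ler_pM ?nc_ge0 //.
  by apply: le_trans (hS _ zr) _; rewrite lerDl.
have := hp _ zr; have := hp _ xr.
have := ncD ((F z - p.[z]) - (F x - p.[x])) ((z - x) * q.[z]).
have := ncB (F z - p.[z]) (F x - p.[x]); lra.
Qed.

(** [x] may lie on the bounding circle, so it is approached from within, along its radius;
    continuity does the rest. *)
Lemma an_eq_at r F G (x : C) : 0 < r -> an r F -> an r G -> nc x <= r ->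
  (forall z, nc z <= r -> z != x -> F z = G z) -> F x = G x.
Proof.
move=> r0 aF aG xr h; apply/eqP; rewrite -subr_eq0; apply/eqP.
apply: nc_le_eps => e e0.
have [d d0 hd] := an_continuous (an_sub aF aG) xr e0.
suff [z [zr zx zd]] : exists z, [/\ nc z <= r, z != x & nc (z - x) <= d].
  by have := hd _ zr zd; rewrite (h _ zr zx) subrr sub0r ncN.
have [->|x0] := eqVneq x 0.
  exists (toC (Num.min d r)); rewrite subr0 nc_toC gtr0_norm ?lt_min ?d0 //.
  rewrite !ge_min !lexx orbT; split=> //.
  by rewrite -nc_eq0 nc_toC gtr0_norm ?gt_eqF // lt_min ?d0.
have nx0 : 0 < nc x by rewrite nc_gt0.
pose t := Num.min 1 (d / nc x).
have t0 : 0 < t by rewrite lt_min ltr01 divr_gt0.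
have t1 : t <= 1 by rewrite ge_min lexx.
have td : t * nc x <= d by rewrite -ler_pdivlMr // ge_min lexx orbT.
exists (toC (1 - t) * x); split.
- rewrite ncM nc_toC ger0_norm ?subr_ge0 //.
  by apply: le_trans xr; rewrite ger_pMl // gerBl ltW.
- rewrite -subr_eq0 -{2}[x]mul1r -mulrBl mulf_neq0 // -(rmorph1 toC) -rmorphB /=.
  by rewrite -nc_eq0 nc_toC normr_eq0; lra.
- have -> : toC (1 - t) * x - x = toC (- t) * x by rewrite rmorphN rmorphB rmorph1; ring.
  by rewrite ncM nc_toC normrN gtr0_norm.
Qed.

(** Otherwise points where |F| tends to 0 accumulate, by compactness, at a zero. *)
Lemma an_nonzero_ge r F : 0 < r -> an r F -> (forall z, nc z <= r -> F z != 0) ->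
  exists2 m, 0 < m & forall z, nc z <= r -> m <= nc (F z).
Proof.
move=> r0 aF F0; apply: contrapT => H.
have [eps [e0 small]] := null_seq.
have U n : exists z, nc z <= r /\ nc (F z) <= eps n.
  apply: contrapT => Hn; apply: H; exists (eps n) => // z zr.
  by rewrite leNgt; apply/negP => h; apply: Hn; exists z; split=> //; exact: ltW.
have [u hu] := boolp.choice U.
have [x hx] := bolzano_weierstrass (fun n => (hu n).1).
have xr : nc x <= r.
  apply/ler_addgt0Pr => e /hx/(_ 0%N)[n _ h].
  have := (hu n).1; have := nc_lerB x (u n); rewrite ncBC; lra.
have/eqP := F0 _ xr; apply; apply: (@nc_le_scaled 2) => e ep.
have [d d0 hd] := an_continuous aF xr ep.
have [N hN] := small _ ep.
have [n Nn hn] := hx _ d0 N.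
have := hd _ (hu n).1 hn; have := (hu n).2; have := hN _ Nn.
by have := nc_lerB (F x) (F (u n)); rewrite ncBC; lra.
Qed.

End DiscDivision.

(** * Series and power series *)

Section Series.
Variable R : realType.
Local Notation C := R[i].
Local Notation toC := (real_complex R).

(** Summation as a predicate, so that convergence is part of the statement; [rsum] and [csum] are
    total functions. *)
Definition rsums (u : nat -> R) (l : R) := forall e, 0 < e ->
  exists N, forall n, (N <= n)%N -> `|\sum_(k < n) u k - l| <= e.

Definition csums (u : nat -> C) (l : C) := forall e, 0 < e ->
  exists N, forall n, (N <= n)%N -> nc (\sum_(k < n) u k - l) <= e.

Lemma csums_toC u l : rsums u l <-> csums (toC \o u) (toC l).
Proof.
have E n : nc (\sum_(k < n) (toC \o u) k - toC l) = `|\sum_(k < n) u k - l|.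
  by rewrite -rmorph_sum -rmorphB /= nc_toC.
split=> h e e0; have [N hN] := h e e0; exists N => n Nn.
  by rewrite E hN.
by rewrite -E hN.
Qed.

Lemma series_ord (u : nat -> R) n : series u n = \sum_(k < n) u k.
Proof. by rewrite seriesEord. Qed.

Lemma rsumsP u : rsum_cvg u -> rsums u (rsum u).
Proof.
move=> cu e e0; have /cvgrPdist_le/(_ e e0)[N _ hN] := cu.
by exists N => n /hN; rewrite /= distrC series_ord.
Qed.

Lemma rsums_cvg u l : rsums u l -> (series u @ \oo --> l)%classic.
Proof.
move=> h; apply/cvgrPdist_le => e e0; have [N hN] := h _ e0.
by exists N => // n /hN; rewrite /= distrC series_ord.
Qed.

Lemma rsums_rsum u l : rsums u l -> rsum u = l.
Proof. by move=> /rsums_cvg/cvg_lim; apply. Qed.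

Lemma csums_csum u l : csums u l -> csum u = l.
Proof.
move=> h; rewrite /csum; case: l h => a b h; congr Complex; apply: rsums_rsum.
  move=> e e0; have [N hN] := h _ e0; exists N => n /hN; apply: le_trans.
  apply: le_trans (nc_Re _).
  rewrite (_ : complex.Re _ = \sum_(k < n) complex.Re (u k) - a) //.
  rewrite raddfB /=; congr (_ - _); exact: (raddf_sum (@complex.Re R)).
move=> e e0; have [N hN] := h _ e0; exists N => n /hN; apply: le_trans.
apply: le_trans (nc_Im _).
rewrite (_ : complex.Im _ = \sum_(k < n) complex.Im (u k) - b) //.
rewrite raddfB /=; congr (_ - _); exact: (raddf_sum (@complex.Im R)).
Qed.

Lemma csums_uniq u l l' : csums u l -> csums u l' -> l = l'.
Proof. by move=> /csums_csum <- /csums_csum <-. Qed.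

Lemma csums_ext u v l : u =1 v -> csums u l -> csums v l.
Proof.
by move=> /funext ->.
Qed.

Lemma csums_shift u l : csums u l <-> csums (fun k => u k.+1) (l - u 0%N).
Proof.
have E n : \sum_(k < n.+1) u k - l = \sum_(k < n) u k.+1 - (l - u 0%N).
  by rewrite big_ord_recl; ring.
split=> h e /h[N hN].
  by exists N => n Nn; rewrite -E hN // ltnW.
by exists N.+1 => -[//|n]; rewrite ltnS E => /hN.
Qed.

Lemma csumsD u v l l' : csums u l -> csums v l' -> csums (fun k => u k + v k) (l + l').
Proof.
move=> hu hv e e0; have e2 : 0 < e / 2 by rewrite divr_gt0.
have [N hN] := hu _ e2; have [N' hN'] := hv _ e2; exists (maxn N N') => n.
rewrite geq_max => /andP[/hN a /hN' b]; rewrite big_split /= opprD addrACA.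
by apply: le_trans (ncD _ _) _; rewrite [e]splitr lerD.
Qed.

Lemma csumsZ c u l : csums u l -> csums (fun k => c * u k) (c * l).
Proof.
move=> hu e e0; have c1 : 0 < nc c + 1 by rewrite ltr_wpDl ?nc_ge0.
have [N hN] := hu _ (divr_gt0 e0 c1); exists N => n /hN h.
rewrite -mulr_sumr -mulrBr ncM -[e](mulfVK (lt0r_neq0 c1)) mulrC.
by rewrite ler_pM ?nc_ge0 // lerDl.
Qed.

Lemma csums_sum (I : finType) (u : I -> nat -> C) (l : I -> C) :
  (forall i, csums (u i) (l i)) -> csums (fun k => \sum_i u i k) (\sum_i l i).
Proof.
move=> h; suff H (s : seq I) : csums (fun k => \sum_(i <- s) u i k) (\sum_(i <- s) l i).
  exact: H.
elim: s => [|i s IH].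
  move=> e e0; exists 0%N => n _; rewrite big_nil big1 ?subrr ?nc0 ?ltW // => k _.
  by rewrite big_nil.
rewrite big_cons; apply: csums_ext (csumsD (h i) IH) => k; by rewrite big_cons.
Qed.

Lemma csums_bound u l (v : nat -> R) K : csums u l -> (forall k, nc (u k) <= v k) ->
  (forall n, \sum_(k < n) v k <= K) -> nc l <= K.
Proof.
move=> hu uv hv; apply/ler_addgt0Pr => e e0; have [N hN] := hu _ e0.
have -> : l = \sum_(k < N) u k - (\sum_(k < N) u k - l) by ring.
apply: le_trans (ncB _ _) _; rewrite lerD ?hN //.
apply: le_trans (nc_sum _ _ _) _; apply: le_trans (hv N).
exact: ler_sum.
Qed.

Lemma mono_cauchy (s : nat -> R) K : (forall n, s n <= s n.+1) ->
  (forall n, s n <= K) -> forall e, 0 < e ->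
  exists N, forall n m, (N <= n)%N -> s m - s n <= e.
Proof.
move=> s1 sK e e0.
have mono : {homo s : m n / (m <= n)%N >-> m <= n}.
  by apply: homo_leq => // x y z; exact: le_trans.
have hs : has_sup (range s).
  by split; [exists (s 0%N), 0%N | exists K => _ [n _ <-]].
have [_ [N _ <-] hN] := sup_adherent e0 hs.
exists N => n m Nn; have : s m <= sup (range s) by apply: (sup_upper_bound hs); exists m.
by have := mono _ _ Nn; lra.
Qed.

Lemma sum_nat_split (V : zmodType) (u : nat -> V) n m : (n <= m)%N ->
  \sum_(k < m) u k - \sum_(k < n) u k = \sum_(n <= k < m) u k.
Proof.
move=> nm; rewrite -!(big_mkord xpredT u) (big_cat_nat (n := n)) //=.
by rewrite addrAC subrr add0r.
Qed.

Lemma ncsum_tail (u : nat -> C) n m : (n <= m)%N ->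
  nc (\sum_(k < m) u k - \sum_(k < n) u k) <=
  \sum_(k < m) nc (u k) - \sum_(k < n) nc (u k).
Proof.
by move=> nm; rewrite (sum_nat_split u nm) (sum_nat_split (fun k => nc (u k)) nm) nc_sum.
Qed.

Lemma abs_csums (u : nat -> C) K : (forall n, \sum_(k < n) nc (u k) <= K) ->
  csums u (csum u).
Proof.
move=> uK; suff [l hl] : exists l, csums u l by rewrite (csums_csum hl).
apply: nc_complete => e e0.
have Su n : \sum_(k < n) nc (u k) <= \sum_(k < n.+1) nc (u k).
  by rewrite big_ord_recr lerDl nc_ge0.
have [N hN] := mono_cauchy Su uK e0; exists N => m n Nm Nn.
case: (leqP m n) => [mn|/ltnW nm].
  by rewrite ncBC; apply: le_trans (ncsum_tail _ mn) _; exact: hN.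
by apply: le_trans (ncsum_tail _ nm) _; exact: hN.
Qed.

Lemma abs_csums_tail (u : nat -> C) (v : nat -> R) K n :
  (forall k, nc (u k) <= v k) -> (forall m, \sum_(k < m) v k - \sum_(k < n) v k <= K) ->
  nc (\sum_(k < n) u k - csum u) <= K.
Proof.
move=> uv vK.
have v0 k : 0 <= v k by apply: le_trans (uv k); exact: nc_ge0.
have cu : csums u (csum u).
  apply: (@abs_csums _ (K + \sum_(k < n) v k)) => m; rewrite -lerBlDr.
  apply: le_trans (vK m); rewrite lerD2r; exact: ler_sum.
apply/ler_addgt0Pr => e /cu[N hN]; pose m := maxn n N.
have nm : (n <= m)%N by rewrite leq_maxl.
have := hN m (leq_maxr _ _).
have -> : \sum_(k < n) u k - csum u = (\sum_(k < m) u k - csum u)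
  - (\sum_(k < m) u k - \sum_(k < n) u k) by ring.
move=> h1; apply: le_trans (ncB _ _) _; rewrite addrC lerD //.
apply: le_trans (ncsum_tail _ nm) _; apply: le_trans (vK m).
by rewrite (sum_nat_split (fun k => nc (u k)) nm) (sum_nat_split v nm); apply: ler_sum.
Qed.

Lemma rsums_le u v l l' : rsums u l -> rsums v l' -> (forall k, u k <= v k) -> l <= l'.
Proof.
move=> hu hv uv; apply/ler_addgt0Pr => e e0; have e2 : 0 < e / 2 by rewrite divr_gt0.
have [N hN] := hu _ e2; have [N' hN'] := hv _ e2.
have := hN _ (leq_maxl N N'); have := hN' _ (leq_maxr N N').
set n := maxn N N'; have : \sum_(k < n) u k <= \sum_(k < n) v k by apply: ler_sum.
by rewrite !ler_norml => a /andP[b c] /andP[d f]; lra.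
Qed.

Lemma rsums_uniq u l l' : rsums u l -> rsums u l' -> l = l'.
Proof. by move=> /rsums_rsum <- /rsums_rsum <-. Qed.

Lemma rsums_ext u v l : u =1 v -> rsums u l -> rsums v l.
Proof.
by move=> /funext ->.
Qed.

Lemma rsumsD u v l l' : rsums u l -> rsums v l' -> rsums (fun k => u k + v k) (l + l').
Proof.
move=> /csums_toC hu /csums_toC hv; apply/csums_toC; rewrite rmorphD.
by apply: csums_ext (csumsD hu hv) => k /=; rewrite rmorphD.
Qed.

Lemma rsumsZ c u l : rsums u l -> rsums (fun k => c * u k) (c * l).
Proof.
move=> /csums_toC hu; apply/csums_toC; rewrite rmorphM.
by apply: csums_ext (csumsZ _ hu) => k /=; rewrite rmorphM.
Qed.

Lemma rsums_sum (I : finType) (u : I -> nat -> R) (l : I -> R) :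
  (forall i, rsums (u i) (l i)) -> rsums (fun k => \sum_i u i k) (\sum_i l i).
Proof.
move=> h; apply/csums_toC; rewrite rmorph_sum.
apply: csums_ext (csums_sum (fun i => (csums_toC _ _).1 (h i))) => k /=.
by rewrite rmorph_sum.
Qed.

Lemma rsums_partial_le u l n : (forall k, 0 <= u k) -> rsums u l -> \sum_(k < n) u k <= l.
Proof.
move=> u0 hu; apply/ler_addgt0Pr => e e0; have [N hN] := hu _ e0.
have := hN _ (leq_maxr n N); rewrite ler_norml => /andP[_].
have : \sum_(k < n) u k <= \sum_(k < maxn n N) u k.
  by rewrite -subr_ge0 sum_nat_split ?leq_maxl // sumr_ge0.
by lra.
Qed.

(** Nonnegative terms with sum 0 vanish. This turns equality of two sums into equality for every
    single transition. *)
Lemma rsums_eq_of_le u v l : rsums u l -> rsums v l -> (forall k, u k <= v k) -> u =1 v.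
Proof.
move=> hu hv uv k; apply/eqP; rewrite eq_le uv /= -subr_le0.
have h : rsums (fun k => v k - u k) (l - l).
  rewrite -[- l]mulN1r; apply: rsums_ext (rsumsD hv (rsumsZ (-1) hu)) => i.
  by rewrite mulN1r.
have d0 i : 0 <= v i - u i by rewrite subr_ge0.
have := rsums_partial_le k.+1 d0 h; rewrite subrr big_ord_recr /=.
have : 0 <= \sum_(i < k) (v i - u i) by apply: sumr_ge0 => i _; exact: d0.
by lra.
Qed.

(** The square of indices below [n] minus the triangle of the Cauchy product is the corner
    [n <= i + j]. *)
Lemma cauchy_rect (V : comPzRingType) (a b : nat -> V) n :
  (\sum_(i < n) a i) * (\sum_(i < n) b i) - \sum_(k < n) \sum_(i < k.+1) a i * b (k - i)%N
  = \sum_(i < n) \sum_(j < n | (n <= i + j)%N) a i * b j.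
Proof.
rewrite big_distrlr /=.
have -> : \sum_(k < n) \sum_(i < k.+1) a i * b (k - i)%N =
   \sum_(i < n) \sum_(j < n | (i + j < n)%N) a i * b j.
  transitivity (\sum_(k < n) \sum_(i < n | (i <= k)%N) a i * b (k - i)%N).
    apply: eq_bigr => k _; exact: (big_ord_widen n (fun i => a i * b (k - i)%N)).
  rewrite (exchange_big_dep xpredT) //=; apply: eq_bigr => i _.
  rewrite -(big_mkord (fun j => (i <= j)%N) (fun j => a i * b (j - i)%N)).
  rewrite -(big_mkord (fun j => (i + j < n)%N) (fun j => a i * b j)).
  rewrite (big_cat_nat (n := i)) //= ?(ltnW (ltn_ord i)) //.
  rewrite big_nat_cond big_pred0 ?add0r; last first.
    by move=> j; apply/negP => /andP[/andP[_ h1] h2]; lia.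
  rewrite -{1}[val i]add0n big_addn [RHS](big_cat_nat (n := (n - i)%N)) ?leq_subr //=.
  rewrite [X in _ = _ + X]big_nat_cond [X in _ = _ + X]big_pred0 ?addr0; last first.
    by move=> j; apply/negP => /andP[/andP[h1 _] h2]; lia.
  rewrite big_nat_cond [RHS]big_nat_cond; apply: eq_big => [j|j _].
    by have := ltn_ord i; lia.
  by rewrite addnK.
rewrite -sumrB; apply: eq_bigr => i _.
rewrite (bigID (fun j : 'I_n => (i + j < n)%N)) /= addrAC subrr add0r.
by apply: eq_bigl => j; rewrite -leqNgt.
Qed.

(** Both series converge absolutely, so the corner of [cauchy_rect] is dominated by the tails of the
    series of moduli. *)
Lemma csums_cauchy_prod (a b : nat -> C) la lb Ka Kb :
  csums a la -> csums b lb ->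
  (forall n, \sum_(k < n) nc (a k) <= Ka) -> (forall n, \sum_(k < n) nc (b k) <= Kb) ->
  csums (fun n => \sum_(i < n.+1) a i * b (n - i)%N) (la * lb).
Proof.
move=> ha hb aK bK.
have K0 : 0 <= Ka by apply: le_trans (aK 0%N); rewrite big_ord0.
have K0' : 0 <= Kb by apply: le_trans (bK 0%N); rewrite big_ord0.
pose Sa n := \sum_(k < n) nc (a k); pose Sb n := \sum_(k < n) nc (b k).
have Sa1 n : Sa n <= Sa n.+1 by rewrite /Sa big_ord_recr lerDl nc_ge0.
have Sb1 n : Sb n <= Sb n.+1 by rewrite /Sb big_ord_recr lerDl nc_ge0.
have Sa0 n : 0 <= Sa n by apply: sumr_ge0 => i _; exact: nc_ge0.
have Sb0 n : 0 <= Sb n by apply: sumr_ge0 => i _; exact: nc_ge0.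
move=> e e0; pose d := e / (1 + Ka + Kb + nc lb + Ka).
have D0 : 0 < 1 + Ka + Kb + nc lb + Ka.
  by have := nc_ge0 lb; lra.
have d0 : 0 < d by rewrite divr_gt0.
have [N1 h1] := ha _ d0; have [N2 h2] := hb _ d0.
have [N3 h3] := mono_cauchy Sa1 aK d0; have [N4 h4] := mono_cauchy Sb1 bK d0.
(* With [n] at least [2 N], the corner [n <= i + j] avoids the square [i, j < N]. *)
pose N := maxn (maxn N1 N2) (maxn N3 N4); exists N.*2 => n Nn.
have Nn' : (N <= n)%N by lia.
have n1 : (N1 <= n)%N by lia.
have n2 : (N2 <= n)%N by lia.
set An := \sum_(i < n) a i; set Bn := \sum_(i < n) b i.
have -> : \sum_(k < n) \sum_(i < k.+1) a i * b (k - i)%N - la * lb =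
   (An - la) * lb + An * (Bn - lb) - \sum_(i < n) \sum_(j < n | (n <= i + j)%N) a i * b j.
  by rewrite -cauchy_rect /An /Bn; ring.
have R1 : nc (\sum_(i < n) \sum_(j < n | (n <= i + j)%N) a i * b j) <=
    Sa n * Sb n - Sa N * Sb N.
  apply: le_trans (_ : \sum_(i < n) \sum_(j < n | (n <= i + j)%N) nc (a i) * nc (b j) <= _).
    apply: le_trans (nc_sum _ _ _) _; apply: ler_sum => i _.
    apply: le_trans (nc_sum _ _ _) _; apply: ler_sum => j _.
    by rewrite ncM.
  rewrite /Sa /Sb !big_distrlr /= lerBrDr.
  rewrite (big_ord_widen n (fun i => \sum_(j < N) nc (a i) * nc (b j)) Nn').
  rewrite [X in _ + X]big_mkcond /= -big_split /=; apply: ler_sum => i _.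
  case: ltnP => iN; last first.
    rewrite addr0 [leRHS](bigID (fun j : 'I_n => (n <= i + j)%N)) /= lerDl.
    by apply: sumr_ge0 => j _; rewrite mulr_ge0 ?nc_ge0.
  rewrite (big_ord_widen n (fun j => nc (a i) * nc (b j)) Nn').
  rewrite big_mkcond [X in _ + X]big_mkcond -big_split /=; apply: ler_sum => j _.
  have : 0 <= nc (a i) * nc (b j) by rewrite mulr_ge0 ?nc_ge0.
  case: leqP => ij; case: ltnP => jN; rewrite ?addr0 ?add0r //.
  by exfalso; lia.
have R2 : Sa n * Sb n - Sa N * Sb N <= Ka * d + Kb * d.
  have -> : Sa n * Sb n - Sa N * Sb N = Sa n * (Sb n - Sb N) + Sb N * (Sa n - Sa N) by ring.
  have := h3 N n; have := h4 N n; rewrite !leq_max !leqnn !orbT /= => /(_ isT) i4 /(_ isT) i3.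
  apply: lerD.
    by apply: le_trans (_ : Sa n * d <= _); [rewrite ler_wpM2l|rewrite ler_wpM2r ?(ltW d0) ?aK].
  by apply: le_trans (_ : Sb N * d <= _); [rewrite ler_wpM2l|rewrite ler_wpM2r ?(ltW d0) ?bK].
have R3 : nc ((An - la) * lb) <= nc lb * d by rewrite ncM mulrC ler_wpM2l ?nc_ge0 ?h1.
have R4 : nc (An * (Bn - lb)) <= Ka * d.
  rewrite ncM ler_pM ?nc_ge0 ?h2 //; apply: le_trans (nc_sum _ _ _) _; exact: aK.
apply: le_trans (ncB _ _) _.
have := ncD ((An - la) * lb) (An * (Bn - lb)).
have : (1 + Ka + Kb + nc lb + Ka) * d = e by rewrite /d mulrC mulfVK // gt_eqF.
by move: R1 R2 R3 R4; set S := \sum_(i < n) _; nra.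
Qed.

End Series.

(** * Power series on closed discs *)

Section PowerSeries.
Variable R : realType.
Local Notation C := R[i].
Local Notation toC := (real_complex R).
Implicit Types (r S e : R) (F G : C -> C) (p q : {poly C}) (a : nat -> C).

Definition ps a (z : C) : C := csum (fun k => a k * z ^+ k).
Definition l1 a r := exists K : R, forall n, \sum_(k < n) nc (a k) * r ^+ k <= K.

Lemma nc_term_le a r z k : nc z <= r -> nc (a k * z ^+ k) <= nc (a k) * r ^+ k.
Proof.
move=> zr; rewrite ncM ncX ler_wpM2l ?nc_ge0 // lerXn2r ?nnegrE ?nc_ge0 //.
by apply: le_trans zr; exact: nc_ge0.
Qed.

Lemma ps_csums a r z : l1 a r -> nc z <= r -> csums (fun k => a k * z ^+ k) (ps a z).
Proof.
move=> [K hK] zr; apply: (@abs_csums _ _ K) => n; apply: le_trans (hK n).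
by apply: ler_sum => k _; exact: nc_term_le.
Qed.

Lemma ps_uniform a r : 0 <= r -> l1 a r -> forall e, 0 < e -> exists N, forall n, (N <= n)%N ->
  forall z, nc z <= r -> nc (ps a z - (\poly_(k < n) a k).[z]) <= e.
Proof.
move=> r0 [K hK] e e0.
have mono n : \sum_(k < n) nc (a k) * r ^+ k <= \sum_(k < n.+1) nc (a k) * r ^+ k.
  by rewrite big_ord_recr lerDl mulr_ge0 ?nc_ge0 ?exprn_ge0.
have [N hN] := mono_cauchy mono hK e0; exists N => n Nn z zr.
rewrite horner_poly ncBC.
apply: (@abs_csums_tail _ (fun k => a k * z ^+ k) (fun k => nc (a k) * r ^+ k)).
  by move=> k; exact: nc_term_le.
by move=> m; exact: hN.
Qed.

Lemma ps_an a r : 0 <= r -> l1 a r -> an r (ps a).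
Proof.
move=> r0 la e e0; have [N hN] := ps_uniform r0 la e0.
by exists (\poly_(k < N) a k) => z zr; exact: hN.
Qed.

(** The continuation [F] is not known to be a power series on the larger disc. A polynomial close to
    [F] there has bounded coefficients by the Cauchy estimate at radius [r], and they are close to
    those of [a] by the same estimate at radius 1. *)
Lemma ps_coef_bound a r F : l1 a 1 -> 1 <= r -> an r F ->
  (forall z, nc z <= 1 -> F z = ps a z) ->
  exists S, forall k, nc (a k) * r ^+ k <= S.
Proof.
move=> la r1 aF FE; have [S S0 hS] := an_bounded aF.
have r0 : 0 < r by apply: lt_le_trans r1.
exists S => k; apply: (@le_add_eps_mul _ _ _ (1 + 2 * r ^+ k)) => e e0.
have [p hp] := aF _ e0; have [N hN] := ps_uniform ler01 la e0.
pose n := maxn N k.+1; have {}hN := hN n (leq_maxl _ _).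
have h1 : nc p`_k * r ^+ k <= S + e.
  apply: poly_coef_bound => // z zr; have zr' : nc z <= r by rewrite zr.
  by have := hp _ zr'; have := hS _ zr'; have := nc_lerB p.[z] (F z); rewrite ncBC; lra.
have h2 : nc (a k - p`_k) * 1 ^+ k <= 2 * e.
  have -> : a k - p`_k = ((\poly_(k < n) a k) - p)`_k.
    by rewrite coefB coef_poly leq_maxr.
  apply: poly_coef_bound => // z z1; have z1' : nc z <= 1 by rewrite z1.
  rewrite hornerD hornerN.
  have := hN _ z1'; have := hp _ (le_trans z1' r1); rewrite FE //.
  move: (_.[z]) => u; move: p.[z] => w; move: (ps a z) => y.
  have -> : u - w = (y - w) - (y - u) by ring.
  by have := ncB (y - w) (y - u); lra.
rewrite expr1n mulr1 in h2.
have h3 : nc (a k) <= nc p`_k + 2 * e by have := nc_lerB (a k) p`_k; lra.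
have rk : 0 < r ^+ k by rewrite exprn_gt0.
apply: le_trans (_ : (nc p`_k + 2 * e) * r ^+ k <= _); first by rewrite ler_wpM2r // ltW.
lra.
Qed.

Lemma an_diff r F (x : C) : nc x < r -> an r F ->
  exists G, [/\ an r G, forall z, nc z <= r -> F z = F x + (z - x) * G z &
    forall p e, (forall z, nc z <= r -> nc (F z - p.[z]) <= e) ->
      nc (G x - p^`().[x]) <= 2 * e / (r - nc x)].
Proof.
move=> xr aF.
have [|G [aG GE Gd]] := @an_div _ r (fun z => F z - F x) x xr (an_sub aF (an_cst r (F x))).
  by rewrite subrr.
exists G; split=> // [z zr|p e hp]; first by rewrite -GE // addrC subrK.
have := Gd (p - (F x)%:P) e; rewrite derivB derivC subr0; apply=> z zr.
rewrite hornerD hornerN hornerC.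
have -> : F z - F x - (p.[z] - F x) = F z - p.[z] by ring.
exact: hp.
Qed.

(** The partial sums serve as approximating polynomials in the last clause of [an_diff], so the
    quotient at [x] is the termwise derivative. *)
Lemma ps_diff a r (x : C) : 0 <= r -> nc x < r -> l1 a r ->
  exists G, [/\ an r G, forall z, nc z <= r -> ps a z = ps a x + (z - x) * G z &
    csums (fun k => k%:R * a k * x ^+ k.-1) (G x)].
Proof.
move=> r0 xr la; have [G [aG GE Gd]] := an_diff xr (ps_an r0 la).
exists G; split=> // e e0; have d0 : 0 < r - nc x by rewrite subr_gt0.
have [|N hN] := @ps_uniform a r r0 la (e * (r - nc x) / 2).
  by rewrite divr_gt0 ?mulr_gt0.
exists N => n Nn; have := Gd _ _ (hN n Nn).
have -> : 2 * (e * (r - nc x) / 2) / (r - nc x) = e by field; rewrite gt_eqF.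
rewrite ncBC; congr (nc (_ - _) <= _).
have -> : (\poly_(k < n) a k)^`() = \sum_(k < n) (a k *+ k) *: 'X^(k.-1).
  rewrite poly_def raddf_sum; apply: eq_bigr => k _ /=.
  by rewrite derivZ derivXn -scalerMnl -scalerMnr.
rewrite horner_sum; apply: eq_bigr => k _.
by rewrite hornerZ hornerXn mulr_natl.
Qed.

End PowerSeries.

(** * Zeros in the disc algebra *)

Section Zeros.
Variable R : realType.
Local Notation C := R[i].
Local Notation toC := (real_complex R).
Implicit Types (r S e : R) (F G : C -> C) (p q : {poly C}) (s : seq C).

Lemma ncsq (z : C) : nc z ^+ 2 = complex.Re z ^+ 2 + complex.Im z ^+ 2.
Proof. by rewrite /nc normc_def /= sqr_sqrtr ?addr_ge0 ?sqr_ge0. Qed.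

(** On |z| = r the right side vanishes, so the Blaschke factor and [z - x] have the same modulus up
    to the constant [r]; inside the disc the right side measures the gain. *)
Lemma blaschke_identity (r : R) (z x : C) :
  nc (toC (r ^+ 2) - conjc x * z) ^+ 2 - r ^+ 2 * nc (z - x) ^+ 2 =
  (r ^+ 2 - nc z ^+ 2) * (r ^+ 2 - nc x ^+ 2).
Proof. by case: z x => [a b] [c d]; rewrite !ncsq /=; ring. Qed.

(* Trading each zero for a Blaschke factor keeps the modulus on |z| = r1 and enlarges it at [z0]. *)
Lemma zeros_bounded r1 r F (z0 : C) : 0 < r -> r < r1 -> an r1 F -> nc z0 < r1 ->
  F z0 != 0 -> exists n0, forall s G, (forall x, x \in s -> nc x <= r) -> an r1 G ->
    (forall z, nc z <= r1 -> F z = (\prod_(x <- s) (z - x)) * G z) -> (size s <= n0)%N.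
Proof.
move=> r0 rr1 aF z0r Fz0; have [S S0 hS] := an_bounded aF.
have r10 : 0 < r1 by apply: lt_trans rr1.
have sq x y : 0 <= x -> x < y -> 0 < y ^+ 2 - x ^+ 2 :> R.
  by move=> x0 xy; rewrite subr_gt0 ltrXn2r // ?nnegrE ?(le_trans x0) ?ltW.
pose c := (r1 ^+ 2 - nc z0 ^+ 2) * (r1 ^+ 2 - r ^+ 2).
have c0 : 0 < c by rewrite mulr_gt0 ?sq ?nc_ge0 ?ltW.
(* Each exchanged factor multiplies the squared modulus at [z0] by at least [1 + d]: [4 * r1 ^+ 2]
   bounds [nc (z0 - x) ^+ 2], and the other [r1 ^+ 2] comes from the normalization of the factor. *)
pose d := c / (4 * r1 ^+ 4).
have d0 : 0 < d by apply: divr_gt0 => //; rewrite mulr_gt0 ?exprn_gt0.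
have Fz0' : 0 < nc (F z0) by rewrite nc_gt0.
have [n0 hn0] := archi_nat ((S / nc (F z0)) ^+ 2 / d).
exists n0 => s G hs aG FE.
pose B z := G z * \prod_(x <- s) ((toC (r1 ^+ 2) - conjc x * z) / toC r1).
have aB : an r1 B.
  apply: an_mul => //; apply: (@an_prod _ r1 _ s xpredT) => x _.
  apply: an_mul; last exact: an_cst.
  apply: an_sub; first exact: an_cst.
  by apply: an_scale; exact: an_id.
have hB : nc (B z0) <= S.
  apply: (an_max r10 aB _ (ltW z0r)) => z zr.
  have -> : nc (B z) = nc (F z).
    rewrite FE ?zr // /B !ncM mulrC; congr (_ * _); rewrite !nc_prod.
    apply: eq_bigr => x _; rewrite ncM ncV nc_toC gtr0_norm //.
    have := blaschke_identity r1 z x; rewrite zr subrr mul0r => /eqP.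
    rewrite subr_eq0 -exprMn eqrXn2 ?mulr_ge0 ?nc_ge0 ?(ltW r10) // => /eqP ->.
    by rewrite mulrC mulKf // gt_eqF.
  by apply: hS; rewrite zr.
have key : (1 + d) ^+ size s * nc (F z0) ^+ 2 <= nc (B z0) ^+ 2.
  rewrite (FE _ (ltW z0r)) /B !ncM !nc_prod !exprMn mulrA [leRHS]mulrC.
  rewrite ler_wpM2r ?sqr_ge0 // -!prodrXl.
  have -> : (1 + d) ^+ size s = \prod_(x <- s) (1 + d).
    by rewrite big_const_seq count_predT iter_mulr_1.
  rewrite -big_split big_seq [leRHS]big_seq /=.
  apply: ler_prod => x xs; rewrite mulr_ge0 ?sqr_ge0 ?addr_ge0 ?(ltW d0) //=.
  rewrite ncM ncV nc_toC gtr0_norm // expr_div_n ler_pdivlMr ?exprn_gt0 //.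
  have := blaschke_identity r1 z0 x.
  have xr := hs _ xs.
  have : r1 ^+ 2 - r ^+ 2 <= r1 ^+ 2 - nc x ^+ 2.
    by rewrite lerB // lerXn2r ?nnegrE ?nc_ge0 // ltW.
  move=> /(ler_wpM2l (ltW (sq _ _ (nc_ge0 z0) z0r))) h1 h2.
  have h3 : nc (z0 - x) ^+ 2 <= (2 * r1) ^+ 2.
    rewrite lerXn2r ?nnegrE ?nc_ge0 ?mulr_ge0 ?(ltW r10) //.
    by apply: le_trans (ncB _ _) _; lra.
  have h4 : d * nc (z0 - x) ^+ 2 * r1 ^+ 2 <= c.
    have -> : c = d * (2 * r1) ^+ 2 * r1 ^+ 2 by rewrite /d; field; rewrite gt_eqF.
    by rewrite ler_wpM2r ?sqr_ge0 // ler_wpM2l ?(ltW d0).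
  rewrite /c in h4; lra.
have h5 : (1 + d) ^+ size s <= (S / nc (F z0)) ^+ 2.
  rewrite expr_div_n ler_pdivlMr ?exprn_gt0 //; apply: le_trans key _.
  by rewrite lerXn2r ?nnegrE ?nc_ge0 ?(ltW S0).
have h6 := bernoulli_ge (size s) (ltW d0).
rewrite -(@ler_nat R); apply: le_trans hn0.
by rewrite ler_pdivlMr //; lra.
Qed.

(** Zeros in the disc of radius [r] are divided out one by one; [zeros_bounded] bounds their number,
    hence the induction on the remaining allowance [n0 - size s]. *)
Lemma an_factor r1 r F (z0 : C) : 0 < r -> r < r1 -> an r1 F -> nc z0 < r1 ->
  F z0 != 0 -> exists s G, [/\ forall x, x \in s -> nc x <= r, an r1 G,
    forall z, nc z <= r1 -> F z = (\prod_(x <- s) (z - x)) * G z &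
    forall z, nc z <= r -> G z != 0].
Proof.
move=> r0 rr1 aF z0r Fz0; have [n0 hn0] := zeros_bounded r0 rr1 aF z0r Fz0.
suff H k : forall s G, (n0 - size s <= k)%N -> (forall x, x \in s -> nc x <= r) -> an r1 G ->
    (forall z, nc z <= r1 -> F z = (\prod_(x <- s) (z - x)) * G z) ->
    exists s G, [/\ forall x, x \in s -> nc x <= r, an r1 G,
    forall z, nc z <= r1 -> F z = (\prod_(x <- s) (z - x)) * G z &
    forall z, nc z <= r -> G z != 0].
  apply: (H n0 [::] F) => // [|z _]; first by rewrite leq_subr.
  by rewrite big_nil mul1r.
elim: k => [|k IH] s G sk hs aG FE.
all: case: (pselect (forall z, nc z <= r -> G z != 0)) => [h|]; first by exists s, G.
all: move=> /existsNP[x /not_implyP[xr /negP]]; rewrite negbK => /eqP Gx.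
all: have [G' [aG' GE _]] := an_div (le_lt_trans xr rr1) aG Gx.
all: have FE' z : nc z <= r1 -> F z = (\prod_(x <- x :: s) (z - x)) * G' z.
1,3: by move=> zr; rewrite FE // GE // big_cons; ring.
all: have hs' y : y \in x :: s -> nc y <= r by rewrite inE => /orP[/eqP ->|/hs].
all: have /= sn := hn0 _ _ hs' aG' FE'.
  by move: sk; rewrite leqn0 subn_eq0 leqNgt sn.
apply: IH hs' aG' FE' => /=; lia.
Qed.

(** Otherwise [an_factor] leaves finitely many zeros in the disc, but the points [r / k.+1] are
    infinitely many of them. *)
Lemma an_identity r1 r F : 0 < r -> r < r1 -> an r1 F ->
  (forall z, nc z <= r -> F z = 0) -> forall z, nc z < r1 -> F z = 0.
Proof.
move=> r0 rr1 aF F0 z0 z0r; apply/eqP; apply: contraT => Fz0.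
have [s [G [hs aG FE G0]]] := an_factor r0 rr1 aF z0r Fz0.
pose f (k : nat) : C := toC (r / k.+1%:R).
have fr k : nc (f k) <= r.
  rewrite nc_toC ger0_norm ?divr_ge0 ?(ltW r0) // ler_pdivrMr ?ltr0n //.
  by rewrite ler_pMr // ler1n.
have fs k : f k \in s.
  have := F0 _ (fr k); rewrite FE; last by rewrite (le_trans (fr k)) ?ltW.
  move/eqP; rewrite mulf_eq0 (negbTE (G0 _ (fr k))) orbF.
  case: (boolP (f k \in s)) => // ks; rewrite prodf_seq_eq0 => /hasP[x xs].
  by rewrite subr_eq0 => /eqP e; rewrite e xs in ks.
have inj : injective f.
  move=> i j /complexI /(mulfI (lt0r_neq0 r0)) /invr_inj /eqP.
  by rewrite eqr_nat => /eqP [].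
have : uniq (map f (iota 0 (size s).+1)) by rewrite map_inj_uniq ?iota_uniq.
move=> /uniq_leq_size h; have := h s; rewrite size_map size_iota ltnn; apply.
by move=> _ /mapP[k _ ->].
Qed.

Lemma an_div_seq r F s : an r F -> uniq s -> (forall x, x \in s -> nc x < r /\ F x = 0) ->
  exists2 G, an r G & forall z, nc z <= r -> F z = (\prod_(x <- s) (z - x)) * G z.
Proof.
elim: s F => [|x s IH] F aF; first by exists F => // z _; rewrite big_nil mul1r.
move=> /= /andP[xs us] h; have [xr Fx] := h x (mem_head _ _).
have [G [aG GE _]] := an_div xr aF Fx.
have [|G' aG' GE'] := IH G aG us.
  move=> y ys; have [yr Fy] := h y (mem_behead (s := x :: s) ys); split=> //.
  move/eqP: Fy; rewrite GE ?ltW // mulf_eq0 subr_eq0 => /orP[/eqP e|/eqP //].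
  by rewrite -e ys in xs.
exists G' => // z zr; rewrite GE // GE' // big_cons; ring.
Qed.

End Zeros.

(** Fredholm alternative, read on the transpose, where it is a row-space inclusion tested against
    the cokernel. *)
Lemma mx_solvable (F : fieldType) n (K : 'M[F]_n) (b : 'cV[F]_n) :
  (forall w : 'rV_n, w *m K = 0 -> w *m b = 0) -> exists g : 'cV_n, K *m g = b.
Proof.
move=> h; have : (b^T <= K^T)%MS.
  rewrite submxE -(inj_eq (@trmx_inj _ _ _)) trmx_mul trmxK trmx0.
  apply/eqP/row_matrixP => i; rewrite row_mul row0; apply: h.
  by rewrite -row_mul -[X in _ *m X]trmxK -trmx_mul mulmx_coker trmx0 row0.
case/submxP => D hD; exists D^T.
by rewrite -[K]trmxK -trmx_mul -hD trmxK.
Qed.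

(** * Perron-Frobenius theory *)

Section PerronFrobenius.
Variable R : realType.
Local Notation C := R[i].
Local Notation toC := (real_complex R).

Definition nonneg_mx m n (X : 'M[R]_(m, n)) := forall i j, 0 <= X i j.

Lemma mulmx_nonneg m n p (X : 'M[R]_(m, n)) (Y : 'M[R]_(n, p)) :
  nonneg_mx X -> nonneg_mx Y -> nonneg_mx (X *m Y).
Proof. by move=> hX hY i j; rewrite mxE sumr_ge0 // => k _; rewrite mulr_ge0. Qed.

Lemma expr_nonneg n (X : 'M[R]_n.+1) k : nonneg_mx X -> nonneg_mx (X ^+ k).
Proof.
move=> hX; elim: k => [|k IH] i j; first by rewrite expr0 mxE ler0n.
by rewrite exprS; exact: mulmx_nonneg.
Qed.

Lemma mulmx_pos m n p (X : 'M[R]_(m, n)) (Y : 'M[R]_(n, p)) i k j :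
  nonneg_mx X -> nonneg_mx Y -> 0 < X i k -> 0 < Y k j -> 0 < (X *m Y) i j.
Proof.
move=> hX hY Xik Ykj; rewrite mxE (bigD1 k) //= ltr_wpDr ?mulr_gt0 //.
by apply: sumr_ge0 => l _; rewrite mulr_ge0.
Qed.

Lemma fin_pos_lower (I : finType) (f : I -> R) : (forall i, 0 < f i) ->
  exists2 e, 0 < e & forall i, e <= f i.
Proof.
move=> f0; have S0 : 0 < 1 + \sum_i (f i)^-1.
  by rewrite ltr_pwDl // sumr_ge0 // => i _; rewrite invr_ge0 ltW.
exists (1 + \sum_i (f i)^-1)^-1 => [|i]; first by rewrite invr_gt0.
rewrite -[f i]invrK lef_pV2 ?posrE ?invr_gt0 //.
rewrite (bigD1 i) //= addrCA lerDl addr_ge0 // sumr_ge0 // => j _.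
by rewrite invr_ge0 ltW.
Qed.

Lemma nonneg_row_pos n (z : 'rV[R]_n) : nonneg_mx z -> z != 0 -> exists i, 0 < z 0 i.
Proof.
move=> z0 zn0; apply: contrapT => h; move/eqP: zn0; apply; apply/rowP => i.
rewrite [RHS]mxE; apply/eqP; rewrite eq_le z0 andbT leNgt.
by apply/negP => zi; apply: h; exists i.
Qed.

Section Irreducible.
Variables (n : nat) (B : 'M[R]_n.+1).
Hypothesis B0 : nonneg_mx B.
Hypothesis Birr : mx_irreducible B.

Let B1 := 1%:M + B.

Let B1_ge0 : nonneg_mx B1.
Proof. by move=> i j; rewrite !mxE addr_ge0 // ler0n. Qed.

Let B1X_ge0 k : nonneg_mx (B1 ^+ k).
Proof. exact: expr_nonneg. Qed.

Let B1_diag i : 0 < B1 i i.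
Proof. by rewrite !mxE eqxx ltr_pwDl. Qed.

Let B1X_diag k i : 0 < (B1 ^+ k) i i.
Proof.
elim: k => [|k IH]; first by rewrite expr0 mxE eqxx.
by rewrite exprS; apply: mulmx_pos (B1_diag i) IH.
Qed.

(** [1 + B] has a positive diagonal, so a positive entry stays positive in higher powers and the
    path lengths for all pairs can be raised to their maximum. *)
Lemma irreducible_power_pos : exists N, forall i j, 0 < ((1%:M + B) ^+ N) i j.
Proof.
have step k i j l : 0 < (B1 ^+ k) i j -> 0 < (B1 ^+ (k + l)) i j.
  by move=> h; rewrite exprD; apply: mulmx_pos h (B1X_diag l j).
have H i j : exists N, 0 < (B1 ^+ N) i j.
  elim: (Birr i j) => [a b ab|a|a b c _ [N1 h1] _ [N2 h2]].
  - by exists 1%N; rewrite expr1 !mxE ltr_wpDl // ler0n.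
  - by exists 0%N; exact: B1X_diag.
  - by exists (N1 + N2)%N; rewrite exprD; apply: mulmx_pos h1 h2.
have [f hf] := boolp.choice (fun ij : 'I_n.+1 * 'I_n.+1 => H ij.1 ij.2).
exists (\max_ij f ij)%N => i j.
have le := leq_bigmax_cond (F := f) (i, j) (P := xpredT) isT.
by rewrite -(subnKC le); apply: step; exact: (hf (i, j)).
Qed.

(** Multiplying [y] by a positive power of [1 + B] gives a positive vector, and also a positive
    multiple of [y]. *)
Lemma eigen_row_pos (r : R) (y : 'rV[R]_n.+1) : nonneg_mx y -> y != 0 -> 0 <= r ->
  y *m B = r *: y -> forall j, 0 < y 0 j.
Proof.
move=> y0 yn0 r0 yB j; have [N hN] := irreducible_power_pos.
have E k : y *m (B1 ^+ k) = (1 + r) ^+ k *: y.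
  elim: k => [|k IH]; first by rewrite !expr0 mulmx1 scale1r.
  rewrite exprSr mulmxA IH -scalemxAl mulmxDr mulmx1 yB.
  by rewrite -{1}[y]scale1r -scalerDl scalerA exprSr.
have [i yi] := nonneg_row_pos y0 yn0.
have : 0 < (y *m (B1 ^+ N)) 0 j by apply: mulmx_pos yi (hN i j).
by rewrite E mxE pmulr_rgt0 // exprn_gt0 // ltr_pwDl.
Qed.

End Irreducible.

Lemma recurrence_bound (b e : nat -> C) (x : C) (s K : R) : nc x < s ->
  (forall k, b k.+1 = x * b k + e k) -> (forall k, nc (e k) <= K * s ^+ k) ->
  exists K', forall k, nc (b k) <= K' * s ^+ k.
Proof.
move=> xs be eK; have d0 : 0 < s - nc x by rewrite subr_gt0.
have s0 : 0 < s by apply: le_lt_trans xs; exact: nc_ge0.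
have K0 : 0 <= K by have := eK 0%N; rewrite expr0 mulr1; apply: le_trans; exact: nc_ge0.
exists (nc (b 0%N) + K / (s - nc x)); elim=> [|k IH].
  by rewrite expr0 mulr1 lerDl divr_ge0 ?(ltW d0).
set K' := _ + _ in IH *; have sk : 0 <= s ^+ k by rewrite exprn_ge0 ?(ltW s0).
rewrite be; apply: le_trans (ncD _ _) _; rewrite ncM.
apply: le_trans (_ : nc x * (K' * s ^+ k) + K * s ^+ k <= _).
  by rewrite lerD ?eK // ler_wpM2l ?nc_ge0.
rewrite exprS mulrA -mulrDl mulrA ler_wpM2r // -lerBrDl [K' * s]mulrC -mulrBl /K' mulrDr.
by rewrite mulrCA mulfV ?gt_eqF // mulr1 lerDr mulr_ge0 ?nc_ge0 ?(ltW d0).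
Qed.

Lemma uniform_const (I J : finType) (P : I -> J -> R -> Prop) :
  (forall i j K K', K <= K' -> P i j K -> P i j K') ->
  (forall i j, exists K, P i j K) -> exists K, forall i j, P i j K.
Proof.
move=> mono h; have [f hf] := boolp.choice (fun ij : I * J => h ij.1 ij.2).
exists (\sum_ij `|f ij|) => i j; apply: mono (hf (i, j)).
rewrite (bigD1 (i, j)) //=; apply: le_trans (ler_norm _) _; rewrite lerDl.
exact: sumr_ge0.
Qed.

(** A bound for any [s] above the spectral radius without a Jordan form: by Cayley-Hamilton the
    product of the factors [B - x] vanishes, and each factor is removed by solving a recurrence
    [b k.+1 = x * b k + e k]. *)
Lemma mx_power_bound n (B : 'M[C]_n.+1) (s : R) :
  (forall x, root (char_poly B) x -> nc x < s) ->
  exists K, forall k i j, nc ((B ^+ k) i j) <= K * s ^+ k.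
Proof.
move=> hs; have [rs hrs] := closed_field_poly_normal (char_poly B).
rewrite (monicP (char_poly_monic B)) scale1r in hrs.
have rsP x : x \in rs -> nc x < s by move=> xs; apply: hs; rewrite hrs root_prod_XsubC.
suff H (rs' : seq C) (W : 'M[C]_n.+1) : (forall x, x \in rs' -> nc x < s) ->
    (exists K, forall k i j,
       nc ((B ^+ k * (horner_mx B (\prod_(x <- rs') ('X - x%:P)) * W)) i j) <= K * s ^+ k) ->
    exists K, forall k i j, nc ((B ^+ k * W) i j) <= K * s ^+ k.
  have [|K hK] := H rs 1 rsP.
    exists 0 => k i j; rewrite -hrs [horner_mx _ _]Cayley_Hamilton mul0r mulr0 mxE nc0.
    by rewrite mul0r.
  by exists K => k i j; have := hK k i j; rewrite mulr1.
elim: rs' W => [|x rs' IH] W hrs' [K hK].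
  by exists K => k i j; have := hK k i j; rewrite big_nil rmorph1 mul1r.
apply: IH => [y ys|]; first by apply: hrs'; rewrite inE ys orbT.
set P := horner_mx B (\prod_(x <- rs') ('X - x%:P)) in hK *.
have xs : nc x < s by apply: hrs'; rewrite mem_head.
have [||K' hK'] := @uniform_const 'I_n.+1 'I_n.+1 (fun i j K => forall k,
   nc ((B ^+ k * (P * W)) i j) <= K * s ^+ k).
- move=> i j K1 K2 K12 h k; apply: le_trans (h k) _; rewrite ler_wpM2r //.
  by rewrite exprn_ge0 // ltW // (le_lt_trans (nc_ge0 x)).
- move=> i j; apply: (recurrence_bound xs
    (e := fun k => (B ^+ k * (horner_mx B (\prod_(x <- x :: rs') ('X - x%:P)) * W)) i j)
    (K := K)) => [k|k]; last exact: hK.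
  rewrite big_cons rmorphM rmorphB /= horner_mx_X horner_mx_C -/P.
  rewrite exprSr -mulrA -[in RHS]mulrA mulrBl mulrBr.
  have -> : x%:M * (P * W) = x *: (P * W) by exact: mul_scalar_mx.
  have E (X1 X2 : 'M[C]_n.+1) : X1 i j = x * X2 i j + (X1 - x *: X2) i j.
    by rewrite !mxE; ring.
  by rewrite -scalerAr; exact: E.
- by exists K' => k i j; exact: hK'.
Qed.

Lemma root_max_mod (s : seq C) : s != [::] ->
  exists2 x, x \in s & forall y, y \in s -> nc y <= nc x.
Proof.
elim: s => // a [|b s] IH _.
  by exists a; rewrite ?mem_head // => y; rewrite inE => /eqP ->.
have [//|x xs hx] := IH; case: (leP (nc a) (nc x)) => h.
  by exists x => [|y]; rewrite inE ?xs ?orbT // => /orP[/eqP ->|/hx].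
exists a; rewrite ?mem_head // => y; rewrite inE => /orP[/eqP -> //|/hx h'].
by apply: le_trans h' (ltW h).
Qed.

Lemma is_delta_uniq n (X : 'M[C]_n) l l' : is_delta X l -> is_delta X l' -> l = l'.
Proof.
move=> [r1 m1 i1 s1] [r2 m2 i2 s2].
have e : `|l| = `|l'| by apply/eqP; rewrite eq_le m1 // m2.
have re : complex.Re l = complex.Re l'.
  by apply/eqP; rewrite eq_le s1 // s2 // e.
have : nc l ^+ 2 = nc l' ^+ 2 by rewrite /nc e.
rewrite !ncsq re => /addrI/eqP; rewrite eqrXn2 // => /eqP im.
by case: l l' re im {r1 m1 i1 s1 r2 m2 i2 s2 e} => a b [c d] /= -> ->.
Qed.

Lemma cmxM m n p (X : 'M[R]_(m, n)) (Y : 'M[R]_(n, p)) : cmx (X *m Y) = cmx X *m cmx Y.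
Proof. exact: (map_mxM toC). Qed.

Lemma cmxZ m n (c : R) (X : 'M[R]_(m, n)) : cmx (c *: X) = toC c *: cmx X.
Proof. exact: (map_mxZ toC). Qed.

Lemma cmxX n (X : 'M[R]_n.+1) k : cmx (X ^+ k) = cmx X ^+ k.
Proof.
elim: k => [|k IH]; first by rewrite !expr0; exact: (map_mx1 toC).
by rewrite !exprS -IH; exact: cmxM.
Qed.

Section PF.
Variables (n : nat) (B : 'M[R]_n.+1).
Hypothesis B0 : nonneg_mx B.
Hypothesis Birr : mx_irreducible B.

(* If [r y <= y B] were strict somewhere, multiplying by a positive power of [1 + B]
   would make [y B^k] grow faster than the spectral radius allows. *)
Lemma subeigen_eq (r : R) (y : 'rV[R]_n.+1) : 0 <= r ->
  (forall x, root (char_poly (cmx B)) x -> nc x <= r) ->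
  nonneg_mx y -> (forall j, r * y 0 j <= (y *m B) 0 j) -> y *m B = r *: y.
Proof.
move=> r0 hr y0 yB; pose z := y *m B - r *: y.
have z0 : nonneg_mx z by move=> i j; rewrite ord1 !mxE subr_ge0; have := yB j; rewrite mxE.
apply/eqP; rewrite -subr_eq0 -/z; apply: contraT => zn0.
have [N hN] := irreducible_power_pos B0 Birr; set Q := _ ^+ N in hN.
have [i zi] := nonneg_row_pos z0 zn0.
have Q0 : nonneg_mx Q by move=> ? ?; exact: ltW.
have zQ j : 0 < (z *m Q) 0 j by apply: mulmx_pos zi (hN i j).
pose y' := y *m Q.
have y'0 : nonneg_mx y' by exact: mulmx_nonneg.
have y'B : y' *m B = z *m Q + r *: y'.
  have cQ : Q *m B = B *m Q.
    have : GRing.comm B Q by apply: commrX; apply: commrD; [exact: commr1 | ].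
    by move=> h; exact: esym h.
  by rewrite /y' -mulmxA cQ mulmxA mulmxBl -scalemxAl subrK.
pose S := 1 + \sum_j y' 0 j.
have S0 : 0 < S by rewrite ltr_pwDl // sumr_ge0.
have [e e0 he] : exists2 e, 0 < e & forall j, e * y' 0 j <= (z *m Q) 0 j.
  have [e' e'0 he'] := fin_pos_lower zQ.
  exists (e' / S) => [|j]; first by rewrite divr_gt0.
  apply: le_trans (he' j); rewrite mulrAC ler_pdivrMr // ler_wpM2l ?(ltW e'0) //.
  by rewrite /S (bigD1 j) //= addrCA lerDl addr_ge0 // sumr_ge0.
have grow k j : (r + e) ^+ k * y' 0 j <= (y' *m B ^+ k) 0 j.
  elim: k j => [|k IH] j; first by rewrite !expr0 mul1r mulmx1.
  have -> : B ^+ k.+1 = B *m B ^+ k by rewrite exprS.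
  have E (X Y : 'rV[R]_n.+1) : (X + r *: Y) 0 j = X 0 j + r * Y 0 j by rewrite !mxE.
  rewrite mulmxA y'B mulmxDl -scalemxAl E.
  have h1 : (r + e) ^+ k * (r * y' 0 j) <= r * (y' *m B ^+ k) 0 j.
    by rewrite mulrCA ler_wpM2l.
  have h2 : (r + e) ^+ k * (e * y' 0 j) <= (z *m Q *m B ^+ k) 0 j.
    apply: le_trans (_ : e * (y' *m B ^+ k) 0 j <= _).
      by rewrite mulrCA ler_wpM2l // ltW.
    rewrite mxE [leRHS]mxE mulr_sumr; apply: ler_sum => l _.
    by rewrite mulrA ler_wpM2r // expr_nonneg.
  rewrite exprSr; lra.
(* Powers bounded at rate [r + e / 2] contradict the growth at rate [r + e]. *)
have [|K hK] := @mx_power_bound n (cmx B) (r + e / 2).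
  by move=> x /hr; lra.
have y'pos : 0 < y' 0 0.
  have yn0 : y != 0.
    by apply: contraTneq zi => yz; rewrite /z yz mul0mx scaler0 subrr mxE ltxx.
  by have [i' yi'] := nonneg_row_pos y0 yn0; apply: mulmx_pos yi' (hN i' 0).
have : r + e <= r + e / 2; last by lra.
apply: (@le_of_expr_le _ _ _ (\sum_l y' 0 l * K / y' 0 0)) => [|k].
  by rewrite addr_ge0 // divr_ge0 // ltW.
rewrite -mulr_suml mulrAC ler_pdivlMr //; apply: le_trans (grow k 0) _.
rewrite mxE mulr_suml; apply: ler_sum => l _; rewrite -mulrA ler_wpM2l //.
have := hK k l 0; rewrite -cmxX mxE nc_toC; apply: le_trans.
exact: ler_norm.
Qed.

(** The moduli of a left eigenvector for an eigenvalue of maximal modulus form a subeigenvector;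
    [subeigen_eq] makes it an eigenvector and irreducibility makes it positive. *)
Lemma perron_frobenius : exists (r : R) (y : 'rV[R]_n.+1),
  [/\ 0 <= r, forall j, 0 < y 0 j, y *m B = r *: y &
      forall x, root (char_poly (cmx B)) x -> nc x <= r].
Proof.
have [rs hrs] := closed_field_poly_normal (char_poly (cmx B)).
rewrite (monicP (char_poly_monic _)) scale1r in hrs.
have [|x xs hx] := @root_max_mod rs.
  apply/eqP => e; have := size_char_poly (cmx B).
  by rewrite hrs e big_nil size_poly1.
have hr y : root (char_poly (cmx B)) y -> nc y <= nc x.
  by rewrite hrs root_prod_XsubC => /hx.
have : root (char_poly (cmx B)) x by rewrite hrs root_prod_XsubC.
rewrite -eigenvalue_root_char => /eigenvalueP[w wB wn0].
pose y : 'rV[R]_n.+1 := \row_j nc (w 0 j).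
have y0 : nonneg_mx y by move=> i j; rewrite mxE nc_ge0.
have yB : y *m B = nc x *: y.
  apply: subeigen_eq => // [|j]; first exact: nc_ge0.
  have := congr1 (fun u : 'rV_n.+1 => nc (u 0 j)) wB; rewrite [in X in _ = X -> _]mxE ncM.
  rewrite {1}/y mxE => <-; rewrite !mxE; apply: le_trans (nc_sum _ _ _) _.
  apply: ler_sum => i _; rewrite !mxE ncM nc_toC ger0_norm //.
exists (nc x), y; split=> //; first exact: nc_ge0.
apply: (eigen_row_pos B0 Birr y0 _ (nc_ge0 x) yB).
apply: contraNneq wn0 => yz; apply/eqP/rowP => j; rewrite mxE.
by apply/eqP; rewrite -nc_eq0; have := congr1 (fun u : 'rV_n.+1 => u 0 j) yz; rewrite !mxE => ->.
Qed.

(** Collatz-Wielandt bounds, by pairing [w] with the positive left Perron vector. The choice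
    operator [delta] is first identified with the Perron root by uniqueness. *)
Lemma delta_bounds (a b : R) (w : 'cV[R]_n.+1) : (forall i, 0 < w i 0) ->
  (forall i, a * w i 0 <= (B *m w) i 0 <= b * w i 0) ->
  a <= complex.Re (delta (cmx B)) <= b.
Proof.
move=> w0 hw; have [r [y [r0 y0 yB hr]]] := perron_frobenius.
have D : is_delta (cmx B) (toC r).
  split=> //=.
  - rewrite -eigenvalue_root_char; apply/eigenvalueP; exists (cmx y).
      by rewrite -cmxM yB cmxZ.
    apply/eqP => /(congr1 (fun u : 'rV_n.+1 => u 0 0)); rewrite !mxE => -[e].
    by have := y0 0; rewrite e ltxx.
  - by move=> m /hr h; rewrite !norm_nc lecR nc_toC ger0_norm.
  - move=> m /hr h _; apply: le_trans h; apply: le_trans (nc_Re m).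
    exact: ler_norm.
have -> : delta (cmx B) = toC r.
  by apply: (is_delta_uniq _ D); apply: epsilon_spec; exists (toC r).
have yw : 0 < (y *m w) 0 0.
  rewrite mxE (bigD1 ord0) //= ltr_wpDr ?mulr_gt0 //.
  by apply: sumr_ge0 => i _; rewrite mulr_ge0 // ltW.
have E : (y *m (B *m w)) 0 0 = r * (y *m w) 0 0.
  by rewrite mulmxA yB -scalemxAl mxE.
rewrite /= -(ler_pM2r yw) -[X in _ && X](ler_pM2r yw) -E !mxE !mulr_sumr.
apply/andP; split; apply: ler_sum => i _; rewrite mulrCA ler_wpM2l ?(ltW (y0 _)) //.
  by have /andP[] := hw i.
by have /andP[] := hw i.
Qed.

(** Subtract the largest multiple of [mu] that leaves a nonnegative vector. The difference has a
    zero entry, so it cannot be a nonzero nonnegative eigenvector. *)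
Lemma left_kernel_real (r : R) (mu w : 'rV[R]_n.+1) : (forall j, 0 < mu 0 j) ->
  mu *m B = r *: mu -> w *m B = r *: w -> exists c, w = c *: mu.
Proof.
move=> mu0 muB wB.
have r0 : 0 <= r.
  have : 0 <= (mu *m B) 0 0 by apply: mulmx_nonneg => // i j; rewrite ord1 ltW.
  by rewrite muB mxE pmulr_lge0.
pose f j := w 0 j / mu 0 j.
pose j0 := [arg min_(j < ord0) f j]%O.
have hj0 j : f j0 <= f j by rewrite /j0; case: arg_minP => // i _ h; exact: h.
exists (f j0); pose d := w - f j0 *: mu.
have d0 : nonneg_mx d.
  move=> i j; rewrite ord1 !mxE subr_ge0 -ler_pdivlMr //; exact: hj0.
have dB : d *m B = r *: d by rewrite mulmxBl wB -scalemxAl muB scalerBr !scalerA [f j0 * r]mulrC.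
apply/eqP; rewrite -subr_eq0 -/d; apply: contraT => dn0.
have := eigen_row_pos B0 Birr d0 dn0 r0 dB j0.
by rewrite !mxE /f mulfVK ?subrr ?ltxx // gt_eqF.
Qed.

Lemma left_kernel (r : R) (mu : 'rV[R]_n.+1) (w : 'rV[C]_n.+1) : (forall j, 0 < mu 0 j) ->
  mu *m B = r *: mu -> w *m cmx B = toC r *: w -> exists c, w = c *: cmx mu.
Proof.
move=> mu0 muB wB.
pose wr : 'rV[R]_n.+1 := \row_j complex.Re (w 0 j).
pose wi : 'rV[R]_n.+1 := \row_j complex.Im (w 0 j).
have E j : \sum_i w 0 i * toC (B i j) = toC r * w 0 j.
  have := congr1 (fun u : 'rV_n.+1 => u 0 j) wB; rewrite !mxE => <-.
  by apply: eq_bigr => i _; rewrite mxE.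
have [c hc] : exists c, wr = c *: mu.
  apply: (left_kernel_real mu0 muB); apply/rowP => j.
  have := congr1 (@complex.Re R) (E j); rewrite (raddf_sum (@complex.Re R)) !mxE /=.
  case: (w 0 j) => x y /=; rewrite mul0r subr0 => <-; apply: eq_bigr => i _.
  by rewrite mxE; case: (w 0 i) => u v /=; rewrite mulr0 subr0.
have [d hd] : exists d, wi = d *: mu.
  apply: (left_kernel_real mu0 muB); apply/rowP => j.
  have := congr1 (@complex.Im R) (E j); rewrite (raddf_sum (@complex.Im R)) !mxE /=.
  case: (w 0 j) => x y /=; rewrite mul0r addr0 => <-; apply: eq_bigr => i _.
  by rewrite mxE; case: (w 0 i) => u v /=; rewrite mulr0 add0r.
exists (Complex c d); apply/rowP => j.
have := congr1 (fun u : 'rV_n.+1 => u 0 j) hc; have := congr1 (fun u : 'rV_n.+1 => u 0 j) hd.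
rewrite !mxE; case: (w 0 j) => x y /= -> ->.
by rewrite [RHS]/GRing.mul /= !mulr0 subr0 add0r.
Qed.

(** Fredholm alternative, the left kernel being spanned by [mu]. *)
Lemma poisson_solve (r : R) (mu : 'rV[R]_n.+1) (b : 'cV[R]_n.+1) : (forall j, 0 < mu 0 j) ->
  mu *m B = r *: mu -> mu *m b = 0 -> exists g : 'cV[R]_n.+1, B *m g - r *: g = b.
Proof.
move=> mu0 muB mub; have [w wK|g hg] := @mx_solvable R _ (B - r%:M) b.
  have [c ->] : exists c, w = c *: mu.
    apply: (left_kernel_real mu0 muB); apply/eqP; rewrite -subr_eq0 -mul_mx_scalar -mulmxBr.
    exact/eqP.
  by rewrite -scalemxAl mub scaler0.
by exists g; rewrite -mul_scalar_mx -mulmxBl.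
Qed.

End PF.

End PerronFrobenius.

(** * The matrix function A^*(z) *)

Section Aux.
Variable R : realType.
Local Notation C := R[i].
Local Notation toC := (real_complex R).

Lemma l1_le (a : nat -> C) (r s : R) : 0 <= r -> r <= s -> l1 a s -> l1 a r.
Proof.
move=> r0 rs [K hK]; exists K => n; apply: le_trans (hK n); apply: ler_sum => k _.
by rewrite ler_wpM2l ?nc_ge0 // lerXn2r ?nnegrE // (le_trans r0).
Qed.

Lemma conv_radius_l1 m n (Y : nat -> 'M[R]_(m, n)) (x : R) :
  (forall k i j, 0 <= Y k i j) -> (x%:E < conv_radius Y)%E ->
  exists2 r, x < r & forall i j, l1 (fun k => toC (Y k i j)) r.
Proof.
move=> Y0 /ereal_sup_gt[_ [y [y0 hy] <-]]; rewrite lte_fin => xy.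
exists y => // i j; have h := rsumsP (hy i j).
exists (rsum (fun k => y ^+ k * Y k i j)) => N; apply: le_trans (rsums_partial_le N _ h).
  by apply: ler_sum => k _; rewrite nc_toC ger0_norm // mulrC.
by move=> k; rewrite mulr_ge0 // exprn_ge0 // ltW.
Qed.

Lemma csums_real (u : nat -> R) (L : C) : csums (toC \o u) L ->
  rsums u (rsum u) /\ L = toC (rsum u).
Proof.
move=> h; have hr : rsums u (complex.Re L).
  move=> e e0; have [N hN] := h _ e0; exists N => n /hN; apply: le_trans.
  by rewrite -rmorph_sum; apply: le_trans (nc_Re _); case: (L) => a b.
by rewrite (rsums_rsum hr); split=> //; exact: csums_uniq h ((csums_toC _ _).1 hr).
Qed.

Lemma ps_rsums (u : nat -> R) (r y : R) : l1 (fun k => toC (u k)) r -> 0 <= y -> y <= r ->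
  rsums (fun k => y ^+ k * u k) (rsum (fun k => y ^+ k * u k)) /\
  ps (fun k => toC (u k)) (toC y) = toC (rsum (fun k => y ^+ k * u k)).
Proof.
move=> hl y0 yr; have yr' : nc (toC y) <= r by rewrite nc_toC ger0_norm.
apply: csums_real; apply: csums_ext (ps_csums hl yr') => k /=.
by rewrite rmorphM rmorphXn mulrC.
Qed.

Lemma ltr_sum_lt (I : finType) (F G : I -> R) : (forall i, F i <= G i) ->
  (exists i, F i < G i) -> \sum_i F i < \sum_i G i.
Proof.
move=> FG [i lt]; rewrite (bigD1 i) //= [ltRHS](bigD1 i) //=.
by rewrite ltr_leD // ler_sum.
Qed.

Lemma eq_of_sum_le (I : finType) (F G : I -> R) : (forall i, F i <= G i) ->
  \sum_i F i = \sum_i G i -> forall i, F i = G i.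
Proof.
move=> FG E i; apply/eqP; rewrite eq_le FG leNgt; apply/negP => lt.
by have := ltr_sum_lt FG (ex_intro _ i lt); rewrite E ltxx.
Qed.

(** Both values are compared with the tangent of the exponential at the weighted mean [t]; the
    equality case carries the rigidity used later. *)
Lemma expR_convex (b x y : R) : 0 < b -> b < 1 ->
  expR (b * x + (1 - b) * y) <= b * expR x + (1 - b) * expR y ?= iff (x == y).
Proof.
move=> b0 b1; set t := b * x + (1 - b) * y; have b1' : 0 < 1 - b by rewrite subr_gt0.
have hx : expR x = expR t * expR (x - t) by rewrite -expRD; congr expR; ring.
have hy : expR y = expR t * expR (y - t) by rewrite -expRD; congr expR; ring.
have E0 := expR_gt0 t.
have key : expR t = b * (expR t * (1 + (x - t))) + (1 - b) * (expR t * (1 + (y - t))).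
  by rewrite /t; ring.
have lex : b * (expR t * (1 + (x - t))) <= b * expR x.
  by rewrite ler_pM2l // hx ler_pM2l // expR_ge1Dx.
have ley : (1 - b) * (expR t * (1 + (y - t))) <= (1 - b) * expR y.
  by rewrite ler_pM2l // hy ler_pM2l // expR_ge1Dx.
split; first by rewrite {1}key lerD.
case: (eqVneq x y) => [e|ne].
  by apply/eqP; rewrite /t e -mulrDl addrC subrK mul1r -mulrDl addrC subrK mul1r.
apply/negP => /eqP e; have : b * (expR t * (1 + (x - t))) < b * expR x; last by lra.
rewrite ltr_pM2l // hx ltr_pM2l // expR_gt1Dx //.
have -> : x - t = (1 - b) * (x - y) by rewrite /t; ring.
by rewrite mulf_neq0 ?subr_eq0 // gt_eqF.
Qed.

End Aux.

(** * Characters of the Markov additive process and its period *)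

Section MAP.
Variable R : realType.
Local Notation C := R[i].
Local Notation toC := (real_complex R).
Variables (M : nat) (A : nat -> 'M[R]_M).

Lemma map_reach_char (phi : 'I_M -> C) (Z : C) : Z != 0 ->
  (forall k i j, 0 < A k i j -> phi j * Z = phi i * Z ^+ k) ->
  forall s t, map_reach A s t -> phi t.2 = phi s.2 * Z ^ (t.1 - s.1).
Proof.
move=> Z0 h s t; elim=> {s t} [[k i] [l j] [/= h1 h2]|s t u _ IH1 _ IH2].
  apply: (mulIf Z0); rewrite (h _ _ _ h2) -mulrA -[in X in _ * (_ * X)](expr1z Z) -expfzDr //.
  by congr (_ * _); rewrite exprnP gez0_abs // -lerBlDr sub0r.
rewrite IH2 IH1 -mulrA -expfzDr //; congr (_ * _ ^ _); ring.
Qed.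

(** Along paths that return to the same phase, [Z] to the power of the displacement is 1; the order
    of [Z] divides every such displacement and hence their gcd [tau]. *)
Lemma map_char (tau : nat) (phi : 'I_M -> C) (Z : C) (j0 : 'I_M) : MAP_period A tau ->
  Z != 0 -> (forall j, phi j != 0) ->
  (forall k i j, 0 < A k i j -> phi j * Z = phi i * Z ^+ k) -> Z ^+ tau = 1.
Proof.
move=> ht Z0 p0 h; have [_ dvdtau] := ht j0.
have ZS k : map_reach A (0, j0) (k, j0) -> Z ^+ `|k|%N = 1.
  move=> /(map_reach_char Z0 h) /= /esym/eqP; rewrite -{2}[phi j0]mulr1 subr0.
  rewrite (inj_eq (mulfI (p0 j0))) => /eqP; case: k => k //=.
  by rewrite NegzE -exprnN => /(congr1 GRing.inv); rewrite invrK invr1.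
case: (pselect (exists k, k != 0 /\ map_reach A (0, j0) (k, j0))) => [[k [k0 hk]]|no].
  have kp : (0 < `|k|)%N by rewrite absz_gt0.
  have [d pd _] := prim_order_exists kp (ZS _ hk).
  have : (d%:Z %| tau%:Z)%Z.
    by apply: dvdtau => l [_ hl]; rewrite dvdzE /= (prim_order_dvd pd) ZS.
  by rewrite dvdzE /= (prim_order_dvd pd) => /eqP.
(* Without any nonzero displacement, the gcd condition tested with the divisor 0 gives [tau = 0]. *)
have : (0 %| tau%:Z)%Z by apply: dvdtau => k hk; case: no; exists k.
by rewrite dvd0z => /eqP [->]; rewrite expr0.
Qed.

End MAP.

(** * Singular points in the annulus, and the Perron root near theta *)

Section Astar.
Variable R : realType.
Local Notation C := R[i].
Local Notation toC := (real_complex R).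
Variables (M : nat) (A : nat -> 'M[R]_M.+1) (r1 theta : R).
Hypothesis A0 : forall k i j, 0 <= A k i j.
Hypothesis Al1 : forall i j, l1 (fun k => toC (A k i j)) r1.
Hypothesis th1 : 1 < theta.
Hypothesis thr1 : theta < r1.

Definition Az (z : C) : 'M[C]_M.+1 := \matrix_(i, j) ps (fun k => toC (A k i j)) z.

Let r10 : 0 < r1.
Proof. by apply: lt_trans thr1; apply: lt_trans th1. Qed.

Let th0 : 0 < theta.
Proof. exact: lt_trans th1. Qed.

Lemma Az_an i j : an r1 (fun z => Az z i j).
Proof. by apply: an_ext (ps_an (ltW r10) (Al1 i j)) => z _; rewrite mxE. Qed.

Lemma Az_real y : 0 <= y -> y <= r1 -> Az (toC y) = cmx (Astar A y).
Proof.
move=> y0 yr; apply/matrixP => i j; rewrite !mxE.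
by have [_ ->] := ps_rsums (Al1 i j) y0 yr.
Qed.

Lemma Astar_rsums y i j : 0 <= y -> y <= r1 ->
  rsums (fun k => y ^+ k * A k i j) (Astar A y i j).
Proof. by move=> y0 yr; rewrite mxE; have [] := ps_rsums (Al1 i j) y0 yr. Qed.

Let term_ge0 y i j : 0 <= y -> forall k, 0 <= y ^+ k * A k i j.
Proof. by move=> y0 k; rewrite mulr_ge0 // exprn_ge0. Qed.

Lemma Astar_nonneg y : 0 <= y -> y <= r1 -> nonneg_mx (Astar A y).
Proof.
move=> y0 yr i j; have := rsums_partial_le 0 (term_ge0 i j y0) (Astar_rsums i j y0 yr).
by rewrite big_ord0.
Qed.

Lemma Astar_term_le y i j k : 0 <= y -> y <= r1 -> y ^+ k * A k i j <= Astar A y i j.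
Proof.
move=> y0 yr; apply: le_trans (rsums_partial_le k.+1 (term_ge0 i j y0) (Astar_rsums i j y0 yr)).
by rewrite big_ord_recr lerDr sumr_ge0 // => l _; exact: term_ge0.
Qed.

Lemma Astar_pos_support y i j : 0 <= y -> y <= r1 -> 0 < Astar A y i j ->
  exists k, 0 < A k i j.
Proof.
move=> y0 yr h; apply: contrapT => no.
have Ak k : A k i j = 0.
  by apply/eqP; rewrite eq_le A0 andbT leNgt; apply/negP => hk; apply: no; exists k.
have hz : rsums (fun k => y ^+ k * A k i j) 0.
  move=> e e0; exists 0%N => n _; rewrite big1 ?subrr ?normr0 ?ltW // => k _.
  by rewrite Ak mulr0.
by move: h; rewrite (rsums_uniq (Astar_rsums i j y0 yr) hz) ltxx.
Qed.

Hypothesis Airr : mx_irreducible (Astar A 1).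

(** The zero pattern of [Astar A y] is the same for all admissible [y > 0]. *)
Lemma Astar_irr y : 0 < y -> y <= r1 -> mx_irreducible (Astar A y).
Proof.
move=> y0 yr i j; elim: (Airr i j) => [a b ab|a|a b c _ h1 _ h2].
- have [|k hk] := Astar_pos_support ler01 _ ab; first by rewrite ltW // (lt_trans th1).
  apply: rt_step; apply: lt_le_trans (Astar_term_le _ _ k (ltW y0) yr).
  by rewrite mulr_gt0 // exprn_gt0.
- exact: rt_refl.
- exact: rt_trans h1 h2.
Qed.

(** One term is split off so that [eigen_phase] can compare the phase of a single transition with
    that of the whole sum. *)
Lemma nc_Az_le z i j k : nc z <= r1 ->
  nc (Az z i j - toC (A k i j) * z ^+ k) <= Astar A (nc z) i j - nc z ^+ k * A k i j.
Proof.
move=> zr; rewrite mxE; set c := toC _ * _.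
have hd : csums (fun l => if l == k then - c else 0) (- c).
  move=> e e0; exists k.+1 => n kn; rewrite -big_mkcond (big_pred1 (Ordinal kn)) //.
  by rewrite subrr nc0 ltW.
have hr : rsums (fun l => if l == k then - (nc z ^+ k * A k i j) else 0) (- (nc z ^+ k * A k i j)).
  move=> e e0; exists k.+1 => n kn; rewrite -big_mkcond (big_pred1 (Ordinal kn)) //.
  by rewrite subrr normr0 ltW.
apply: (csums_bound (csumsD (ps_csums (Al1 i j) zr) hd)
   (v := fun l => nc z ^+ l * A l i j + (if l == k then - (nc z ^+ k * A k i j) else 0))).
  move=> l; case: eqVneq => [->|_]; first by rewrite !subrr nc0.
  by rewrite !addr0 ncM ncX nc_toC ger0_norm // mulrC.
move=> n; apply: (rsums_partial_le n _ (rsumsD (Astar_rsums i j (nc_ge0 z) zr) hr)).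
move=> l; case: eqVneq => [->|_]; first by rewrite subrr.
by rewrite addr0 term_ge0 // nc_ge0.
Qed.

Lemma nc_Az z i j : nc z <= r1 -> nc (Az z i j) <= Astar A (nc z) i j.
Proof.
move=> zr; have := nc_Az_le i j 0 zr; have := nc_lerB (Az z i j) (toC (A 0%N i j) * z ^+ 0).
by rewrite !expr0 mulr1 mul1r nc_toC ger0_norm //; lra.
Qed.

Variables (mu : 'rV[R]_M.+1) (v : 'cV[R]_M.+1).
Hypothesis mu0 : forall j, 0 < mu 0 j.
Hypothesis v0 : forall j, 0 < v j 0.
Hypothesis muA : mu *m Astar A theta = theta *: mu.
Hypothesis Av : Astar A theta *m v = theta *: v.
Hypothesis muv : (mu *m v) 0 0 = 1.
Hypothesis stoch : forall i, \sum_j Astar A 1 i j = 1.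
Variable tau : nat.
Hypothesis htau : MAP_period A tau.
Hypothesis tau0 : (0 < tau)%N.

(** With [s = nc z], the moduli [y] of [w] satisfy [s y <= y A^*(s)], while pairing with the
    superharmonic [h] gives the reverse inequality on average. As [h] and then [y] are positive,
    both inequalities are equalities in every coordinate. *)
Lemma left_eigen_abs (z : C) (w : 'rV[C]_M.+1) (h : 'cV[R]_M.+1) : w != 0 -> nc z <= r1 ->
  0 < nc z -> w *m Az z = z *: w -> (forall i, 0 < h i 0) ->
  (forall i, (Astar A (nc z) *m h) i 0 <= nc z * h i 0) ->
  [/\ forall j, 0 < nc (w 0 j),
      forall j, \sum_i nc (w 0 i) * Astar A (nc z) i j = nc z * nc (w 0 j) &
      forall i, (Astar A (nc z) *m h) i 0 = nc z * h i 0].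
Proof.
move=> w0 zr z0 wA h0 Ah; pose s := nc z; rewrite -/s in z0 Ah zr *.
pose y : 'rV[R]_M.+1 := \row_j nc (w 0 j).
have y0 : nonneg_mx y by move=> i j; rewrite mxE nc_ge0.
have yn0 : y != 0.
  apply: contraNneq w0 => yz; apply/eqP/rowP => j; rewrite [RHS]mxE; apply/eqP; rewrite -nc_eq0.
  by have := congr1 (fun u : 'rV_M.+1 => u 0 j) yz; rewrite !mxE => ->.
have le1 j : s * y 0 j <= (y *m Astar A s) 0 j.
  have := congr1 (fun u : 'rV_M.+1 => nc (u 0 j)) wA; rewrite [in X in _ = X -> _]mxE ncM.
  rewrite {1}/y mxE => <-; rewrite !mxE; apply: le_trans (nc_sum _ _ _) _.
  apply: ler_sum => i _; rewrite ncM [y 0 i]mxE ler_wpM2l ?nc_ge0 //; exact: nc_Az.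
have E : (y *m Astar A s *m h) 0 0 <= s * (y *m h) 0 0.
  rewrite -mulmxA !mxE mulr_sumr; apply: ler_sum => i _.
  by rewrite mulrCA ler_wpM2l // Ah.
have yA j : (y *m Astar A s) 0 j = s * y 0 j.
  apply/eqP; rewrite eq_le le1 andbT leNgt; apply/negP => lt.
  have : s * (y *m h) 0 0 < (y *m Astar A s *m h) 0 0; last by rewrite ltNge E.
  rewrite !mxE mulr_sumr; apply: ltr_sum_lt => [i|]; last exists j => //.
  - by rewrite mulrA; apply: ler_wpM2r (ltW (h0 i)) _ _ (le1 i).
  - by rewrite mulrA ltr_pM2r.
have yAm : y *m Astar A s = s *: y by apply/rowP => j; rewrite yA [RHS]mxE.
have ypos := eigen_row_pos (Astar_nonneg (ltW z0) zr) (Astar_irr z0 zr) y0 yn0 (ltW z0) yAm.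
split=> [j|j|i].
- by have := ypos j; rewrite mxE.
- have <- : y 0 j = nc (w 0 j) by rewrite mxE.
  rewrite -yA mxE; apply: eq_bigr => i _; congr (_ * _); by rewrite mxE.
- apply/eqP; rewrite eq_le Ah leNgt; apply/negP => lt.
  have : (y *m (Astar A s *m h)) 0 0 < s * (y *m h) 0 0.
    rewrite [ltLHS]mxE [X in _ * X]mxE mulr_sumr; apply: ltr_sum_lt => [l|]; last exists i => //.
    - by rewrite mulrCA ler_wpM2l.
    - by rewrite mulrCA ltr_pM2l.
  by rewrite mulmxA yAm -scalemxAl [X in X < _]mxE ltxx.
Qed.

(** Equality in the triangle inequality for every column of [w A^*(z) = z w] makes the phases
    [w_j / |w_j|] a character along the transitions with multiplier [z / |z|], to which [map_char]
    applies. *)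
Lemma eigen_phase (z : C) (w : 'rV[C]_M.+1) (h : 'cV[R]_M.+1) : w != 0 -> nc z <= r1 ->
  0 < nc z -> w *m Az z = z *: w -> (forall i, 0 < h i 0) ->
  (forall i, (Astar A (nc z) *m h) i 0 <= nc z * h i 0) ->
  (z / toC (nc z)) ^+ tau = 1.
Proof.
move=> w0 zr z0 wA h0 Ah; have [y0 yA _] := left_eigen_abs w0 zr z0 wA h0 Ah.
set s := nc z in zr z0 yA *.
have sC : toC s != 0 by rewrite -nc_eq0 nc_toC normr_eq0 gt_eqF.
apply: (map_char (phi := fun j => w 0 j / toC (nc (w 0 j))) ord0 htau).
- by rewrite mulf_neq0 ?invr_neq0 // -nc_gt0.
- by move=> j; rewrite mulf_neq0 ?invr_neq0 // -nc_eq0 ?nc_toC ?normr_eq0 gt_eqF.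
move=> k i j Aij; pose t0 := w 0 i * (toC (A k i j) * z ^+ k).
have E : \sum_l w 0 l * Az z l j = z * w 0 j.
  by have := congr1 (fun u : 'rV_M.+1 => u 0 j) wA; rewrite !mxE.
have nt0 : nc t0 = nc (w 0 i) * (s ^+ k * A k i j).
  by rewrite !ncM ncX nc_toC ger0_norm // [A k i j * _]mulrC.
have le1 : nc (z * w 0 j - t0) <= nc (z * w 0 j) - nc t0.
  rewrite nt0 [X in _ <= X - _]ncM -/s -yA -E (bigD1 i) //= addrAC -mulrBr.
  rewrite [X in _ <= X - _](bigD1 i) //= addrAC -mulrBr.
  apply: le_trans (ncD _ _) _; rewrite lerD //.
    by rewrite ncM ler_wpM2l ?nc_ge0 // nc_Az_le.
  apply: le_trans (nc_sum _ _ _) _; apply: ler_sum => l _.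
  by rewrite ncM ler_wpM2l ?nc_ge0 // nc_Az.
(* The split-off term and the remainder share the phase [u], which is then that of [z * w 0 j]. *)
have [u un [E1 E2]] : {u : C | `|u| == 1 & (t0, z * w 0 j - t0) =
    (`|t0| * u, `|z * w 0 j - t0| * u)}.
  apply: normCDeq; rewrite [t0 + _]addrC subrK !norm_nc -rmorphD; congr (toC _).
  apply/eqP; rewrite eq_le; apply/andP; split; last by move: le1; lra.
  by rewrite -{1}(subrK t0 (z * w 0 j)) addrC ncD.
have E3 : z * w 0 j = toC (s * nc (w 0 j)) * u.
  rewrite -[LHS](subrK t0) E2 {2}E1 -mulrDl !norm_nc -rmorphD; congr (toC _ * u).
  rewrite -[s * _]ncM; apply/eqP; rewrite eq_le; apply/andP; split; first by move: le1; lra.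
  by rewrite -{1}(subrK t0 (z * w 0 j)) ncD.
have u0 : u != 0 by rewrite -normr_eq0 (eqP un) oner_eq0.
move: E1; rewrite norm_nc nt0 /t0.
have wj0 : toC (nc (w 0 j)) != 0 by rewrite -nc_eq0 nc_toC normr_eq0 gt_eqF.
have wi0 : toC (nc (w 0 i)) != 0 by rewrite -nc_eq0 nc_toC normr_eq0 gt_eqF.
have Ak0 : toC (A k i j) != 0 by rewrite -nc_eq0 nc_toC normr_eq0 gt_eqF.
rewrite !rmorphM rmorphXn => E4.
have -> : w 0 j / toC (nc (w 0 j)) * (z / toC s) = u.
  by rewrite mulrACA mulrC [w 0 j * z]mulrC E3 rmorphM; field; rewrite wj0 sC.
have sk0 : toC s ^+ k != 0 by rewrite expf_neq0.
rewrite expr_div_n; apply: (mulfI wi0); apply: (mulfI sk0); apply: (mulfI Ak0).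
transitivity (toC (nc (w 0 i)) * (toC s ^+ k * toC (A k i j)) * u); first by ring.
by rewrite -E4; field; rewrite sk0 wi0.
Qed.

(* If every cycle had [theta]-weight 1, then [theta ^+ tau = 1] by the definition of the period. *)
Lemma theta_drift_absurd : (forall k i j, 0 < A k i j -> theta * v i 0 = theta ^+ k * v j 0) ->
  False.
Proof.
move=> h.
have vC j : toC (v j 0) != 0 by rewrite -nc_eq0 nc_toC normr_eq0 gt_eqF.
have thC : toC theta != 0 by rewrite -nc_eq0 nc_toC normr_eq0 gt_eqF.
have := map_char (phi := fun j => (toC (v j 0))^-1) (Z := toC theta) ord0 htau thC.
have H1 j : (toC (v j 0))^-1 != 0 by rewrite invr_neq0.
move=> /(_ H1) H; have : toC theta ^+ tau = 1.
  apply: H => k i j Aij.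
  have E : toC theta * toC (v i 0) = toC theta ^+ k * toC (v j 0).
    by rewrite -rmorphXn -!rmorphM (h _ _ _ Aij).
  apply: (mulfI (vC i)); apply: (mulfI (vC j)).
  transitivity (toC theta * toC (v i 0)); first by field; exact: vC.
  by rewrite E; field; exact: vC.
move=> /(congr1 (@nc R)); rewrite ncX nc_toC nc1 gtr0_norm // => E.
by have := exprn_egt1 tau th1; rewrite E ltxx -lt0n tau0.
Qed.

Let row_v i : \sum_j Astar A theta i j * v j 0 = theta * v i 0.
Proof. by have := congr1 (fun u : 'cV_M.+1 => u i 0) Av; rewrite !mxE. Qed.

Let col_mu j : \sum_i mu 0 i * Astar A theta i j = theta * mu 0 j.
Proof. by have := congr1 (fun u : 'rV_M.+1 => u 0 j) muA; rewrite !mxE. Qed.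

Let thr1' : theta <= r1 := ltW thr1.
Let one_r1 : 1 <= r1.
Proof. by apply: le_trans thr1'; exact: ltW. Qed.

(* Interpolating between the superharmonic vectors [1] at [1] and [v] at [theta]. *)
Lemma superharmonic_interp s : 1 < s -> s < theta -> exists h : 'cV[R]_M.+1,
  [/\ forall i, 0 < h i 0, forall i, (Astar A s *m h) i 0 <= s * h i 0 &
      ~ (forall i, (Astar A s *m h) i 0 = s * h i 0)].
Proof.
move=> s1 sth; have s0 : 0 < s by apply: lt_trans s1.
(* [b] is determined by [theta^(1 - b) = s]; logarithms make the geometric interpolation affine. *)
pose sg := ln theta; pose g j := ln (v j 0); pose b := (sg - ln s) / sg.
have sg0 : 0 < sg by rewrite ln_gt0.
have ls0 : 0 < ln s by rewrite ln_gt0.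
have lslt : ln s < sg by rewrite ltr_ln ?posrE.
have b0 : 0 < b by rewrite divr_gt0 ?subr_gt0.
have b1 : b < 1 by rewrite ltr_pdivrMr // mul1r ltrBlDr ltrDl.
have bs : (1 - b) * sg = ln s by rewrite /b; field; rewrite gt_eqF.
have eg j : expR (g j) = v j 0 by rewrite lnK ?posrE.
have es : expR sg = theta by rewrite lnK ?posrE.
have els : expR (ln s) = s by rewrite lnK ?posrE.
have eX x k : expR (k%:R * x) = expR x ^+ k :> R by rewrite expRM_natl.
pose h : 'cV[R]_M.+1 := \col_j expR ((1 - b) * g j).
have h0 i : 0 < h i 0 by rewrite mxE expR_gt0.
(* This factor normalizes the claim at [i]: its right side becomes [theta * v i 0], which is also
   the sum of the convex majorant [V i]. *)
pose c i := expR (b * (sg + g i)).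
have c0 i : 0 < c i by rewrite expR_gt0.
have ch i : c i * (s * h i 0) = theta * v i 0.
  by rewrite mxE -[in s * _]els -bs -es -eg -!expRD; congr expR; ring.
pose U i k := \sum_j c i * h j 0 * (s ^+ k * A k i j).
pose V i k := \sum_j (b * theta * v i 0 * (1 ^+ k * A k i j) + (1 - b) * v j 0 * (theta ^+ k * A k i j)).
have term i j k : c i * h j 0 * (s ^+ k * A k i j) =
    A k i j * expR (b * (sg + g i) + (1 - b) * (k%:R * sg + g j)).
  rewrite mxE -[s]els -eX -bs mulrA mulrC; congr (_ * _).
  by rewrite -!expRD; congr expR; ring.
have term2 i j k : b * theta * v i 0 * (1 ^+ k * A k i j) + (1 - b) * v j 0 * (theta ^+ k * A k i j)
   = A k i j * (b * expR (sg + g i) + (1 - b) * expR (k%:R * sg + g j)).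
  by rewrite !expRD eX !eg es expr1n; ring.
have UV i k j : c i * h j 0 * (s ^+ k * A k i j) <=
   b * theta * v i 0 * (1 ^+ k * A k i j) + (1 - b) * v j 0 * (theta ^+ k * A k i j).
  by rewrite term term2 ler_wpM2l // (expR_convex _ _ b0 b1).
have sr1 : s <= r1 by apply: le_trans thr1'; exact: ltW.
have hU i : rsums (U i) (c i * (Astar A s *m h) i 0).
  rewrite mxE mulr_sumr; have := rsums_sum (fun j => rsumsZ (c i * h j 0) (Astar_rsums i j (ltW s0) sr1)).
  by congr (rsums _ _); apply: eq_bigr => j _; ring.
have hV i : rsums (V i) (theta * v i 0).
  have := rsums_sum (fun j => rsumsD (rsumsZ (b * theta * v i 0) (Astar_rsums i j ler01 one_r1))
    (rsumsZ ((1 - b) * v j 0) (Astar_rsums i j (ltW th0) thr1'))).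
  congr (rsums _ _); rewrite big_split /= -mulr_sumr stoch.
  have -> : \sum_j (1 - b) * v j 0 * Astar A theta i j = (1 - b) * (theta * v i 0).
    by rewrite -row_v mulr_sumr; apply: eq_bigr => j _; ring.
  by ring.
exists h; split=> // [i|E].
  rewrite -(ler_pM2l (c0 i)) ch; apply: (rsums_le (hU i) (hV i)) => k.
  by apply: ler_sum.
(* A harmonic [h] forces equality in the convexity inequality, hence [theta v_i = theta^k v_j] along
   every transition. *)
apply: theta_drift_absurd => k i j Aij.
have hU' : rsums (U i) (theta * v i 0) by rewrite -ch -E.
have UVk := rsums_eq_of_le hU' (hV i) (fun k => ler_sum _ (fun j _ => UV i k j)) k.
have := eq_of_sum_le (UV i k) UVk j; rewrite term term2 => /(mulfI (lt0r_neq0 Aij))/eqP.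
rewrite (expR_convex _ _ b0 b1) => /eqP /(congr1 (@expR R)).
by rewrite !expRD eX !eg es.
Qed.

Lemma det_Az_annulus z : 1 < nc z -> nc z <= theta -> \det (z%:M - Az z) = 0 ->
  nc z = theta /\ z ^+ tau = toC theta ^+ tau.
Proof.
move=> z1 zth D0; have zr : nc z <= r1 by apply: le_trans zth _.
have z0 : 0 < nc z by apply: lt_trans z1.
have [w w0 wK] : exists2 w : 'rV[C]_M.+1, w != 0 & w *m (z%:M - Az z) = 0.
  by apply/det0P; rewrite D0.
have wA : w *m Az z = z *: w.
  by apply/eqP; rewrite eq_sym -subr_eq0 -mul_mx_scalar -mulmxBr wK.
move: zth; rewrite le_eqVlt => /orP[/eqP e|lt]; last first.
  have [h [h0 h1 h2]] := superharmonic_interp z1 lt; exfalso; apply: h2.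
  by have [] := left_eigen_abs w0 zr z0 wA h0 h1.
split=> //; have Ah i : (Astar A (nc z) *m v) i 0 <= nc z * v i 0.
  by rewrite e Av mxE.
have := eigen_phase w0 zr z0 wA v0 Ah; rewrite e expr_div_n => /(congr1 (fun x => x * toC theta ^+ tau)).
by rewrite mul1r mulfVK // expf_neq0 // -nc_eq0 nc_toC normr_eq0 gt_eqF.
Qed.

Lemma Az_diff (x : C) i j : nc x < r1 -> exists G, [/\ an r1 G,
   forall z, nc z <= r1 -> Az z i j = Az x i j + (z - x) * G z &
   csums (fun k => k%:R * toC (A k i j) * x ^+ k.-1) (G x)].
Proof.
move=> xr; have [G [aG GE Gx]] := ps_diff (ltW r10) xr (Al1 i j).
by exists G; split=> // z zr; rewrite !mxE GE.
Qed.

Definition dAstar : 'M[R]_M.+1 :=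
  \matrix_(i, j) rsum (fun k => k%:R * A k i j * theta ^+ k.-1).

Let ncth : nc (toC theta) = theta.
Proof. by rewrite nc_toC gtr0_norm. Qed.

Lemma dAstar_real i j (L : C) :
  csums (fun k => k%:R * toC (A k i j) * toC theta ^+ k.-1) L ->
  rsums (fun k => k%:R * A k i j * theta ^+ k.-1) (dAstar i j) /\ L = toC (dAstar i j).
Proof.
move=> h; rewrite mxE; apply: csums_real; apply: csums_ext h => k /=.
by rewrite !rmorphM rmorphXn rmorph_nat.
Qed.

Lemma dAstar_rsums i j : rsums (fun k => k%:R * A k i j * theta ^+ k.-1) (dAstar i j).
Proof.
have [|G [_ _ /dAstar_real[]]] // := @Az_diff (toC theta) i j; by rewrite ncth.
Qed.

(** Dividing twice by [z - theta] in the disc algebra leaves a bounded second quotient. *)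
Lemma Astar_taylor : exists S, 0 <= S /\ forall i j y, 0 <= y -> y <= r1 ->
  `|Astar A y i j - Astar A theta i j - (y - theta) * dAstar i j| <= S * (y - theta) ^+ 2.
Proof.
have [||S hS] := @uniform_const R 'I_M.+1 'I_M.+1 (fun i j S => forall y, 0 <= y -> y <= r1 ->
  `|Astar A y i j - Astar A theta i j - (y - theta) * dAstar i j| <= S * (y - theta) ^+ 2).
- move=> i j K K' KK' h y y0 yr; apply: le_trans (h y y0 yr) _.
  by rewrite ler_wpM2r ?sqr_ge0.
- move=> i j; have thr : nc (toC theta) < r1 by rewrite ncth.
  have [G [aG GE Gx]] := Az_diff i j thr.
  have [_ Gth] := dAstar_real Gx.
  have [G2 [aG2 G2E _]] := an_diff thr aG; have [S S0 hS] := an_bounded aG2.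
  exists S => y y0 yr; have ncy : nc (toC y) <= r1 by rewrite nc_toC ger0_norm.
  have E y' : 0 <= y' -> y' <= r1 -> Az (toC y') i j = toC (Astar A y' i j).
    by move=> a b; rewrite Az_real // mxE.
  have H1 := G2E _ ncy; rewrite Gth in H1.
  have H := GE _ ncy; rewrite H1 in H.
  have {}H := etrans (esym (E _ y0 yr)) (etrans H (congr1 (+%R^~ _) (E _ (ltW th0) thr1'))).
  rewrite -nc_toC; have -> : toC (Astar A y i j - Astar A theta i j - (y - theta) * dAstar i j) =
    toC ((y - theta) ^+ 2) * G2 (toC y).
    by rewrite !rmorphB !rmorphM /= !rmorphB /= H; ring.
  by rewrite ncM mulrC nc_toC ger0_norm ?sqr_ge0 // ler_wpM2r ?sqr_ge0 ?hS.
exists `|S|; split=> // i j y y0 yr; apply: le_trans (hS i j y y0 yr) _.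
by rewrite ler_wpM2r ?sqr_ge0 // ler_norm.
Qed.

(** Mean of [k] in the process tilted by [theta] and [v], with transitions
    [theta^(k-1) A(k)_ij v_j / v_i] and stationary law [mu_i v_i]. A step moves the level by
    [k - 1], so [1 < drift] says that the tilted process drifts upwards. *)
Definition drift : R := (mu *m dAstar *m v) 0 0.

Lemma driftE : drift = \sum_i \sum_j mu 0 i * dAstar i j * v j 0.
Proof.
rewrite /drift mxE exchange_big; apply: eq_bigr => j _; rewrite mxE mulr_suml.
by apply: eq_bigr.
Qed.

Let muv_sum : \sum_i mu 0 i * v i 0 = 1.
Proof. by rewrite -muv mxE. Qed.

(** Jensen in the form [1 + Y <= exp Y] with [exp Y = theta v_i / (theta^k v_j)], averaged over the
    tilted law. The right side has mean 1 by stochasticity; on the left the terms in [ln v] cancel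
    by stationarity and leave [1 + ln theta (1 - drift)]. If [drift <= 1], equality holds termwise,
    which [theta_drift_absurd] excludes. *)
Lemma drift_gt1 : 1 < drift.
Proof.
rewrite ltNge; apply/negP => dle.
pose sg := ln theta; pose g j := ln (v j 0).
have sg0 : 0 < sg by rewrite ln_gt0.
have eg j : expR (g j) = v j 0 by rewrite lnK ?posrE.
have es : expR sg = theta by rewrite lnK ?posrE.
have eX x k : expR (k%:R * x) = expR x ^+ k :> R by rewrite expRM_natl.
pose Y k i j : R := (sg + g i) - (k%:R * sg + g j).
pose U k := \sum_i \sum_j mu 0 i * theta * v i 0 * (1 ^+ k * A k i j).
pose V k := \sum_i \sum_j (mu 0 i * v j 0 * (1 + sg + g i - g j) * (theta ^+ k * A k i j) +
   - sg * mu 0 i * v j 0 * theta * (k%:R * A k i j * theta ^+ k.-1)).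
have tU k i j : mu 0 i * theta * v i 0 * (1 ^+ k * A k i j) =
   mu 0 i * A k i j * expR (k%:R * sg + g j) * expR (Y k i j).
  rewrite expr1n mul1r -[RHS]mulrA -expRD /Y addrC subrK expRD es eg; ring.
have tV k i j : mu 0 i * v j 0 * (1 + sg + g i - g j) * (theta ^+ k * A k i j) +
   - sg * mu 0 i * v j 0 * theta * (k%:R * A k i j * theta ^+ k.-1) =
   mu 0 i * A k i j * expR (k%:R * sg + g j) * (1 + Y k i j).
  rewrite expRD eX es eg /Y; case: k => [|k]; first by rewrite !mul0r; ring.
  by rewrite /= exprS; ring.
have VU k i j : mu 0 i * v j 0 * (1 + sg + g i - g j) * (theta ^+ k * A k i j) +
   - sg * mu 0 i * v j 0 * theta * (k%:R * A k i j * theta ^+ k.-1) <=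
   mu 0 i * theta * v i 0 * (1 ^+ k * A k i j).
  rewrite tU tV ler_wpM2l ?expR_ge1Dx // mulr_ge0 ?expR_ge0 // mulr_ge0 //; exact: ltW.
have hU : rsums U theta.
  have := rsums_sum (fun i => rsums_sum (fun j => rsumsZ (mu 0 i * theta * v i 0)
    (Astar_rsums i j ler01 one_r1))).
  congr (rsums _ _); under eq_bigr => i _ do rewrite -mulr_sumr stoch mulr1 mulrAC.
  by rewrite -mulr_suml muv_sum mul1r.
have hV : rsums V (theta + theta * sg * (1 - drift)).
  have := rsums_sum (fun i => rsums_sum (fun j => rsumsD
    (rsumsZ (mu 0 i * v j 0 * (1 + sg + g i - g j)) (Astar_rsums i j (ltW th0) thr1'))
    (rsumsZ (- sg * mu 0 i * v j 0 * theta) (dAstar_rsums i j)))).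
  congr (rsums _ _).
  have S1 : \sum_i \sum_j mu 0 i * (1 + sg + g i) * (Astar A theta i j * v j 0) =
     theta * (1 + sg) + theta * \sum_i mu 0 i * v i 0 * g i.
    under eq_bigr => i _ do rewrite -mulr_sumr row_v.
    rewrite -[theta * (1 + sg)]mulr1 -muv_sum !mulr_sumr -big_split.
    by apply: eq_bigr => i _ /=; ring.
  have S2 : \sum_i \sum_j mu 0 i * Astar A theta i j * (v j 0 * g j) =
     theta * \sum_i mu 0 i * v i 0 * g i.
    rewrite exchange_big /=; under eq_bigr => j _ do rewrite -mulr_suml col_mu.
    by rewrite mulr_sumr; apply: eq_bigr => j _; ring.
  have S3 : \sum_i \sum_j mu 0 i * dAstar i j * v j 0 = drift by rewrite driftE.
  have -> : theta + theta * sg * (1 - drift) = (theta * (1 + sg) + theta * \sum_i mu 0 i * v i 0 * g i)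
     - theta * \sum_i mu 0 i * v i 0 * g i - (sg * theta) * drift by ring.
  rewrite -S1 -S2 -S3 mulr_sumr -!sumrB; apply: eq_bigr => i _.
  by rewrite mulr_sumr -!sumrB; apply: eq_bigr => j _; ring.
have VUk k : V k <= U k by apply: ler_sum => i _; apply: ler_sum.
have tot := rsums_le hV hU VUk.
have pos : 0 <= theta * sg * (1 - drift) by rewrite !mulr_ge0 ?subr_ge0 // ltW.
have tot0 : theta + theta * sg * (1 - drift) = theta by lra.
have hV' : rsums V theta by move: hV; rewrite tot0.
apply: theta_drift_absurd => k i j Aij.
have E1 := eq_of_sum_le (fun i => ler_sum _ (fun j _ => VU k i j)) (rsums_eq_of_le hV' hU VUk k) i.
have := eq_of_sum_le (VU k i) E1 j; rewrite tU tV => /mulfI H.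
have {}H : 1 + Y k i j = expR (Y k i j).
  by apply: H; rewrite !mulf_neq0 // gt_eqF // expR_gt0.
have Y0 : Y k i j = 0.
  apply/eqP; apply: contraT => /expR_gt1Dx; by rewrite H ltxx.
have : expR (sg + g i) = expR (k%:R * sg + g j) by congr expR; move: Y0; rewrite /Y; lra.
by rewrite !expRD eX es !eg.
Qed.

(* First-order perturbation: [g] solves the Poisson equation
   [(Astar A theta - theta) g = (drift - dAstar) v]. *)
Lemma perturbed_eigenvector : exists (g : 'cV[R]_M.+1) (K e0 : R), [/\ 0 < e0, 0 <= K &
  forall e, `|e| <= e0 -> [/\ 0 < theta + e, theta + e <= r1,
    forall i, 0 < (v + e *: g) i 0 &
    forall i, `|(Astar A (theta + e) *m (v + e *: g)) i 0 - (theta + e * drift) * (v + e *: g) i 0|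
      <= K * e ^+ 2 * (v + e *: g) i 0]].
Proof.
have [g hg] : exists g : 'cV[R]_M.+1, Astar A theta *m g - theta *: g = drift *: v - dAstar *m v.
  apply: (poisson_solve (Astar_nonneg (ltW th0) thr1') (Astar_irr th0 thr1') mu0 muA).
  apply/matrixP => i j; rewrite !ord1 mulmxBr -scalemxAr mulmxA.
  have E (X Y : 'M[R]_1) : (drift *: X - Y) 0 0 = drift * X 0 0 - Y 0 0 by rewrite !mxE.
  by rewrite E muv mulr1 -/drift subrr mxE.
have [S [S0 hS]] := Astar_taylor.
have [m m0 hm] := fin_pos_lower v0.
pose Sg := \sum_j `|g j 0|; pose Sv := \sum_j `|v j 0|.
have Sg0 : 0 <= Sg by apply: sumr_ge0.
have Sv0 : 0 <= Sv by apply: sumr_ge0.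
pose K0 := (\sum_i `|(dAstar *m g) i 0|) + `|drift| * Sg + S * (Sv + Sg).
have K00 : 0 <= K0 by rewrite !addr_ge0 ?mulr_ge0 ?addr_ge0 // sumr_ge0.
(* The four bounds keep |e| below 1, [v + e g] above [m / 2], [theta + e] within [r1], and
   [theta + e] positive. *)
pose e0 := Num.min (Num.min 1 (m / (2 * (1 + Sg)))) (Num.min (r1 - theta) (theta / 2)).
have Sg1 : 0 < 2 * (1 + Sg) by rewrite mulr_gt0 // ltr_pwDl.
exists g, (2 * K0 / m), e0; split.
- by rewrite !lt_min ltr01 divr_gt0 // subr_gt0 thr1 divr_gt0.
- by rewrite divr_ge0 ?mulr_ge0 // ltW.
move=> e; rewrite /e0 !le_min => /andP[/andP[e1 em] /andP[er eth]].
have [ea eb] : e <= `|e| /\ - e <= `|e| by rewrite ler_norm -normrN ler_norm.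
have th_e0 : 0 < theta + e by move: eth eb th0; lra.
have th_er : theta + e <= r1 by lra.
have gl i : `|g i 0| <= Sg by rewrite /Sg (bigD1 i) //= lerDl sumr_ge0.
have W i : m / 2 <= (v + e *: g) i 0.
  rewrite !mxE; have : `|e * g i 0| <= m / 2.
    rewrite normrM; apply: le_trans (_ : m / (2 * (1 + Sg)) * Sg <= _).
      by rewrite ler_pM.
    rewrite mulrAC ler_pdivrMr //; nra.
  by rewrite ler_norml => /andP[h _]; have := hm i; lra.
have W0 i : 0 < (v + e *: g) i 0 by apply: lt_le_trans (W i); rewrite divr_gt0.
split=> // i; pose T j := Astar A (theta + e) i j - Astar A theta i j - e * dAstar i j.
have hT j : `|T j| <= S * e ^+ 2.
  have := hS i j (theta + e) (ltW th_e0) th_er.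
  by have -> : theta + e - theta = e by ring.
have gi : \sum_j Astar A theta i j * g j 0 - theta * g i 0 =
     drift * v i 0 - \sum_j dAstar i j * v j 0.
  by have := congr1 (fun u : 'cV_M.+1 => u i 0) hg; rewrite !mxE.
(* The first-order terms cancel by the Poisson equation; [T] is the Taylor remainder. *)
have E : (Astar A (theta + e) *m (v + e *: g)) i 0 - (theta + e * drift) * (v + e *: g) i 0 =
   e ^+ 2 * ((dAstar *m g) i 0 - drift * g i 0) + \sum_j T j * (v j 0 + e * g j 0).
  have -> : (Astar A (theta + e) *m (v + e *: g)) i 0 =
     \sum_j Astar A theta i j * v j 0 + e * \sum_j Astar A theta i j * g j 0 +
     e * \sum_j dAstar i j * v j 0 + e ^+ 2 * \sum_j dAstar i j * g j 0 +
     \sum_j T j * (v j 0 + e * g j 0).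
    rewrite mxE !mulr_sumr -!big_split; apply: eq_bigr => j _ /=.
    by rewrite /T ![(v + e *: g) _ _]mxE [(e *: g) _ _]mxE; ring.
  rewrite row_v [(dAstar *m g) _ _]mxE ![(v + e *: g) _ _]mxE [(e *: g) _ _]mxE.
  have -> : \sum_j Astar A theta i j * g j 0 = theta * g i 0 +
     drift * v i 0 - \sum_j dAstar i j * v j 0 by move: gi; lra.
  by ring.
apply: le_trans (_ : K0 * e ^+ 2 <= _); last first.
  have -> : 2 * K0 / m * e ^+ 2 * (v + e *: g) i 0 = K0 * e ^+ 2 * ((v + e *: g) i 0 * 2 / m).
    by field; rewrite gt_eqF.
  apply: ler_peMr; first by rewrite mulr_ge0 ?sqr_ge0.
  by rewrite ler_pdivlMr // mul1r; have := W i; lra.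
rewrite E; apply: le_trans (ler_normD _ _) _; rewrite normrM [`|e ^+ 2|]ger0_norm ?sqr_ge0 //.
have b1 : `|(dAstar *m g) i 0 - drift * g i 0| <=
    (\sum_i `|(dAstar *m g) i 0|) + `|drift| * Sg.
  apply: le_trans (ler_normB _ _) _; rewrite lerD //.
    by rewrite (bigD1 i) //= lerDl sumr_ge0.
  by rewrite normrM ler_wpM2l.
have b2 : `|\sum_j T j * (v j 0 + e * g j 0)| <= S * e ^+ 2 * (Sv + Sg).
  apply: le_trans (ler_norm_sum _ _ _) _; rewrite -big_split mulr_sumr /=.
  apply: ler_sum => j _; rewrite normrM ler_pM // (le_trans (ler_normD _ _)) // lerD //.
  by rewrite normrM ler_piMl.
have e2 : 0 <= e ^+ 2 by rewrite sqr_ge0.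
have := ler_wpM2l e2 b1; rewrite /K0; lra.
Qed.

(** By [delta_bounds] on the perturbed eigenvector, the Perron root at [theta + e] is within [K e^2]
    of [theta + e * drift]; the case [e = 0] gives its value at [theta]. *)
Lemma derive_delta :
  derive1 (fun y : R => complex.Re (delta (cmx (Astar A y)))) theta = drift.
Proof.
have [g [K [e0 [e0p K0 H]]]] := perturbed_eigenvector.
pose f (y : R) := complex.Re (delta (cmx (Astar A y))).
have key e : `|e| <= e0 -> `|f (theta + e) - (theta + e * drift)| <= K * e ^+ 2.
  move=> /H[h1 h2 W0 hW].
  have := delta_bounds (Astar_nonneg (ltW h1) h2) (Astar_irr h1 h2) (a := theta + e * drift - K * e ^+ 2)
    (b := theta + e * drift + K * e ^+ 2) W0.
  rewrite -/(f _) => /(_ _)/andP[i|]; first by have := hW i; rewrite ler_norml => /andP[]; rewrite mulrBl mulrDl; lra.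
  by rewrite ler_norml; lra.
have f0 : f theta = theta.
  have := key 0; rewrite normr0 (ltW e0p) addr0 mul0r addr0 expr0n mulr0 => /(_ isT).
  by rewrite normr_le0 subr_eq0 => /eqP.
rewrite /derive1; apply: cvg_lim => //; apply/cvgrPdist_le => e ep.
have K1 : 0 < K + 1 by rewrite ltr_wpDl.
near=> h.
have h0 : h != 0 by near: h; exact: nbhs_dnbhs_neq.
have he0 : `|h| <= e0 by near: h; exact: dnbhs0_le.
have heK : `|h| <= e / (K + 1) by near: h; apply: dnbhs0_le; rewrite divr_gt0.
rewrite -/(f _) -/(f _) [h + _]addrC.
have -> : drift - h^-1 *: (f (theta + h) - f theta) = - h^-1 * (f (theta + h) - (theta + h * drift)).
  by rewrite f0 /GRing.scale /=; field.
have hn : 0 < `|h| by rewrite normr_gt0.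
rewrite normrM normrN normfV mulrC ler_pdivrMr //; apply: le_trans (key _ he0) _.
rewrite -real_normK ?num_real // expr2 mulrA ler_wpM2r // -[e](mulfVK (lt0r_neq0 K1)) mulrC.
by rewrite ler_pM // lerDl.
Unshelve. all: by end_near.
Qed.

(** Slightly below [theta], at [theta - t], the approximate eigenvalue is [theta - t * drift], which
    is smaller than [theta - t] because [drift > 1]. *)
Lemma strictly_superharmonic : exists s (h : 'cV[R]_M.+1) (kappa : R),
  [/\ 1 < s, s < theta, forall i, 0 < h i 0, 0 < kappa &
    forall i, (Astar A s *m h) i 0 <= s * (1 - kappa) * h i 0].
Proof.
have [g [K [e0 [e0p K0 H]]]] := perturbed_eigenvector; have d1 := drift_gt1.
have K1 : 0 < 2 * (K + 1) by rewrite mulr_gt0 // ltr_wpDl.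
(* The second bound lets the quadratic error consume at most half of the gain [t * (drift - 1)]; the
   third keeps [theta - t] above 1. *)
pose t := Num.min (Num.min e0 ((drift - 1) / (2 * (K + 1)))) ((theta - 1) / 2).
have t0 : 0 < t by rewrite !lt_min e0p !divr_gt0 ?subr_gt0.
have te0 : t <= e0 by rewrite !ge_min lexx.
have td : t <= (drift - 1) / (2 * (K + 1)) by rewrite !ge_min lexx orbT.
have tth : t <= (theta - 1) / 2 by rewrite !ge_min lexx orbT.
have [|h1 h2 W0 hW] := H (- t); first by rewrite normrN gtr0_norm.
have s1 : 1 < theta - t by move: tth th1; lra.
have s0 : 0 < theta - t by lra.
exists (theta - t), (v + - t *: g), (t * (drift - 1) / (2 * (theta - t))); split=> //.
- by lra.
- by rewrite !mulr_gt0 ?invr_gt0 ?subr_gt0 ?mulr_gt0.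
move=> i; have -> : (theta - t) * (1 - t * (drift - 1) / (2 * (theta - t))) =
   theta - t * drift + t * ((drift - 1) / 2).
  by field; rewrite gt_eqF.
have := hW i; rewrite ler_norml => /andP[_].
have : K * (- t) ^+ 2 * (v + - t *: g) i 0 <= t * ((drift - 1) / 2) * (v + - t *: g) i 0.
  rewrite ler_wpM2r ?(ltW (W0 _)) // sqrrN expr2 mulrCA ler_wpM2l ?(ltW t0) //.
  move: td; rewrite ler_pdivlMr // => td; nra.
by rewrite mulNr; lra.
Qed.

End Astar.

(** * Meromorphic continuation *)

Section Continuation.
Variable R : realType.
Local Notation C := R[i].
Local Notation toC := (real_complex R).
Variables (J : finType) (X : J -> C -> C) (theta : R) (tau : nat).
Hypothesis X_an : forall j, an 1 (X j).
Hypothesis th1 : 1 < theta.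
Hypothesis tau0 : (0 < tau)%N.

Let th0 : 0 < theta.
Proof. exact: lt_trans th1. Qed.

Definition polar (z : C) : C := z ^+ tau - toC theta ^+ tau.

Lemma polar_an r : an r polar.
Proof. by apply: an_sub (an_cst _ _); apply: an_exp; exact: an_id. Qed.

(* [(z ^+ tau - x ^+ tau) / (z - x)]. *)
Definition polar_quot (x z : C) : C := \sum_(i < tau) z ^+ (tau.-1 - i) * x ^+ i.

Lemma polar_quot_an r x : an r (polar_quot x).
Proof.
apply: an_sum => i _; apply: an_mul; last exact: an_cst.
by apply: an_exp; exact: an_id.
Qed.

Lemma polar_quotE x z : x ^+ tau = toC theta ^+ tau -> polar z = (z - x) * polar_quot x z.
Proof.
move=> xt; rewrite /polar -xt /polar_quot; case: (tau) tau0 => // t _.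
by rewrite subrXX.
Qed.

Lemma polar_quot_diag x : x ^+ tau = toC theta ^+ tau ->
  x * polar_quot x x = tau%:R * toC theta ^+ tau.
Proof.
move=> xt; rewrite -xt /polar_quot mulr_sumr; case: (tau) tau0 => // t _.
rewrite (eq_bigr (fun=> x ^+ t.+1)) => [|i _].
  by rewrite sumr_const card_ord mulr_natl.
by rewrite -exprD subnK -?exprS // -ltnS.
Qed.

Lemma polar_neq0 z : nc z < theta -> polar z != 0.
Proof.
move=> zth; rewrite subr_eq0; apply/eqP => /(congr1 (@nc R)).
rewrite !ncX nc_toC gtr0_norm // => /eqP.
by rewrite eqrXn2 ?nc_ge0 ?(ltW th0) // lt_eqF.
Qed.

(** [s] lists the denominators still to be cleared. A root in the unit disc is a removable
    singularity, since [X] is analytic there; a root with [x ^+ tau = theta ^+ tau] is absorbed by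
    one more factor [polar]; a root beyond [theta] is inverted on a smaller disc. *)
Lemma clear_poles (s : seq C) : forall m r (G : J -> C -> C), theta < r ->
  (forall x, x \in s -> [\/ nc x <= 1, x ^+ tau = toC theta ^+ tau | theta < nc x]) ->
  (forall j, an r (G j)) ->
  (forall j z, nc z <= 1 -> X j z * polar z ^+ m * \prod_(x <- s) (z - x) = G j z) ->
  exists m' r' (F : J -> C -> C), [/\ theta < r', r' <= r, forall j, an r' (F j) &
    forall j z, nc z <= 1 -> X j z * polar z ^+ m' = F j z].
Proof.
elim: s => [|x s IH] m r G thr hs aG GE.
  by exists m, r, G; split=> // j z z1; rewrite -GE // big_nil mulr1.
have hs' y : y \in s -> [\/ nc y <= 1, y ^+ tau = toC theta ^+ tau | theta < nc y].
  by move=> ys; apply: hs; rewrite inE ys orbT.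
have a1 : an 1 (fun z => \prod_(x <- s) (z - x)).
  by apply: an_prod => y _; apply: an_sub; [exact: an_id | exact: an_cst].
have [x1|xt|xth] := hs x (mem_head _ _).
- have xr : nc x < r by apply: le_lt_trans x1 _; exact: lt_trans thr.
  have Gx j : G j x = 0 by rewrite -GE // big_cons subrr mul0r mulr0.
  have H j : exists G' : C -> C, an r G' /\ forall z, nc z <= r -> G j z = (z - x) * G' z.
    by have [G' [? ? _]] := an_div xr (aG j) (Gx j); exists G'.
  have [G' hG'] := boolp.choice H.
  apply: (IH m r G' thr hs') => [j|j z z1]; first by case: (hG' j).
  have r1 : 1 <= r by apply/ltW; exact: lt_trans thr.
  have E z' : nc z' <= 1 -> z' != x ->
      X j z' * polar z' ^+ m * \prod_(x <- s) (z' - x) = G' j z'.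
    move=> z'1 z'x; have zx : z' - x != 0 by rewrite subr_eq0.
    apply: (mulfI zx); have [_ <-] := hG' j; last exact: le_trans r1.
    by rewrite -GE // big_cons; ring.
  have [->|] := eqVneq z x; last exact: E.
  apply: (@an_eq_at _ 1) x1 E => //.
    by apply: an_mul a1; apply: an_mul => //; apply: an_exp; exact: polar_an.
  by apply: an_le r1 _; case: (hG' j).
- apply: (IH m.+1 r (fun j z => G j z * polar_quot x z) thr hs') => [j|j z z1].
    by apply: an_mul => //; exact: polar_quot_an.
  by rewrite -GE // big_cons exprS (polar_quotE _ xt); ring.
(* The midpoint leaves room above [theta] and excludes [x] from the closed disc. *)
pose r' := Num.min r ((theta + nc x) / 2).
have r'r : r' <= r by rewrite ge_min lexx.
have r'x : r' < nc x by rewrite gt_min; apply/orP; right; lra.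
have thr' : theta < r' by rewrite lt_min thr; lra.
have r'0 : 0 < r' by apply: lt_trans thr'.
have [j|j z z1|m' [r'' [F [h1 h2 h3 h4]]]] := IH m r' (fun j z => G j z * (z - x)^-1) thr' hs'.
- by apply: an_mul; [exact: an_le (aG j) | exact: an_inv_lin].
- have zx : z - x != 0.
    by rewrite subr_eq0; apply: contraTneq xth => <-; rewrite -leNgt (le_trans z1) ?ltW.
  by apply: (mulIf zx); rewrite mulfVK // -GE // big_cons; ring.
by exists m', r'', F; split=> //; exact: le_trans r'r.
Qed.

(** The zeros of the denominator [D] are collected in a finite list and the zero-free cofactor is
    inverted, which reduces the claim to [clear_poles]. *)
Lemma continuation r1 (D : C -> C) (N : J -> C -> C) (z0 : C) : theta < r1 -> an r1 D ->
  (forall j, an r1 (N j)) -> nc z0 < r1 -> D z0 != 0 ->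
  (forall z, 1 < nc z -> nc z <= theta -> D z = 0 -> z ^+ tau = toC theta ^+ tau) ->
  (forall j z, nc z <= 1 -> X j z * D z = N j z) ->
  exists m r (F : J -> C -> C), [/\ theta < r, r < r1, forall j, an r (F j) &
    forall j z, nc z <= 1 -> X j z * polar z ^+ m = F j z].
Proof.
move=> thr1 aD aN z0r Dz0 Dz XD; pose r := (theta + r1) / 2.
have thr : theta < r by rewrite /r; lra.
have rr1 : r < r1 by rewrite /r; lra.
have r0 : 0 < r by apply: lt_trans thr.
have [s [E [hs aE DE E0]]] := an_factor r0 rr1 aD z0r Dz0.
have aEr := an_le (ltW rr1) aE.
have [m0 m00 hm0] := an_nonzero_ge r0 aEr E0.
have aEi := an_inv r0 m00 aEr hm0.
have D0 x : x \in s -> D x = 0.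
  move=> xs; rewrite DE ?(le_trans (hs _ xs)) ?(ltW rr1) // (big_rem x) //=.
  by rewrite subrr !mul0r.
have [x xs|j|j z z1|m [r' [F [h1 h2 h3 h4]]]] :=
  @clear_poles s 0%N r (fun j z => N j z * (E z)^-1) thr _ _ _.
- case: (lerP (nc x) 1) => x1; first by constructor 1.
  case: (lerP (nc x) theta) => xth; last by constructor 3.
  by constructor 2; apply: Dz => //; exact: D0.
- by apply: an_mul => //; apply: an_le (aN j); exact: ltW.
- have zr : nc z <= r by apply: le_trans z1 _; apply/ltW; exact: lt_trans thr.
  rewrite expr0 mulr1 -XD // DE; last by apply: le_trans zr _; exact: ltW.
  by field; exact: E0.
by exists m, r', F; split=> //; exact: le_lt_trans rr1.
Qed.

Variable w : C.
Hypothesis wprim : tau.-primitive_root w.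
Hypothesis wnorm : nc w = 1.

Definition node (nu : nat) : C := toC theta * w ^+ nu.

Lemma node_norm nu : nc (node nu) = theta.
Proof. by rewrite ncM ncX wnorm expr1n mulr1 nc_toC gtr0_norm. Qed.

Lemma node_exp nu : node nu ^+ tau = toC theta ^+ tau.
Proof. by rewrite exprMn -exprM mulnC exprM (prim_expr_order wprim) expr1n mulr1. Qed.

Lemma toC_th0 : toC theta != 0.
Proof. by rewrite -nc_eq0 nc_toC normr_eq0 gt_eqF. Qed.

Lemma w_neq0 : w != 0.
Proof. by rewrite -nc_eq0 wnorm oner_eq0. Qed.

Lemma node_neq0 nu : node nu != 0.
Proof. by rewrite mulf_neq0 ?toC_th0 // expf_neq0 // w_neq0. Qed.

Lemma node_inj (i j : 'I_tau) : node i = node j -> i = j.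
Proof.
move=> /(mulfI toC_th0) /eqP; rewrite (eq_prim_root_expr wprim) !modn_small //.
by move=> /eqP /val_inj.
Qed.

Lemma nodes_uniq : uniq [seq node (val i) | i <- enum 'I_tau].
Proof. by rewrite map_inj_uniq ?enum_uniq //; exact: node_inj. Qed.

Lemma prod_nodes z : \prod_(x <- [seq node (val i) | i <- enum 'I_tau]) (z - x) = polar z.
Proof.
have h : \prod_(x <- [seq node (val i) | i <- enum 'I_tau]) ('X - x%:P) =
    'X^tau - (toC theta ^+ tau)%:P.
  rewrite (@all_roots_prod_XsubC _ ('X^tau - (toC theta ^+ tau)%:P)
     [seq node (val i) | i <- enum 'I_tau]).
  - by rewrite (monicP (monicXnsubC _ tau0)) scale1r.
  - by rewrite size_XnsubC // size_map -cardE card_ord.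
  - apply/allP => _ /mapP[i _ ->]; rewrite rootE !hornerE.
    by rewrite node_exp subrr.
  - by rewrite uniq_rootsE nodes_uniq.
have := congr1 (fun p => p.[z]) h; rewrite horner_prod !hornerE.
by rewrite /polar => <-; apply: eq_bigr => x _; rewrite !hornerE.
Qed.

(** Up to scaling, the [polar_quot (node i)] form the Lagrange basis at the nodes. *)
Lemma polar_quot_offdiag (i j : 'I_tau) : i != j -> polar_quot (node i) (node j) = 0.
Proof.
move=> ij; have := polar_quotE (node j) (node_exp i); rewrite /polar node_exp subrr.
move=> /esym/eqP; rewrite mulf_eq0 subr_eq0 => /orP[/eqP /node_inj e|/eqP //].
by rewrite e eqxx in ij.
Qed.

Lemma polar_divides r (F : C -> C) : theta < r -> an r F ->
  (forall i : 'I_tau, F (node i) = 0) ->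
  exists2 G, an r G & forall z, nc z <= r -> F z = polar z * G z.
Proof.
move=> thr aF F0; have [|G aG GE] := an_div_seq aF nodes_uniq.
  by move=> _ /mapP[i _ ->]; rewrite node_norm; split=> //; exact: F0.
by exists G => // z zr; rewrite GE // prod_nodes.
Qed.

Lemma reduce_order m r (F : J -> C -> C) : theta < r ->
  (forall j, an r (F j)) -> (forall j z, nc z <= 1 -> X j z * polar z ^+ m.+1 = F j z) ->
  (forall j (i : 'I_tau), F j (node i) = 0) ->
  exists F' : J -> C -> C, (forall j, an r (F' j)) /\
    forall j z, nc z <= 1 -> X j z * polar z ^+ m = F' j z.
Proof.
move=> thr aF FE F0.
have H j : exists G : C -> C, an r G /\ forall z, nc z <= r -> F j z = polar z * G z.
  by have [G] := polar_divides thr (aF j) (F0 j); exists G.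
have [G hG] := boolp.choice H; exists G; split=> [j|j z z1]; first by case: (hG j).
have zth : nc z < theta by apply: le_lt_trans th1.
apply: (mulfI (polar_neq0 zth)); have [_ <-] := hG j.
  by rewrite -FE // exprS; ring.
by apply: le_trans z1 _; apply/ltW; exact: lt_trans thr.
Qed.

Lemma csums_geo (q : C) : nc q < 1 -> csums (fun k => q ^+ k) (1 - q)^-1.
Proof.
move=> q1; have q0 : 1 - q != 0.
  by rewrite subr_eq0; apply: contraTneq q1 => <-; rewrite nc1 ltxx.
have n0 : 0 < nc (1 - q) by rewrite nc_gt0.
move=> e e0; have [N hN] := expr_small (nc_ge0 q) q1 (mulr_gt0 e0 n0).
exists N => n /hN h.
have -> : \sum_(k < n) q ^+ k - (1 - q)^-1 = - (q ^+ n / (1 - q)).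
  have := subrX1 q n; set s := \sum_(k < n) _ => E.
  have -> : q ^+ n = 1 + (q - 1) * s by rewrite -E; ring.
  by field; exact: q0.
by rewrite ncN ncM ncV ncX ler_pdivrMr.
Qed.

(** The principal parts [res / (1 - z / node)] have coefficients [res * node ^- k]. Once they are
    subtracted, the function extends to the disc of radius [r], and [ps_coef_bound] controls the
    remaining coefficients. *)
Lemma mittag_leffler (a : J -> nat -> C) r (F : J -> C -> C) (res : 'I_tau -> J -> C) :
  theta < r -> (forall j, l1 (a j) 1) -> (forall j z, nc z <= 1 -> X j z = ps (a j) z) ->
  (forall j, an r (F j)) -> (forall j z, nc z <= 1 -> X j z * polar z = F j z) ->
  (forall j (nu : 'I_tau), F j (node nu) = - (tau%:R * toC theta ^+ tau * res nu j)) ->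
  forall j, exists S, forall k, nc (a j k - \sum_(nu < tau) res nu j * node nu ^- k) * r ^+ k <= S.
Proof.
move=> thr la Xa aF FE Fn j; have r0 : 0 < r by apply: lt_trans thr.
have r1 : 1 <= r by apply/ltW; exact: lt_trans thr.
(* [H] is [polar] times the difference of [X] and its principal parts, because
   [node * polar_quot node] equals [- polar / (1 - z / node)]. *)
pose H z := F j z + \sum_(nu < tau) res nu j * (node nu * polar_quot (node nu) z).
have aH : an r H.
  apply: an_add => //; apply: an_sum => nu _; apply: an_scale; apply: an_scale.
  exact: polar_quot_an.
have Hn (i : 'I_tau) : H (node i) = 0.
  rewrite /H (bigD1 i) //= polar_quot_diag ?node_exp // Fn big1 ?addr0.
    by ring.
  by move=> nu nui; rewrite polar_quot_offdiag // !mulr0.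
have [G aG GE] := polar_divides thr aH Hn.
pose b k := a j k - \sum_(nu < tau) res nu j * node nu ^- k.
have nV nu : nc (node nu)^-1 < 1 by rewrite ncV node_norm invf_lt1.
have bsums z : nc z <= 1 -> csums (fun k => b k * z ^+ k)
    (ps (a j) z - \sum_(nu < tau) res nu j * (1 - z / node nu)^-1).
  move=> z1; rewrite -[- \sum_nu _]mulN1r.
  have hg nu : nc (z / node nu) < 1.
    by rewrite ncM; apply: le_lt_trans (nV nu); rewrite ler_piMl ?nc_ge0.
  have := csumsD (ps_csums (la j) z1)
    (csumsZ (-1) (csums_sum (fun nu : 'I_tau => csumsZ (res nu j) (csums_geo (hg nu))))).
  apply: csums_ext => k; rewrite /b mulrBl mulN1r mulr_suml; congr (_ - _).
  by apply: eq_bigr => nu _; rewrite exprMn exprVn; ring.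
have lb : l1 b 1.
  have [K hK] := la j.
  exists (K + \sum_(nu < tau) nc (res nu j) * (1 - nc (node nu)^-1)^-1) => n.
  apply: le_trans (_ : \sum_(k < n) nc (a j k) * 1 ^+ k +
    \sum_(nu < tau) nc (res nu j) * \sum_(k < n) nc (node nu)^-1 ^+ k <= _).
    under [X in _ <= _ + X]eq_bigr => nu _ do rewrite mulr_sumr.
    rewrite exchange_big -big_split /=; apply: ler_sum => k _.
    rewrite expr1n !mulr1; apply: le_trans (ncB _ _) _; rewrite lerD2l.
    apply: le_trans (nc_sum _ _ _) _; apply: ler_sum => nu _.
    by rewrite ncM -exprVn ncX.
  apply: lerD => //; apply: ler_sum => nu _; rewrite ler_wpM2l ?nc_ge0 //.
  by rewrite geo_sum_le ?nc_ge0.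
apply: (ps_coef_bound lb r1 aG) => z z1.
rewrite /ps (csums_csum (bsums z z1)).
have zth : nc z < theta by apply: le_lt_trans th1.
have zr : nc z <= r by apply/ltW; apply: lt_trans thr.
apply: (mulfI (polar_neq0 zth)); rewrite -GE // /H mulrBr -Xa // mulrC FE //.
congr (_ + _); rewrite mulr_sumr -sumrN; apply: eq_bigr => nu _.
have zn : z - node nu != 0.
  by rewrite subr_eq0; apply: contraTneq zth => ->; rewrite node_norm ltxx.
rewrite (polar_quotE z (node_exp nu)); have n0 := node_neq0 nu.
have -> : 1 - z / node nu = - (z - node nu) / node nu by field.
by field; rewrite zn n0.
Qed.

End Continuation.

(** * Absence of faster decay *)

Section Escape.
Variable R : realType.
Variables (M : nat) (A : nat -> 'M[R]_M.+1) (theta s kappa : R) (v h : 'cV[R]_M.+1).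
Hypothesis A0 : forall k i j, 0 <= A k i j.
Hypothesis s1 : 1 < s.
Hypothesis sth : s < theta.
Hypothesis kappa0 : 0 < kappa.
Hypothesis v0 : forall i, 0 < v i 0.
Hypothesis h0 : forall i, 0 < h i 0.
Hypothesis Ath : forall i j, rsums (fun k => theta ^+ k * A k i j) (Astar A theta i j).
Hypothesis As : forall i j, rsums (fun k => s ^+ k * A k i j) (Astar A s i j).
Hypothesis Av : Astar A theta *m v = theta *: v.
Hypothesis Ah : forall i, (Astar A s *m h) i 0 <= s * (1 - kappa) * h i 0.

Let s0 : 0 < s. Proof. exact: lt_trans s1. Qed.
Let th0 : 0 < theta. Proof. exact: lt_trans sth. Qed.
Let th1 : 1 < theta. Proof. exact: lt_trans sth. Qed.

Lemma sum_shift_le (g : nat -> R) n a N : (forall k, 0 <= g k) -> (a + N <= n)%N ->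
  \sum_(m < N) g (a + m)%N <= \sum_(k < n | (a <= k)%N) g k.
Proof.
move=> g0 aN; rewrite -(subnKC aN) big_split_ord /= big_split_ord /=.
rewrite [X in _ <= X + _ + _]big_pred0 => [|i]; last by rewrite leqNgt ltn_ord.
rewrite add0r [X in _ <= X + _](eq_bigl xpredT) => [|m]; last by rewrite leq_addr.
by rewrite lerDl sumr_ge0.
Qed.

(** Chosen so that [theta * v <= c * h], which makes [theta^k v - c s^k h] nonpositive at levels 0
    and 1. *)
Let c : R := \sum_i theta * v i 0 / h i 0.

Let ch i : theta * v i 0 <= c * h i 0.
Proof.
rewrite -ler_pdivrMr // /c (bigD1 i) //= lerDl sumr_ge0 // => l _.
by rewrite divr_ge0 ?mulr_ge0 // ltW.
Qed.

Let c0 : 0 < c.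
Proof. by rewrite -(pmulr_lgt0 _ (h0 0)); apply: lt_le_trans (ch 0); rewrite mulr_gt0. Qed.

(* Positive part of a strictly subharmonic function; it vanishes on levels 0 and 1. *)
Definition esc k i : R := Num.max 0 (theta ^+ k * v i 0 - c * s ^+ k * h i 0).

Lemma esc_ge0 k i : 0 <= esc k i.
Proof. by rewrite le_max lexx. Qed.

Lemma esc_low k i : (k <= 1)%N -> esc k i = 0.
Proof.
move=> k1; apply/max_idPl; rewrite subr_le0; case: k k1 => [|[|//]] _.
  rewrite !expr0 mul1r mulr1; apply: le_trans (ch i).
  by rewrite ler_peMl // ltW.
rewrite !expr1; apply: le_trans (ch i) _; rewrite -mulrA mulrCA ler_peMl //.
  by rewrite mulr_ge0 // ltW.
exact: ltW.
Qed.

Lemma esc_le k i : esc k i <= theta ^+ k * v i 0.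
Proof.
rewrite ge_max mulr_ge0 ?exprn_ge0 ?(ltW th0) ?(ltW (v0 _)) //= lerBlDr lerDl.
by rewrite !mulr_ge0 ?exprn_ge0 // ltW.
Qed.

(** Expected value of [esc] after one step from [(i, l)], truncated to [m < N]; the block [A m]
    leads from level [i] to level [i - 1 + m]. *)
Definition esc_step N i l : R := \sum_(m < N) \sum_j A m l j * esc (i.-1 + m)%N j.

(** [c * kappa * s ^+ i * h] is the strict gain and [theta ^+ i.-1 * e] the loss by truncation in
    the harmonic part; truncating the subtracted part only helps. *)
Lemma esc_step_ge N i l e : (0 < i)%N ->
  theta * v l 0 - e <= \sum_(m < N) \sum_j theta ^+ m * A m l j * v j 0 ->
  theta ^+ i * v l 0 - c * s ^+ i * h l 0 + c * kappa * s ^+ i * h l 0 - theta ^+ i.-1 * e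
   <= esc_step N i l.
Proof.
case: i => // i _ he.
have hs : \sum_(m < N) \sum_j s ^+ m * A m l j * h j 0 <= s * (1 - kappa) * h l 0.
  apply: le_trans (Ah l); rewrite mxE exchange_big /=; apply: ler_sum => j _.
  rewrite -mulr_suml ler_wpM2r ?(ltW (h0 _)) //; apply: rsums_partial_le (As l j).
  by move=> k; rewrite mulr_ge0 ?exprn_ge0 // ltW.
apply: le_trans (_ : theta ^+ i * (\sum_(m < N) \sum_j theta ^+ m * A m l j * v j 0) -
   c * s ^+ i * (\sum_(m < N) \sum_j s ^+ m * A m l j * h j 0) <= _).
  have ti : 0 <= theta ^+ i by rewrite exprn_ge0 // ltW.
  have si : 0 <= c * s ^+ i by rewrite mulr_ge0 ?exprn_ge0 // ltW.
  have := ler_wpM2l ti he; have := ler_wpM2l si hs; rewrite !exprS /=; lra.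
rewrite !mulr_sumr -sumrB; apply: ler_sum => m _; rewrite !mulr_sumr -sumrB.
apply: ler_sum => j _ /=.
have -> : theta ^+ i * (theta ^+ m * A m l j * v j 0) - c * s ^+ i * (s ^+ m * A m l j * h j 0)
  = A m l j * (theta ^+ (i + m) * v j 0 - c * s ^+ (i + m) * h j 0).
  by rewrite !exprD; ring.
by rewrite ler_wpM2l // le_max lexx orbT.
Qed.

Lemma esc_step_ge0 N i l : 0 <= esc_step N i l.
Proof. by rewrite sumr_ge0 // => m _; rewrite sumr_ge0 // => j _; rewrite mulr_ge0 // esc_ge0. Qed.

Variable xx : nat -> 'rV[R]_M.+1.
Hypothesis xx0 : xx 0%N = 0.
Hypothesis xx_ge0 : forall k j, 0 <= xx k 0 j.
Hypothesis xx_gt0 : forall k j, (0 < k)%N -> 0 < xx k 0 j.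
Hypothesis xx_super : forall k j, (0 < k)%N ->
  \sum_(i < k.+2) \sum_l xx i 0 l * A (k.+1 - i)%N l j <= xx k 0 j.

Let S n := \sum_(k < n) \sum_j xx k 0 j * esc k j.

Let term_ge0 k j : 0 <= xx k 0 j * esc k j.
Proof. by rewrite mulr_ge0 // esc_ge0. Qed.

(** Stationarity paired with [esc] and summed by source instead of target. Both cut-offs are finite,
    so that no infinite sums are exchanged; [I + N] covers all targets of steps with [m < N] from
    levels below [I]. *)
Lemma esc_flow I N : \sum_(i < I) \sum_l xx i 0 l * esc_step N i l <= S (I + N).
Proof.
pose Psi i k := \sum_l xx i 0 l * \sum_j A (k.+1 - i)%N l j * esc k j.
have Psi0 i k : 0 <= Psi i k.
  apply: sumr_ge0 => l _; rewrite mulr_ge0 // sumr_ge0 // => j _.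
  by rewrite mulr_ge0 // esc_ge0.
set n := (I + N)%N.
apply: le_trans (_ : \sum_(k < n) \sum_(i < k.+2) Psi i k <= _); last first.
  apply: ler_sum => -[[|k] kn] _ /=.
    (* No inequality is assumed at level 0, but [esc] vanishes there. *)
    rewrite [leRHS]big1 => [|j _]; last by rewrite esc_low ?mulr0.
    rewrite big1 // => i _; rewrite /Psi big1 // => l _.
    by rewrite big1 ?mulr0 // => j _; rewrite esc_low ?mulr0.
  apply: le_trans (_ : \sum_j (\sum_(i < k.+3) \sum_l xx i 0 l * A (k.+2 - i)%N l j) * esc k.+1 j <= _).
    rewrite le_eqVlt; apply/orP; left; apply/eqP; rewrite /Psi.
    under [RHS]eq_bigr => j _ do rewrite mulr_suml.
    rewrite [RHS]exchange_big /=; apply: eq_bigr => i _.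
    under [RHS]eq_bigr => j _ do rewrite mulr_suml.
    rewrite [RHS]exchange_big /=; apply: eq_bigr => l _.
    by rewrite mulr_sumr; apply: eq_bigr => j _; rewrite mulrA.
  by apply: ler_sum => j _; rewrite ler_wpM2r ?esc_ge0 // xx_super.
have -> : \sum_(k < n) \sum_(i < k.+2) Psi i k = \sum_(i < n.+1) \sum_(k < n | (i <= k.+1)%N) Psi i k.
  transitivity (\sum_(k < n) \sum_(i < n.+1 | (i < k.+2)%N) Psi i k).
    by apply: eq_bigr => k _; apply: (big_ord_widen n.+1 (fun i => Psi i k)); rewrite ltnS.
  by rewrite (exchange_big_dep xpredT).
have In : (I <= n.+1)%N by rewrite leqW // leq_addr.
apply: le_trans (_ : \sum_(i < I) \sum_(k < n | (i <= k.+1)%N) Psi i k <= _); last first.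
  rewrite (big_ord_widen n.+1 (fun i => \sum_(k < n | (i <= k.+1)%N) Psi i k) In).
  rewrite [leRHS](bigID (fun i : 'I_n.+1 => (i < I)%N)) /= lerDl.
  by apply: sumr_ge0 => i _; apply: sumr_ge0.
apply: ler_sum => -[[|i] iI] _ /=.
  rewrite big1 => [|l _]; first by apply: sumr_ge0.
  by rewrite xx0 mxE mul0r.
apply: le_trans (_ : \sum_(m < N) Psi i.+1 (i + m)%N <= _).
  rewrite /Psi /esc_step /= exchange_big /=; apply: ler_sum => l _.
  rewrite mulr_sumr; apply: ler_sum => m _.
  by rewrite subSS addKn.
apply: (sum_shift_le (fun k => Psi0 i.+1 k)).
by move: iI; rewrite /n; lia.
Qed.

(** Decay faster than [theta^-k] makes the increasing sums [S] bounded, hence Cauchy. One transition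
    step nevertheless adds a fixed gain at the state [(k1, 0)], up to a small truncation error. *)
Lemma escape (K r : R) : theta < r -> (forall k j, xx k 0 j * r ^+ k <= K) -> False.
Proof.
move=> thr hK; have r0 : 0 < r by apply: lt_trans thr.
have K0 : 0 <= K by apply: le_trans (hK 0%N 0); rewrite mulr_ge0 ?exprn_ge0 // ltW.
have q0 : 0 <= theta / r by rewrite divr_ge0 // ltW.
have q1 : theta / r < 1 by rewrite ltr_pdivrMr // mul1r.
have Sb n : S n <= K * (\sum_j v j 0) * (1 - theta / r)^-1.
  apply: le_trans (_ : \sum_(k < n) K * (\sum_j v j 0) * (theta / r) ^+ k <= _).
    apply: ler_sum => k _; rewrite mulr_sumr mulr_suml; apply: ler_sum => j _.
    apply: le_trans (_ : xx k 0 j * (theta ^+ k * v j 0) <= _); first by rewrite ler_wpM2l ?esc_le.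
    have rk : 0 < r ^+ k by rewrite exprn_gt0.
    have -> : K * v j 0 * (theta / r) ^+ k = K / r ^+ k * (theta ^+ k * v j 0).
      by rewrite expr_div_n; field; rewrite gt_eqF.
    rewrite ler_wpM2r ?ler_pdivlMr // mulr_ge0 ?exprn_ge0 ?(ltW th0) //.
    exact: ltW.
  rewrite -mulr_sumr ler_wpM2l ?geo_sum_le // mulr_ge0 // sumr_ge0 // => j _.
  exact: ltW.
have S1 n : S n <= S n.+1 by rewrite /S big_ord_recr lerDl; apply: sumr_ge0.
(* At level [k1] the second branch of the maximum is active, so the strict gain is not lost. *)
have [k1 k10 hk1] : exists2 k1, (0 < k1)%N & c * s ^+ k1 * h 0 0 <= theta ^+ k1 * v 0 0.
  have p0 : 0 <= s / theta by rewrite divr_ge0 // ltW.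
  have p1 : s / theta < 1 by rewrite ltr_pdivrMr // mul1r.
  have [|N hN] := expr_small p0 p1 (e := v 0 0 / (c * h 0 0)).
    by rewrite divr_gt0 ?mulr_gt0.
  exists N.+1 => //; have := hN _ (leqnSn N).
  rewrite expr_div_n ler_pdivrMr ?exprn_gt0 // mulrAC ler_pdivlMr ?mulr_gt0 //.
  by rewrite mulrA [_ * c]mulrC [v 0 0 * _]mulrC.
pose gain := c * kappa * s ^+ k1 * h 0 0.
have gain0 : 0 < gain by rewrite !mulr_gt0 // exprn_gt0.
(* A quarter of the gain: one share for the tail of [S], one for the truncation losses, the rest as
   margin. *)
pose e1 := xx k1 0 0 * gain / 4.
have e10 : 0 < e1 by rewrite divr_gt0 // mulr_gt0 // xx_gt0.
have [I0 hI0] := mono_cauchy S1 Sb e10.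
pose I := maxn I0 k1.+1.
have Ik1 : (k1 < I)%N by rewrite leq_maxr.
pose T := \sum_(i < I) \sum_l xx i 0 l * theta ^+ i.
have T0 : 0 <= T.
  by do 2 (apply: sumr_ge0 => ? _); rewrite mulr_ge0 // exprn_ge0 // ltW.
(* Summed over all states below level [I], the truncation losses amount to at most [e * T <= e1]. *)
pose e := e1 / (T + 1).
have T1 : 0 < T + 1 by rewrite ltr_wpDl.
have ep : 0 < e by rewrite divr_gt0.
have eT : e * T <= e1.
  by rewrite /e mulrAC ler_pdivrMr // ler_wpM2l ?(ltW e10) // lerDl.
have [N hN] : exists N, forall l,
    theta * v l 0 - e <= \sum_(m < N) \sum_j theta ^+ m * A m l j * v j 0.
  have H l : exists N, forall n, (N <= n)%N ->
      theta * v l 0 - e <= \sum_(m < n) \sum_j theta ^+ m * A m l j * v j 0.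
    have hs : rsums (fun m => \sum_j theta ^+ m * A m l j * v j 0) (theta * v l 0).
      have <- : \sum_j v j 0 * Astar A theta l j = theta * v l 0.
        have := congr1 (fun u : 'cV_M.+1 => u l 0) Av; rewrite !mxE => <-.
        by apply: eq_bigr => j _; rewrite mulrC.
      apply: rsums_ext (rsums_sum (fun j => rsumsZ (v j 0) (Ath l j))) => m.
      by apply: eq_bigr => j _; rewrite mulrC.
    have [N hN] := hs _ ep; exists N => n /hN; rewrite ler_norml => /andP[]; lra.
  have [f hf] := boolp.choice H; exists (\max_l f l)%N => l.
  by apply: hf; exact: leq_bigmax.
have main : S I + xx k1 0 0 * gain - e * T <= S (I + N).
  apply: le_trans (esc_flow I N).
  have -> : xx k1 0 0 * gain = \sum_(i < I) \sum_l xx i 0 l *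
      (if (i == k1 :> nat) && (l == 0) then gain else 0).
    rewrite (bigD1 (Ordinal Ik1)) //= (bigD1 0) //= !eqxx big1 => [|l /negbTE ->]; last first.
      by rewrite mulr0.
    rewrite addr0 big1 ?addr0 // => i; rewrite -val_eqE /= => /negbTE ->.
    by rewrite big1 // => l _; rewrite mulr0.
  rewrite /S /T mulr_sumr -big_split -sumrB /=; apply: ler_sum => i _.
  rewrite mulr_sumr -big_split -sumrB /=; apply: ler_sum => l _.
  rewrite mulrCA -mulrDr -mulrBr.
  have [i0|i0] := posnP i; first by rewrite i0 xx0 mxE !mul0r.
  rewrite ler_wpM2l //.
  have ti : theta ^+ i.-1 * e <= e * theta ^+ i.
    rewrite mulrC ler_wpM2l ?(ltW ep) // -[in leRHS](prednK i0) exprS ler_peMl ?exprn_ge0 ?ltW //.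
  have P1 := esc_step_ge i0 (hN l).
  have P0 := esc_step_ge0 N i l.
  have k0 : 0 <= c * kappa * s ^+ i * h l 0 by rewrite !mulr_ge0 ?exprn_ge0 // ltW.
  have te0 : 0 <= e * theta ^+ i by rewrite mulr_ge0 ?exprn_ge0 // ltW.
  rewrite /esc; case: ifPn => [/andP[/eqP ik /eqP l0]|_].
    rewrite {}ik {}l0 in P1 ti k0 te0 P0 *.
    rewrite max_r ?subr_ge0 // /gain; lra.
  rewrite addr0; move: P1 P0 ti te0 k0; set P := esc_step _ _ _; set X := _ - c * _ * _.
  by rewrite /Num.max; case: ifP => _; lra.
have := hI0 I (I + N)%N (leq_maxl _ _).
by move: main eT e10; rewrite /e1; lra.
Qed.

End Escape.

(** * Residues *)

Section Residue.
Variable R : realType.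
Local Notation C := R[i].
Local Notation toC := (real_complex R).
Variables (M : nat) (A : nat -> 'M[R]_M.+1) (r1 theta : R).
Hypothesis A0 : forall k i j, 0 <= A k i j.
Hypothesis Al1 : forall i j, l1 (fun k => toC (A k i j)) r1.
Hypothesis th1 : 1 < theta.
Hypothesis thr1 : theta < r1.
Hypothesis Airr : mx_irreducible (Astar A 1).
Variables (mu : 'rV[R]_M.+1) (v : 'cV[R]_M.+1).
Hypothesis mu0 : forall j, 0 < mu 0 j.
Hypothesis v0 : forall j, 0 < v j 0.
Hypothesis muA : mu *m Astar A theta = theta *: mu.
Hypothesis Av : Astar A theta *m v = theta *: v.
Hypothesis muv : (mu *m v) 0 0 = 1.
Hypothesis stoch : forall i, \sum_j Astar A 1 i j = 1.
Variable tau : nat.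
Hypothesis htau : MAP_period A tau.
Hypothesis tau0 : (0 < tau)%N.
Variable p : 'I_M.+1 -> nat.
Hypothesis hp : period_fun A tau p.
Variable w : C.
Hypothesis wprim : tau.-primitive_root w.
Hypothesis wnorm : nc w = 1.

Let th0 : 0 < theta. Proof. exact: lt_trans th1. Qed.
Let r10 : 0 < r1. Proof. exact: lt_trans thr1. Qed.
Let node := node theta w.
Let nodeE nu : node nu = toC theta * w ^+ nu.
Proof. by []. Qed.
Let node_norm nu : nc (node nu) = theta.
Proof. exact: node_norm. Qed.
Let wX0 nu n : (w ^+ nu) ^+ n != 0.
Proof. by rewrite !expf_neq0 // (w_neq0 wnorm). Qed.

(** Exponentiated form of the congruence that defines [p]. *)
Lemma period_expr k i j nu : 0 < A k i j ->
  (w ^+ nu) ^+ k * (w ^+ nu) ^+ p i = w ^+ nu * (w ^+ nu) ^+ p j.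
Proof.
move=> Aij; have [_ /(_ _ _ _ Aij) h] := hp.
rewrite -exprD -exprS -!exprM ![(nu * _)%N]mulnC !exprM; congr (_ ^+ nu).
apply/eqP; rewrite (eq_prim_root_expr wprim) -eqz_nat -!modz_nat.
have -> : (k + p i)%N%:Z = (k%:Z - 1) + (1 + (p i)%:Z) by lia.
have -> : (p j).+1%:Z = ((p j)%:Z - (p i)%:Z) + (1 + (p i)%:Z) by lia.
by rewrite eqz_modDr; apply/eqP.
Qed.

(** Conjugation by [DeltaM]: A^*(theta w^nu) is [w ^+ nu] times a matrix diagonally similar to
    A^*(theta). *)
Lemma Az_twist nu i j : Az A (node nu) i j * (w ^+ nu) ^+ p i =
  w ^+ nu * (w ^+ nu) ^+ p j * toC (Astar A theta i j).
Proof.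
have zr : nc (node nu) <= r1 by rewrite node_norm ltW.
have h1 := csumsZ ((w ^+ nu) ^+ p i) (ps_csums (Al1 i j) zr).
have h2 := csumsZ (w ^+ nu * (w ^+ nu) ^+ p j)
  ((csums_toC _ _).1 (Astar_rsums Al1 i j (ltW th0) (ltW thr1))).
rewrite mxE mulrC; apply: (csums_uniq (csums_ext _ h1) h2) => k /=.
rewrite rmorphM rmorphXn exprMn; have := A0 k i j; rewrite le_eqVlt => /orP[/eqP <-|Aij].
  by rewrite !mul0r !mulr0.
by rewrite -(period_expr nu Aij); ring.
Qed.

(** As [Az_twist], but differentiation removes one factor [w ^+ nu]. *)
Lemma dAz_twist nu i j (L : C) :
  csums (fun k => k%:R * toC (A k i j) * node nu ^+ k.-1) L ->
  L * (w ^+ nu) ^+ p i = (w ^+ nu) ^+ p j * toC (dAstar A theta i j).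
Proof.
move=> h; have h1 := csumsZ ((w ^+ nu) ^+ p i) h.
have h2 := csumsZ ((w ^+ nu) ^+ p j)
  ((csums_toC _ _).1 (dAstar_rsums Al1 th1 thr1 i j)).
rewrite mulrC; apply: (csums_uniq (csums_ext _ h1) h2) => -[|k] /=.
  by rewrite !mul0r rmorph0 !mulr0.
have t0 : toC 0 = 0 by [].
have := A0 k.+1 i j; rewrite le_eqVlt => /orP[/eqP <-|Aij].
  by rewrite !(t0, mulr0, mul0r).
rewrite !rmorphM rmorphXn rmorph_nat exprMn.
have E : (w ^+ nu) ^+ k * (w ^+ nu) ^+ p i = (w ^+ nu) ^+ p j.
  have wn0 : w ^+ nu != 0 by rewrite -[w ^+ nu]expr1; exact: wX0.
  by apply: (mulfI wn0); rewrite -(period_expr nu Aij) [in RHS]exprS; ring.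
by rewrite -E; ring.
Qed.

Variables (X : 'I_M.+1 -> C -> C) (f : C -> 'rV[C]_M.+1).
Hypothesis X_an : forall j, an 1 (X j).
Hypothesis f_an : forall j, an r1 (fun z => f z 0 j).
Hypothesis XK : forall j z, nc z <= 1 ->
  z * X j z - \sum_i X i z * Az A z i j = z * f z 0 j.

(** The numerator of the summand [nu] in [c_const], with [f] in place of x(0) B^*(z) - x(1) A(0). *)
Definition flux (nu : nat) : C :=
  \sum_j f (node nu) 0 j * ((w ^+ nu) ^- p j * toC (v j 0)).

(* Each value of [F] at a node is a left null vector of [z - Az z], hence a multiple of the twisted
   [mu]; differentiating the kernel equation there and pairing with the twisted [v] gives [c].
   The factor [0 ^+ m] makes [c] vanish for poles of higher order. *)
Lemma residue_at m r (F : 'I_M.+1 -> C -> C) (nu : nat) : theta < r -> r < r1 ->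
  (forall j, an r (F j)) ->
  (forall j z, nc z <= 1 -> X j z * polar theta tau z ^+ m.+1 = F j z) ->
  exists c : C, (forall j, F j (node nu) = c * (toC (mu 0 j) * (w ^+ nu) ^+ p j)) /\
    c * (1 - toC (drift A theta mu v)) = tau%:R * toC theta ^+ tau * 0 ^+ m * flux nu.
Proof.
move=> thr rr1 aF FE; set z0 := node nu; set u := w ^+ nu.
have u0 : u != 0 by rewrite -[u]expr1; exact: wX0.
have uX n : u ^+ n != 0 by exact: wX0.
have r_1 : 1 < r by apply: lt_trans thr.
have r0 : 0 < r by apply: lt_trans thr.
have Azan i j : an r (fun z => Az A z i j).
  by apply: an_le (ltW rr1) _; exact: (Az_an Al1 th1 thr1).
have fan j : an r (fun z => f z 0 j) by apply: an_le (ltW rr1) _; exact: f_an.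
have pan n : an r (fun z => polar theta tau z ^+ n) by apply: an_exp; exact: polar_an.
(* The kernel equation multiplied by [polar ^+ m.+1]; it holds on the unit disc and extends to |z| <
   r by the identity theorem. *)
pose H j z := z * F j z - \sum_i F i z * Az A z i j - z * (polar theta tau z ^+ m.+1 * f z 0 j).
have FK j z : nc z < r -> H j z = 0.
  apply: (an_identity ltr01 r_1).
    apply: an_sub; last by apply: an_mul (an_id _) _; apply: an_mul.
    apply: an_sub; first by apply: an_mul (an_id _) _.
    by apply: an_sum => i _; apply: an_mul.
  move=> {}z z1; rewrite /H -FE //.
  have -> : \sum_i F i z * Az A z i j =
    polar theta tau z ^+ m.+1 * \sum_i X i z * Az A z i j.
    rewrite mulr_sumr; apply: eq_bigr => i _; rewrite -FE //; ring.
  move: (XK j z1); set s := \sum_i _ => E.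
  have -> : s = z * X j z - z * f z 0 j by rewrite -E; ring.
  by ring.
have z0r : nc z0 < r by rewrite node_norm.
have z0t : z0 ^+ tau = toC theta ^+ tau by exact: node_exp.
have pz0 : polar theta tau z0 = 0 by rewrite /polar z0t subrr.
have FA j : \sum_i F i z0 * Az A z0 i j = z0 * F j z0.
  have := FK j z0 z0r; rewrite /H pz0 exprS !mul0r mulr0 subr0 => /eqP.
  by rewrite subr_eq0 => /eqP.
(* Removing the phases turns a left eigenvector of [Az A z0] into one of the real matrix
   [Astar A theta], where [left_kernel] applies. *)
pose w' : 'rV[C]_M.+1 := \row_i (F i z0 * u ^- p i).
have w'A : w' *m cmx (Astar A theta) = toC theta *: w'.
  apply/rowP => j; rewrite mxE [RHS]mxE [w' 0 j]mxE.
  have upj : u * u ^+ p j != 0 by rewrite mulf_neq0.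
  apply: (mulfI upj); rewrite mulr_sumr.
  transitivity (\sum_i F i z0 * Az A z0 i j).
    apply: eq_bigr => i _; rewrite mxE [cmx _ _ _]mxE.
    apply: (mulIf (uX (p i))).
    rewrite -[in RHS]mulrA (Az_twist nu i j) -/u.
    by field; exact: uX.
  rewrite FA /z0 nodeE -/u; field; exact: uX.
have thr1' := ltW thr1.
have [c hc] := left_kernel (Astar_nonneg A0 Al1 (ltW th0) thr1')
  (Astar_irr A0 Al1 th1 thr1 Airr th0 thr1') mu0 muA w'A.
have Fc j : F j z0 = c * (toC (mu 0 j) * u ^+ p j).
  have := congr1 (fun x : 'rV[C]_M.+1 => x 0 j) hc; rewrite !mxE => E.
  by apply: (mulIf (invr_neq0 (uX (p j)))); rewrite E; field; exact: uX.
exists c; split=> //.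
pose dv j := u ^- p j * toC (v j 0).
have Adv i : \sum_j Az A z0 i j * dv j = z0 * dv i.
  apply: (mulfI (uX (p i))); rewrite mulr_sumr.
  transitivity (\sum_j u * toC (Astar A theta i j * v j 0)).
    apply: eq_bigr => j _; rewrite mulrA [u ^+ p i * _]mulrC (Az_twist nu i j) -/u /dv.
    by rewrite rmorphM; field; exact: uX.
  rewrite -mulr_sumr -rmorph_sum.
  have -> : \sum_j Astar A theta i j * v j 0 = theta * v i 0.
    by have := congr1 (fun x : 'cV_M.+1 => x i 0) Av; rewrite !mxE.
  by rewrite rmorphM /dv /z0 nodeE -/u; field; exact: uX.
have z0r1 : nc z0 < r1 by rewrite node_norm.
have [G hG] := boolp.choice (fun ij : 'I_M.+1 * 'I_M.+1 => Az_diff Al1 th1 thr1 ij.1 ij.2 z0r1).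
(* Paired with [dv], both sides of the kernel equation acquire the factor [z - z0]; [P] and [Q] are
   the two quotients. *)
pose P z := \sum_i F i z * (dv i - \sum_j G (i, j) z * dv j).
pose Q z := z * polar_quot tau z0 z * polar theta tau z ^+ m * \sum_j f z 0 j * dv j.
(* The extended equation is available for |z| < r only, whence a slightly smaller closed disc. *)
pose r2 := (theta + r) / 2.
have r2r : r2 < r by rewrite /r2; lra.
have thr2 : theta < r2 by rewrite /r2; lra.
have r20 : 0 < r2 by apply: lt_trans thr2.
have PQ : P z0 = Q z0.
  apply: (@an_eq_at _ r2) => //.
  - apply: an_le (ltW r2r) _; apply: an_sum => i _; apply: an_mul => //.
    apply: an_sub; first exact: an_cst.
    apply: an_sum => j _; apply: an_mul; last exact: an_cst.
    by apply: an_le (ltW rr1) _; case: (hG (i, j)).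
  - apply: an_le (ltW r2r) _; apply: an_mul; last first.
      by apply: an_sum => j _; apply: an_mul => //; exact: an_cst.
    apply: an_mul => //; apply: an_mul; first exact: an_id.
    exact: polar_quot_an.
  - by rewrite node_norm ltW.
  move=> z zr2 zz0; have zr : nc z < r by apply: le_lt_trans r2r.
  have zz0' : z - z0 != 0 by rewrite subr_eq0.
  apply: (mulfI zz0').
  have Azz i : \sum_j Az A z i j * dv j = z0 * dv i + (z - z0) * \sum_j G (i, j) z * dv j.
    rewrite -Adv mulr_sumr -big_split; apply: eq_bigr => j _ /=.
    have [_ /(_ z) GE _] := hG (i, j); rewrite GE /=; first by ring.
    exact/ltW/(lt_trans zr).
  have E1 : \sum_j (z * F j z - \sum_i F i z * Az A z i j) * dv j = (z - z0) * P z.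
    under eq_bigr => j _ do rewrite mulrBl mulr_suml.
    rewrite sumrB exchange_big /= /P mulr_sumr -sumrB; apply: eq_bigr => i _.
    under eq_bigr => j _ do rewrite -mulrA.
    by rewrite -mulr_sumr Azz; ring.
  rewrite -E1 /Q mulr_sumr mulr_sumr; apply: eq_bigr => j _.
  have := FK j z zr; rewrite /H => /eqP; rewrite subr_eq0 => /eqP ->.
  by rewrite exprS (polar_quotE tau0 z z0t); ring.
have -> : tau%:R * toC theta ^+ tau * 0 ^+ m * flux nu = Q z0.
  rewrite /Q pz0 (polar_quot_diag tau0 z0t); congr (_ * _).
rewrite -PQ /P.
under eq_bigr => i _.
  rewrite Fc mulrBr.
  have -> : c * (toC (mu 0 i) * u ^+ p i) * dv i = c * toC (mu 0 i * v i 0).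
    by rewrite /dv rmorphM; field; exact: uX.
  have -> : c * (toC (mu 0 i) * u ^+ p i) * (\sum_j G (i, j) z0 * dv j) =
     c * toC (\sum_j mu 0 i * dAstar A theta i j * v j 0).
    rewrite rmorph_sum !mulr_sumr; apply: eq_bigr => j _.
    have [_ _ /dAz_twist /= E] := hG (i, j).
    transitivity (c * toC (mu 0 i) * (G (i, j) z0 * u ^+ p i) * dv j); first by ring.
    by rewrite E /dv !rmorphM -/u; field; exact: uX.
  over.
rewrite sumrB -!mulr_sumr -!rmorph_sum -driftE.
have -> : \sum_i mu 0 i * v i 0 = 1 by rewrite -muv mxE.
by rewrite rmorph1; ring.
Qed.

(** For an exponent of at least 2 the factor [0 ^+ m] in [residue_at] vanishes, and [drift != 1]
    forces [c = 0]: the numerators vanish at all nodes and one factor [polar] cancels. *)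
Lemma simple_poles m r (F : 'I_M.+1 -> C -> C) : theta < r -> r < r1 ->
  (forall j, an r (F j)) ->
  (forall j z, nc z <= 1 -> X j z * polar theta tau z ^+ m = F j z) ->
  exists F' : 'I_M.+1 -> C -> C, (forall j, an r (F' j)) /\
    forall j z, nc z <= 1 -> X j z * polar theta tau z = F' j z.
Proof.
move=> thr rr1; elim: m F => [|[|m] IH] F aF FE.
- exists (fun j z => F j z * polar theta tau z); split=> [j|j z z1].
    by apply: an_mul => //; exact: polar_an.
  by rewrite -FE // expr0 mulr1.
- by exists F; split=> // j z z1; rewrite -FE // expr1.
have F0 j (i : 'I_tau) : F j (node i) = 0.
  have [c [-> hc]] := residue_at i thr rr1 aF FE.
  move/eqP: hc; rewrite exprS mul0r mulr0 mul0r mulf_eq0 => /orP[/eqP ->|]; first by rewrite mul0r.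
  rewrite -(rmorph1 toC) -rmorphB -nc_eq0 nc_toC normr_eq0 subr_eq0 => /eqP e.
  have := drift_gt1 A0 Al1 th1 thr1 mu0 v0 muA Av muv stoch htau tau0.
  by rewrite -e ltxx.
have [F' [aF' FE']] := reduce_order th1 tau0 wprim wnorm thr aF FE F0.
exact: IH aF' FE'.
Qed.

(** Normalized so that x(k)_j behaves like the sum over [nu] of [res nu j * node nu ^- k]; the phase
    is that of the inverse of [DeltaM]. *)
Definition res (nu : nat) (j : 'I_M.+1) : C :=
  flux nu / toC (drift A theta mu v - 1) * (toC (mu 0 j) * (w ^+ nu) ^+ p j).

Lemma expansion (a : 'I_M.+1 -> nat -> C) : (forall j, l1 (a j) 1) ->
  (forall j z, nc z <= 1 -> X j z = ps (a j) z) ->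
  exists2 r, theta < r & forall j, exists S, forall k,
    nc (a j k - \sum_(nu < tau) res nu j * node nu ^- k) * r ^+ k <= S.
Proof.
move=> la Xa; pose K z := z%:M - Az A z.
have Kan i j : an r1 (fun z => K z i j).
  apply: an_ext (an_sub (an_mul (an_id r1) (an_cst r1 ((i == j)%:R))) (Az_an Al1 th1 thr1 i j)).
  by move=> z _; rewrite !mxE mulr_natr.
pose D z := \det (K z).
pose N j z := \sum_i z * f z 0 i * \adj (K z) i j.
(* A test point strictly inside the annulus, where the determinant does not vanish. *)
pose s := (1 + theta) / 2.
have s1 : 1 < s by move: th1; rewrite /s; lra.
have sth : s < theta by move: th1; rewrite /s; lra.
have s0 : 0 < s by apply: lt_trans s1.
have ncs : nc (toC s) = s by rewrite nc_toC gtr0_norm.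
have [||||||m [r [F [thr rr1 aF FE]]]] :=
  @continuation R 'I_M.+1 X theta tau X_an th1 tau0 r1 D N (toC s) thr1.
- exact: an_det.
- move=> j; apply: an_sum => i _; apply: an_mul; last exact: an_adj.
  by apply: an_mul (an_id _) _.
- by rewrite ncs (lt_trans sth).
- apply/eqP => D0; have [||e _] := det_Az_annulus A0 Al1 th1 thr1 Airr v0 Av stoch htau tau0 _ _ D0.
  + by rewrite ncs.
  + by rewrite ncs ltW.
  by move: sth; rewrite -[s]ncs e ltxx.
- by move=> z z1 zth /(det_Az_annulus A0 Al1 th1 thr1 Airr v0 Av stoch htau tau0 z1 zth)[].
- move=> j z z1; rewrite /N.
  pose Xr : 'rV[C]_M.+1 := \row_i X i z.
  have XrK : Xr *m K z = z *: f z.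
    apply/rowP => i; rewrite [RHS]mxE -XK // mulmxBr mul_mx_scalar.
    have E (Y Z : 'rV[C]_M.+1) : (z *: Y - Z) 0 i = z * Y 0 i - Z 0 i by rewrite !mxE.
    rewrite E [Xr 0 i]mxE; congr (_ - _); rewrite mxE; apply: eq_bigr => l _.
    by congr (_ * _); rewrite mxE.
  have := congr1 (fun Y : 'rV[C]_M.+1 => (Y *m \adj (K z)) 0 j) XrK.
  rewrite -mulmxA mul_mx_adj mul_mx_scalar -/(D z) => E.
  transitivity ((D z *: Xr) 0 j); first by rewrite [RHS]mxE [Xr 0 j]mxE mulrC.
  by rewrite E mxE; apply: eq_bigr => i _; congr (_ * _); rewrite mxE.
have [F' [aF' FE']] := simple_poles thr rr1 aF FE.
exists r => //; apply: (mittag_leffler th1 tau0 wprim wnorm thr la Xa aF' FE').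
move=> j nu; have FE1 : forall j z, nc z <= 1 -> X j z * polar theta tau z ^+ 1 = F' j z.
  by move=> j' z z1; rewrite expr1 FE'.
have [c [-> hc]] := residue_at nu thr rr1 aF' FE1.
have d1 := drift_gt1 A0 Al1 th1 thr1 mu0 v0 muA Av muv stoch htau tau0.
have dC : toC (drift A theta mu v - 1) != 0.
  by rewrite -nc_eq0 nc_toC normr_eq0 gt_eqF // subr_gt0.
rewrite /res; have -> : c = - (tau%:R * toC theta ^+ tau * (flux nu / toC (drift A theta mu v - 1))).
  apply: (mulIf dC); move: hc; rewrite expr0 mulr1 rmorphB rmorph1 => hc.
  rewrite rmorphB rmorph1 in dC.
  transitivity (- (c * (1 - toC (drift A theta mu v)))); first by ring.
  by rewrite hc; field; exact: dC.
by ring.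
Qed.

End Residue.

(** * The M/G/1-type chain *)

Section Main.
Variable R : realType.
Local Notation C := R[i].
Local Notation toC := (real_complex R).
Variables (M0 M : nat).
Variables (A : nat -> 'M[R]_M.+1) (B0 : 'M[R]_M0) (B : nat -> 'M[R]_(M0, M.+1)) (C0 : 'M[R]_(M.+1, M0)).
Hypotheses (hA0 : forall k i j, 0 <= A k i j) (hB00 : forall i j, 0 <= B0 i j)
  (hB0 : forall k i j, 0 <= B k i j) (hC00 : forall i j, 0 <= C0 i j).
Variables (x0 : 'rV[R]_M0) (xl : nat -> 'rV[R]_M.+1).
Hypotheses (hx00 : forall j, 0 <= x0 0 j) (hxl0 : forall k j, (1 <= k)%N -> 0 <= xl k 0 j).
Hypothesis hxlev0 : x0 = x0 *m B0 + xl 1%N *m C0.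
Hypothesis hxlev : forall k, (1 <= k)%N ->
  xl k = x0 *m B k + \sum_(1 <= i < k.+2) xl i *m A (k.+1 - i)%N.
Hypothesis hxcvg : forall j, rsum_cvg (fun k => xl k.+1 0 j).
Hypothesis hxnorm : \sum_j x0 0 j + \sum_j rsum (fun k => xl k.+1 0 j) = 1.

(** Level 0, whose vector has another dimension, is replaced by zero so that the convolution with
    [A] can start at index 0. *)
Definition levels (k : nat) : 'rV[R]_M.+1 := if k == 0%N then 0 else xl k.

Lemma levels_ge0 k j : 0 <= levels k 0 j.
Proof. by case: k => [|k]; rewrite /levels /= ?mxE // hxl0. Qed.

(** For [n = 0] this is not an equation of the chain: the convolution produces x(1) A(0), the term
    that enters the kernel equation. *)
Lemma levels_rec n j : \sum_(m < n.+2) \sum_l levels m 0 l * A (n.+1 - m)%N l j =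
  (if n == 0%N then (xl 1%N *m A 0%N) 0 j else 0) + levels n 0 j - (x0 *m Bext B n) 0 j.
Proof.
transitivity (\sum_(1 <= m < n.+2) (xl m *m A (n.+1 - m)%N) 0 j).
  rewrite -(big_mkord xpredT (fun m => \sum_l levels m 0 l * A (n.+1 - m)%N l j)).
  rewrite big_ltn // big1 => [|l _]; last by rewrite mxE mul0r.
  rewrite add0r big_nat [RHS]big_nat; apply: eq_bigr => -[//|m] _.
  by rewrite [RHS]mxE.
case: n => [|n] /=.
  by rewrite big_nat1 subnn /levels /Bext /= mulmx0 !mxE addr0 subr0.
have := hxlev (ltn0Sn n) => /(congr1 (fun u : 'rV_M.+1 => u 0 j)).
rewrite /levels /Bext /= => ->; rewrite add0r [X in _ = X - _]mxE addrAC subrr add0r.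
by rewrite summxE.
Qed.

Lemma levels_super k j : (0 < k)%N ->
  \sum_(i < k.+2) \sum_l levels i 0 l * A (k.+1 - i)%N l j <= levels k 0 j.
Proof.
case: k => // k _; rewrite levels_rec /= add0r gerBl mxE sumr_ge0 // => i _.
by rewrite mulr_ge0 // /Bext /= hB0.
Qed.

Lemma level_sums j : rsums (fun k => levels k 0 j) (rsum (fun k => xl k.+1 0 j)).
Proof.
have /csums_toC h := rsumsP (@hxcvg j); apply/csums_toC/csums_shift => /=.
by rewrite [levels 0 0 j]mxE subr0.
Qed.

Hypothesis hTirr : T_irreducible A B0 B C0.

(** Positivity propagates along the transitions, some state is charged because the total mass is 1,
    and [T] is irreducible. *)
Lemma levels_gt0 k j : (0 < k)%N -> 0 < levels k 0 j.
Proof.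
move=> k0; pose xs (s : state M0 M.+1) : R :=
  match s with inl i => x0 0 i | inr (k, j) => levels k 0 j end.
have xs0 s : 0 <= xs s by case: s => [i|[l i]] /=; [exact: hx00 | exact: levels_ge0].
have le_mul (m : nat) (u : 'rV[R]_m) n (Y : 'M[R]_(m, n)) i j' : (forall i, 0 <= u 0 i) ->
    (forall i j, 0 <= Y i j) -> u 0 i * Y i j' <= (u *m Y) 0 j'.
  move=> u0 Y0; rewrite mxE (bigD1 i) //= lerDl sumr_ge0 // => l _.
  by rewrite mulr_ge0.
have x1 i : 0 <= xl 1%N 0 i by exact: hxl0.
have step s t : Tedge A B0 B C0 s t -> 0 < xs s -> 0 < xs t.
  case: s t => [i|[l i]] [i'|[l' i']] /=.
  - move=> b xi; rewrite hxlev0 mxE; apply: ltr_pwDl.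
      by apply: lt_le_trans (le_mul _ _ _ _ i _ hx00 hB00); rewrite mulr_gt0.
    by rewrite mxE sumr_ge0 // => a _; rewrite mulr_ge0.
  - case: l' => [|l'] [// _ b] xi; rewrite /levels /= hxlev // mxE; apply: ltr_pwDl.
      by apply: lt_le_trans (le_mul _ _ _ _ i _ hx00 (hB0 _)); rewrite mulr_gt0.
    rewrite summxE big_nat sumr_ge0 // => a /andP[a0 _].
    by rewrite mxE sumr_ge0 // => b' _; rewrite mulr_ge0 ?hxl0.
  - move=> [-> b] xi; rewrite hxlev0 mxE; apply: ltr_wpDl.
      by rewrite mxE sumr_ge0 // => a _; rewrite mulr_ge0.
    by apply: lt_le_trans (le_mul _ _ _ _ i _ x1 hC00); rewrite mulr_gt0.
  - case=> l0 l'0 ll' b xi; apply: lt_le_trans (levels_super i' l'0).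
    have lt : (l < l'.+2)%N by rewrite ltnS.
    rewrite (bigD1 (Ordinal lt)) //= ltr_wpDr //.
      apply: sumr_ge0 => a _; apply: sumr_ge0 => c _.
      by rewrite mulr_ge0 // levels_ge0.
    rewrite (bigD1 i) //= ltr_wpDr ?mulr_gt0 //.
    by apply: sumr_ge0 => a _; rewrite mulr_ge0 // levels_ge0.
have reach s t : clos_refl_trans _ (Tedge A B0 B C0) s t -> 0 < xs s -> 0 < xs t.
  elim=> [a b|a|a b c _ h1 _ h2] //; first exact: step.
  by move=> /h1/h2.
have [s vs sp] : exists2 s, valid_state s & 0 < xs s.
  apply: contrapT => no.
  have z s : valid_state s -> xs s = 0.
    move=> vs; apply/eqP; rewrite eq_le xs0 andbT leNgt; apply/negP => sp.
    by apply: no; exists s.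
  move: hxnorm; rewrite !big1 => [|i _|i _].
  - by move/eqP; rewrite addr0 eq_sym oner_eq0.
  - apply: rsums_rsum => e e0; exists 0%N => n _.
    rewrite big1 ?subrr ?normr0 ?ltW // => l _.
    by have := z (inr (l.+1, i)); rewrite /= /levels /=; apply.
  - by have := z (inl i); apply.
by apply: (reach s (inr (k, j))) => //; apply: hTirr.
Qed.

Definition lev_coef (j : 'I_M.+1) (k : nat) : C := toC (levels k 0 j).

Lemma lev_coef_l1 j : l1 (lev_coef j) 1.
Proof.
exists (rsum (fun k => xl k.+1 0 j)) => n.
apply: le_trans (rsums_partial_le n (fun k => levels_ge0 k j) (level_sums j)).
apply: ler_sum => k _; rewrite expr1n mulr1 nc_toC ger0_norm //; exact: levels_ge0.
Qed.

Definition flux_row (z : C) : 'rV[C]_M.+1 :=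
  cmx x0 *m Bstar B z - cmx (xl 1%N) *m cmx (A 0%N).

Lemma BstarE z i j : Bstar B z i j = ps (fun k => toC (Bext B k i j)) z.
Proof.
rewrite mxE /ps; congr csum; apply: funext => k; rewrite /Bext.
by case: eqVneq => [->|_]; [rewrite mxE mul0r | rewrite mulrC].
Qed.

Lemma flux_rowE z j : flux_row z 0 j =
  \sum_i toC (x0 0 i) * ps (fun k => toC (Bext B k i j)) z - toC ((xl 1%N *m A 0%N) 0 j).
Proof.
rewrite /flux_row -cmxM; have E (Y Z : 'rV[C]_M.+1) : (Y - Z) 0 j = Y 0 j - Z 0 j by rewrite !mxE.
rewrite E; congr (_ - _); last by rewrite [LHS]mxE.
by rewrite mxE; apply: eq_bigr => i _; rewrite BstarE mxE.
Qed.

Variables (r1 theta : R).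
Hypothesis Al1 : forall i j, l1 (fun k => toC (A k i j)) r1.
Hypothesis Bl1 : forall i j, l1 (fun k => toC (Bext B k i j)) r1.
Hypothesis th1 : 1 < theta.
Hypothesis thr1 : theta < r1.

Let one_r1 : 1 <= r1. Proof. by apply/ltW; exact: lt_trans thr1. Qed.
Let r10 : 0 < r1. Proof. exact: lt_le_trans one_r1. Qed.
Let th0 : 0 < theta. Proof. exact: lt_trans th1. Qed.

Lemma flux_row_an j : an r1 (fun z => flux_row z 0 j).
Proof.
apply: an_ext (fun z _ => esym (flux_rowE z j)) _; apply: an_sub; last exact: an_cst.
by apply: an_sum => i _; apply: an_scale; apply: ps_an (ltW r10) _.
Qed.

(** Generating function of [levels_rec], through the Cauchy product of the levels with [A]. *)
Lemma level_identity j z : nc z <= 1 ->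
  z * ps (lev_coef j) z - \sum_i ps (lev_coef i) z * Az A z i j = z * flux_row z 0 j.
Proof.
move=> z1; have zr : nc z <= r1 by apply: le_trans one_r1.
have bd (a : nat -> C) : l1 a 1 -> exists K, forall n, \sum_(k < n) nc (a k * z ^+ k) <= K.
  move=> [K hK]; exists K => n; apply: le_trans (hK n); apply: ler_sum => k _.
  exact: nc_term_le.
have Al1' i : l1 (fun k => toC (A k i j)) 1 by apply: l1_le ler01 one_r1 (Al1 i j).
pose cf n := \sum_(m < n.+1) \sum_l levels m 0 l * A (n - m)%N l j.
have h1 : csums (fun n => z ^+ n * toC (cf n)) (\sum_i ps (lev_coef i) z * Az A z i j).
  have H i : csums (fun n => \sum_(m < n.+1) (lev_coef i m * z ^+ m) *
      (toC (A (n - m)%N i j) * z ^+ (n - m))) (ps (lev_coef i) z * Az A z i j).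
    have [Ka hKa] := bd _ (lev_coef_l1 i); have [Kb hKb] := bd _ (Al1' i).
    rewrite mxE; apply: (csums_cauchy_prod (ps_csums (lev_coef_l1 i) z1)
      (ps_csums (Al1 i j) zr) hKa hKb).
  apply: csums_ext (csums_sum H) => n; rewrite /cf exchange_big /= rmorph_sum mulr_sumr.
  apply: eq_bigr => m _; rewrite rmorph_sum mulr_sumr; apply: eq_bigr => l _.
  have -> : z ^+ n = z ^+ m * z ^+ (n - m) by rewrite -exprD subnKC // -ltnS.
  by rewrite /lev_coef rmorphM /=; ring.
(* The constant coefficient vanishes, so the series can be shifted to the index [n.+1] of
   [levels_rec]. *)
have /csums_shift h2 := h1.
have cf0 : cf 0%N = 0.
  by rewrite /cf big_ord_recl big_ord0 addr0 big1 // => l _; rewrite /levels mxE mul0r.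
rewrite /= cf0 mulr0 subr0 in h2.
have hd : csums (fun n => if n == 0%N then toC ((xl 1%N *m A 0%N) 0 j) else 0)
    (toC ((xl 1%N *m A 0%N) 0 j)).
  move=> e e0; exists 1%N => -[//|n] _; rewrite big_ord_recl /= big1 // addr0 subrr nc0.
  exact: ltW.
have h3 := csumsZ z (csumsD (csumsD hd (ps_csums (lev_coef_l1 j) z1)) (csumsZ (-1)
  (csums_sum (fun i => csumsZ (toC (x0 0 i)) (ps_csums (Bl1 i j) zr))))).
have E : \sum_i ps (lev_coef i) z * Az A z i j = z * (toC ((xl 1%N *m A 0%N) 0 j) +
   ps (lev_coef j) z + -1 * \sum_i toC (x0 0 i) * ps (fun k => toC (Bext B k i j)) z).
  apply: (csums_uniq _ h3); apply: csums_ext h2 => n.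
  rewrite /cf levels_rec exprS rmorphB rmorphD /= /lev_coef.
  have -> : \sum_i toC (x0 0 i) * (toC (Bext B n i j) * z ^+ n) =
      toC ((x0 *m Bext B n) 0 j) * z ^+ n.
    rewrite mxE rmorph_sum mulr_suml; apply: eq_bigr => i _.
    by rewrite rmorphM mulrA.
  by case: n => [|n] /=; rewrite ?rmorph0 ?expr0; ring.
by rewrite E flux_rowE; ring.
Qed.

End Main.

(** * Tails of the stationary distribution *)

Section Tail.
Variable R : realType.
Local Notation C := R[i].
Local Notation toC := (real_complex R).
Variables (J : finType) (theta r : R) (tau : nat) (w : C).
Hypothesis th1 : 1 < theta.
Hypothesis thr : theta < r.
Hypothesis tau0 : (0 < tau)%N.
Hypothesis wprim : tau.-primitive_root w.
Hypothesis wnorm : nc w = 1.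
Variables (x : nat -> J -> R) (T : J -> R) (res : nat -> J -> C).
Hypothesis x_ge0 : forall k j, 0 <= x k j.
Hypothesis xT : forall j, rsums (fun k => x k j) (T j).
Hypothesis hS : forall j, exists S, forall k,
  nc (toC (x k j) - \sum_(nu < tau) res nu j * node theta w nu ^- k) * r ^+ k <= S.

Let th0 : 0 < theta. Proof. exact: lt_trans th1. Qed.
Let r0 : 0 < r. Proof. exact: lt_trans thr. Qed.
Let r_1 : 1 < r. Proof. exact: lt_trans thr. Qed.
Let rV1 : r^-1 < 1. Proof. by rewrite invf_lt1. Qed.
Definition xtail n j : R := T j - \sum_(k < n.+1) x k j.
(** Geometric sums: [res * node ^- k] summed over [k > n] is [node ^- n * res / (node - 1)]. This is
    the origin of the factor theta omega^nu - 1 in the denominators of c_l. *)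
Definition tail_coef l j : C :=
  \sum_(nu < tau) (w ^+ nu) ^- l * (res nu j / (node theta w nu - 1)).

Let nodeE nu : node theta w nu = toC theta * w ^+ nu. Proof. by []. Qed.

Lemma node_sub1 nu : node theta w nu - 1 != 0.
Proof.
rewrite subr_eq0; apply/eqP => /(congr1 (@nc R)); rewrite node_norm // nc1 => e.
by move: th1; rewrite e ltxx.
Qed.

Let err n j : C := toC (xtail n j) - toC theta ^- n * tail_coef n j.

Lemma tail_coefE n j : toC theta ^- n * tail_coef n j =
  \sum_(nu < tau) node theta w nu ^- n * (res nu j / (node theta w nu - 1)).
Proof.
rewrite mulr_sumr; apply: eq_bigr => nu _.
by rewrite nodeE exprMn invfM mulrA.
Qed.

Let err_step n j : err n j - err n.+1 j =
  toC (x n.+1 j) - \sum_(nu < tau) res nu j * node theta w nu ^- n.+1.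
Proof.
rewrite /err !tail_coefE /xtail [\sum_(k < n.+2) _]big_ord_recr /= !rmorphB rmorphD /=.
have -> : \sum_(nu < tau) res nu j * node theta w nu ^- n.+1 =
  \sum_(nu < tau) node theta w nu ^- n * (res nu j / (node theta w nu - 1)) -
  \sum_(nu < tau) node theta w nu ^- n.+1 * (res nu j / (node theta w nu - 1)).
  rewrite -sumrB; apply: eq_bigr => nu _; rewrite exprS.
  have n0 : node theta w nu != 0 by exact: node_neq0.
  have n1 := node_sub1 nu; have nX : node theta w nu ^+ n != 0 by rewrite expf_neq0.
  by field; rewrite n0 n1 nX.
by ring.
Qed.

Let err_lim j e : 0 < e -> exists N, forall n, (N <= n)%N -> nc (err n j) <= e.
Proof.
move=> e0; have e2 : 0 < e / 2 by rewrite divr_gt0.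
have [N1 h1] := xT j e2.
pose K := \sum_(nu < tau) nc (res nu j / (node theta w nu - 1)).
have K0 : 0 <= K by apply: sumr_ge0 => nu _; exact: nc_ge0.
have K1 : 0 < K + 1 by rewrite ltr_wpDl.
have q0 : 0 <= theta^-1 by rewrite invr_ge0 ltW.
have q1 : theta^-1 < 1 by rewrite invf_lt1.
have [N2 h2] := expr_small q0 q1 (divr_gt0 e2 K1).
exists (maxn N1 N2) => n; rewrite geq_max => /andP[n1 n2].
apply: le_trans (ncB _ _) _; rewrite [e]splitr lerD //.
  by rewrite nc_toC /xtail distrC h1 // leqW.
rewrite tail_coefE; apply: le_trans (nc_sum _ _ _) _.
apply: le_trans (_ : theta^-1 ^+ n * K <= _).
  rewrite mulr_sumr; apply: ler_sum => nu _.
  have nX : nc (node theta w nu ^- n) = theta^-1 ^+ n.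
    by rewrite ncV ncX node_norm // exprVn.
  by rewrite [leLHS]ncM nX.
apply: le_trans (_ : e / 2 / (K + 1) * (K + 1) <= _); last by rewrite mulfVK ?gt_eqF.
by rewrite ler_pM ?h2 // ?exprn_ge0 // lerDl.
Qed.

(** The error tends to 0 and its increments are O(r^-k), so it is bounded by telescoping towards
    infinity. *)
Lemma tail_expansion : exists K, forall n j,
  nc (toC (xtail n j) - toC theta ^- n * tail_coef n j) <= K * r ^- n.
Proof.
have rn n : 0 < r ^+ n by rewrite exprn_gt0.
have [||K hK] := @uniform_const R unit J (fun _ j K => forall n, nc (err n j) <= K * r ^- n).
- move=> _ j K K' KK' h n; apply: le_trans (h n) _.
  by rewrite ler_wpM2r // invr_ge0 ltW.
- move=> _ j; have [S hSj] := hS j.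
  have S0 : 0 <= S by apply: le_trans (hSj 0%N); rewrite mulr_ge0 ?nc_ge0 // ltW.
  exists (S * (1 - r^-1)^-1) => n; apply/ler_addgt0Pr => e /(err_lim j)[N hN].
  pose m := maxn n N.
  have E k : err n j = \sum_(i < k) (err (n + i) j - err (n + i).+1 j) + err (n + k) j.
    elim: k => [|k IH]; first by rewrite big_ord0 add0r addn0.
    by rewrite big_ord_recr /= {1}IH addnS; ring.
  rewrite (E N); apply: le_trans (ncD _ _) _; rewrite lerD ?hN ?leq_addl //.
  apply: le_trans (nc_sum _ _ _) _.
  apply: le_trans (_ : \sum_(i < N) S * r ^- n * (r^-1) ^+ i <= _).
    apply: ler_sum => i _; rewrite err_step; have := hSj (n + i).+1.
    rewrite -ler_pdivlMr // => h; apply: le_trans h _.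
    rewrite -mulrA ler_wpM2l // exprVn -invfM -exprD.
    by rewrite lef_pV2 ?posrE // exprS ler_peMl ?ltW.
  rewrite -mulr_sumr mulrAC ler_wpM2r ?invr_ge0 ?(ltW (rn n)) // ler_wpM2l //.
  by rewrite geo_sum_le // invr_ge0 ltW.
by exists K => n j; exact: (hK tt j n).
Qed.

Variables (fl : nat -> C) (m : J -> R) (p : J -> nat).
Hypothesis resE : forall nu j, res nu j = fl nu * (toC (m j) * (w ^+ nu) ^+ p j).
Hypothesis m0 : forall j, 0 < m j.
Hypothesis no_decay : forall K, (forall k j, x k j * r ^+ k <= K) -> False.

(** The tau-periodic profile to which [theta ^+ k * x k j] is asymptotic. *)
Let L k j : C := \sum_(nu < tau) res nu j * (w ^+ nu) ^- k.

Let LE k j : \sum_(nu < tau) res nu j * node theta w nu ^- k = toC theta ^- k * L k j.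
Proof.
rewrite mulr_sumr; apply: eq_bigr => nu _; rewrite nodeE exprMn invfM.
by rewrite mulrCA.
Qed.

Let L_per k n j : L (n * tau + k) j = L k j.
Proof.
apply: eq_bigr => nu _; rewrite exprD invfM -exprM mulnA mulnC exprM.
by rewrite (prim_expr_order wprim) expr1n invr1 mul1r.
Qed.

Let wV k j : forall e, 0 < e -> exists N, forall n, (N <= n)%N ->
  nc (toC (theta ^+ n * x n j) - L n j) <= e /\ (k <= n)%N.
Proof.
move=> e e0; have [S hSj] := hS j.
have S0 : 0 <= S by apply: le_trans (hSj 0%N); rewrite mulr_ge0 ?nc_ge0 // exprn_ge0 // ltW.
have S1 : 0 < S + 1 by rewrite ltr_wpDl.
have q0 : 0 <= theta / r by rewrite divr_ge0 // ltW.
have q1 : theta / r < 1 by rewrite ltr_pdivrMr // mul1r.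
have [N hN] := expr_small q0 q1 (divr_gt0 e0 S1).
exists (maxn N k) => n; rewrite geq_max => /andP[/hN h1 kn]; split=> //.
have tn : toC theta ^+ n != 0 by rewrite expf_neq0 // toC_th0.
have -> : toC (theta ^+ n * x n j) - L n j =
    toC theta ^+ n * (toC (x n j) - \sum_(nu < tau) res nu j * node theta w nu ^- n).
  by rewrite LE rmorphM rmorphXn; field.
rewrite ncM ncX nc_toC gtr0_norm //.
have rn : 0 < r ^+ n by rewrite exprn_gt0.
have := hSj n; rewrite -ler_pdivlMr // => h.
apply: le_trans (_ : theta ^+ n * (S / r ^+ n) <= _).
  by rewrite ler_wpM2l // exprn_ge0 // ltW.
have -> : theta ^+ n * (S / r ^+ n) = S * (theta / r) ^+ n.
  by rewrite expr_div_n; field; rewrite gt_eqF.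
apply: le_trans (_ : (S + 1) * (e / (S + 1)) <= _); last by rewrite mulrC mulfVK ?gt_eqF.
by rewrite ler_pM // ?exprn_ge0 // lerDl.
Qed.

Let L_real k j : L k j = toC (complex.Re (L k j)) /\ 0 <= complex.Re (L k j).
Proof.
have H e : 0 < e -> exists2 y : R, 0 <= y & nc (toC y - L k j) <= e.
  move=> /(wV 0%N j)[N hN]; pose n := (N * tau + k)%N.
  have Nn : (N <= n)%N by rewrite /n (leq_trans (leq_pmulr _ tau0)) // leq_addr.
  have [h _] := hN n Nn; rewrite /n L_per -/n in h.
  by exists (theta ^+ n * x n j) => //; rewrite mulr_ge0 // exprn_ge0 // ltW.
have im : complex.Im (L k j) = 0.
  apply/eqP; rewrite -normr_le0; apply/ler_addgt0Pr => e /H[y _ h]; rewrite add0r.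
  apply: le_trans h; rewrite ncBC; apply: le_trans (nc_Im _).
  by case: (L k j) => a b /=; rewrite oppr0 addr0.
split; first by case: (L k j) im => a b /= ->.
apply/ler_addgt0Pr => e /H[y y0 h].
have : `|complex.Re (toC y - L k j)| <= e by apply: le_trans (nc_Re _) h.
case: (L k j) => a b /=; rewrite ler_norml; lra.
Qed.

(** Orthogonality leaves only the index [nu = 0], whose residue carries no phase. *)
Let L_sum j : \sum_(k < tau) L k j = tau%:R * res 0%N j.
Proof.
rewrite exchange_big /= (bigD1 (Ordinal tau0)) //=.
have -> : \sum_(k < tau) res 0%N j * (w ^+ 0) ^- k = tau%:R * res 0%N j.
  rewrite (eq_bigr (fun=> res 0%N j)) ?sumr_const ?card_ord ?mulr_natl // => k _.
  by rewrite expr0 expr1n invr1 mulr1.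
apply/eqP; rewrite -subr_eq0 addrAC subrr add0r; apply/eqP; apply: big1.
move=> nu nu0; rewrite -mulr_sumr; under eq_bigr => k _ do rewrite -exprVn.
set q := (w ^+ nu)^-1; have q1 : q != 1.
  rewrite invr_eq1 -(prim_order_dvd wprim) gtnNdvd // lt0n.
  by move: nu0; rewrite -val_eqE.
have : (q - 1) * \sum_(k < tau) q ^+ k = 0.
  rewrite -subrX1 /q exprVn -exprM mulnC exprM (prim_expr_order wprim) expr1n invr1 subrr //.
by move/eqP; rewrite mulf_eq0 subr_eq0 (negbTE q1) => /eqP ->; rewrite mulr0.
Qed.

(** If the profile vanishes in one coordinate, its sum over a period gives [fl 0 = 0]. The sums over
    a period then vanish in all coordinates, and nonnegativity makes every profile zero. This means
    that [x k] is O(r^-k), contrary to [no_decay]. *)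
Let L_nonzero j : exists k, L k j != 0.
Proof.
apply: contrapT => no.
have z k : L k j = 0 by apply/eqP; apply: contraT => h; case: no; exists k.
have f0 : fl 0%N = 0.
  have := L_sum j; rewrite big1 // resE expr0 expr1n mulr1 => /esym/eqP.
  have mC : toC (m j) != 0 by rewrite -nc_eq0 nc_toC normr_eq0 gt_eqF.
  by rewrite !mulf_eq0 (negbTE mC) orbF pnatr_eq0 gtn_eqF //= => /eqP.
have z' j' (k : 'I_tau) : L k j' = 0.
  have E : \sum_(k < tau) complex.Re (L k j') = 0.
    have := L_sum j'; rewrite resE f0 mul0r mulr0 => /(congr1 (@complex.Re R)).
    by rewrite (raddf_sum (@complex.Re R)).
  have [-> _] := L_real k j'; congr (toC _).
  have := eq_of_sum_le (F := fun=> 0) (G := fun k : 'I_tau => complex.Re (L k j')).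
  move=> H; symmetry; apply: (H _ _ k) => [i|]; first by have [] := L_real i j'.
  by rewrite E big1.
have zk j' k : L k j' = 0.
  by rewrite (divn_eq k tau) L_per; exact: (z' j' (Ordinal (ltn_pmod k tau0))).
have [||K hK] := @uniform_const R unit J (fun _ j K => forall k, x k j * r ^+ k <= K).
- by move=> _ j' K K' KK' h k; apply: le_trans (h k) _.
- move=> _ j'; have [S hSj] := hS j'; exists S => k; apply: le_trans (hSj k).
  by rewrite LE zk mulr0 subr0 nc_toC ger0_norm.
by apply: (no_decay (K := K)) => k j'; exact: (hK tt j' k).
Qed.

Let xtail_ge n k j : (n < k)%N -> x k j <= xtail n j.
Proof.
move=> nk; rewrite /xtail lerBrDr; apply: le_trans (rsums_partial_le k.+1 (x_ge0^~ j) (xT j)).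
have -> : \sum_(i < k.+1) x i j = x k j + \sum_(i < k) x i j by rewrite big_ord_recr /= addrC.
rewrite lerD2l -subr_ge0 (sum_nat_split (fun k => x k j) nk); apply: sumr_ge0 => i _; exact: x_ge0.
Qed.

(** The scaled tail along one residue class converges to [tail_coef l j], and it stays above a
    positive constant because it contains a term at a later level where the profile [L] is
    positive. *)
Lemma tail_coef_gt0 l j : 0 < tail_coef l j.
Proof.
have [k Lk] := L_nonzero j; have [LR L0] := L_real k j.
set a := complex.Re (L k j) in LR L0.
have a0 : 0 < a.
  rewrite lt_def L0 andbT; apply: contraNneq Lk => e.
  by rewrite LR e.
have a2 : 0 < a / 2 by rewrite divr_gt0.
(* Adding [i > 0] leads from [n * tau + l] to the residue class of [k]; the summand [l.+1 * tau]
   keeps the subtraction from truncating. *)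
pose i := (l.+1 * tau + k - l)%N; pose d := theta ^- i * (a / 2).
have thi : 0 < theta ^+ i by rewrite exprn_gt0.
have d0 : 0 < d by rewrite mulr_gt0 ?invr_gt0.
have li : (l < l.+1 * tau + k)%N by rewrite (leq_trans (leq_pmulr _ tau0)) // leq_addr.
have per n : tail_coef (n * tau + l) j = tail_coef l j.
  apply: eq_bigr => nu _; congr (_ * _); congr (_^-1).
  by rewrite exprD -exprM mulnA mulnC exprM (prim_expr_order wprim) expr1n mul1r.
have low : exists N, forall n, (N <= n)%N -> d <= theta ^+ (n * tau + l) * xtail (n * tau + l) j.
  have [N hN] := wV 0%N j a2; exists N => n' Nn; set q := (n' * tau + l)%N.
  pose k' := ((n' + l.+1) * tau + k)%N.
  have qk : k' = (q + i)%N by rewrite /k' /q /i; move: li; rewrite mulnDl; lia.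
  have i0 : (0 < i)%N by rewrite subn_gt0.
  have Nk : (N <= k')%N.
    apply: leq_trans Nn _; rewrite /k' mulnDl -addnA.
    by apply: leq_trans (leq_pmulr _ tau0) (leq_addr _ _).
  have [h _] := hN k' Nk; rewrite /k' L_per -/k' LR -rmorphB nc_toC ler_norml in h.
  have {h} h : a / 2 <= theta ^+ k' * x k' j by case/andP: h; lra.
  have qk' : (q < k')%N by rewrite qk -[q in (q < _)%N]addn0 ltn_add2l.
  apply: le_trans (_ : theta ^+ q * x k' j <= _); last first.
    by rewrite ler_wpM2l ?xtail_ge // exprn_ge0 // ltW.
  rewrite /d mulrC ler_pdivrMr //; apply: le_trans h _.
  by rewrite qk exprD mulrAC.
have [K hK] := tail_expansion.
have approx e : 0 < e -> exists N, forall n, (N <= n)%N ->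
    nc (toC (theta ^+ (n * tau + l) * xtail (n * tau + l) j) - tail_coef l j) <= e.
  move=> e0; have r0V : 0 < r ^- 0 by rewrite expr0 invr1.
  have K0 : 0 <= K by rewrite -(pmulr_lge0 _ r0V); apply: le_trans (hK 0%N j); exact: nc_ge0.
  have K1 : 0 < K + 1 by rewrite ltr_wpDl.
  have q0 : 0 <= theta / r by rewrite divr_ge0 // ltW.
  have q1 : theta / r < 1 by rewrite ltr_pdivrMr // mul1r.
  have [N hN] := expr_small q0 q1 (divr_gt0 e0 K1); exists N => n Nn.
  have Nq : (N <= n * tau + l)%N.
    by apply: leq_trans Nn _; apply: leq_trans (leq_pmulr _ tau0) (leq_addr _ _).
  set q := (n * tau + l)%N in Nq *; have h1 := hN _ Nq.
  have tn : toC theta ^+ q != 0 by rewrite expf_neq0 // toC_th0.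
  have -> : toC (theta ^+ q * xtail q j) - tail_coef l j =
     toC theta ^+ q * (toC (xtail q j) - toC theta ^- q * tail_coef q j).
    by rewrite {2}/q per rmorphM rmorphXn; field.
  rewrite ncM ncX nc_toC gtr0_norm //.
  apply: le_trans (_ : theta ^+ q * (K * r ^- q) <= _).
    by rewrite ler_wpM2l // exprn_ge0 // ltW.
  have -> : theta ^+ q * (K * r ^- q) = K * (theta / r) ^+ q.
    by rewrite expr_div_n; field; rewrite expf_neq0 // gt_eqF.
  apply: le_trans (_ : (K + 1) * (e / (K + 1)) <= _); last by rewrite mulrC mulfVK ?gt_eqF.
  by rewrite ler_pM // ?exprn_ge0 // lerDl.
(* Positivity in [R[i]] includes being real: the imaginary part vanishes because real numbers
   approximate [tail_coef l j]. *)
rewrite ltcE /=; have [N1 h1] := low; apply/andP; split.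
  rewrite -normr_le0; apply/ler_addgt0Pr => e /approx[N hN]; rewrite add0r.
  apply: le_trans (hN N (leqnn N)); rewrite ncBC; apply: le_trans (nc_Im _).
  by case: (tail_coef l j) => a' b' /=; rewrite oppr0 addr0.
have [N hN] := approx _ (divr_gt0 d0 (ltr0n _ 2)).
have n1 := h1 _ (leq_maxl N1 N); have := hN _ (leq_maxr N1 N).
set y := _ * xtail _ _ in n1 *; move=> h2.
have : `|complex.Re (toC y - tail_coef l j)| <= d / 2 by apply: le_trans (nc_Re _) h2.
case: (tail_coef l j) => a' b' /=; rewrite ler_norml; lra.
Qed.

End Tail.

Lemma xbarE (R : realType) M (xl : nat -> 'rV[R]_M.+1) n j :
  (forall j, rsum_cvg (fun k => xl k.+1 0 j)) ->
  xbar xl n 0 j = xtail (fun k j => levels xl k 0 j) (fun j => rsum (fun k => xl k.+1 0 j)) n j.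
Proof.
move=> hx; rewrite mxE /xtail; apply: rsums_rsum.
have h := level_sums hx j; have S k : rsums (fun l => levels xl (k + l)%N 0 j)
    (rsum (fun k => xl k.+1 0 j) - \sum_(l < k) levels xl l 0 j).
  elim: k => [|k /csums_toC/csums_shift IH]; first by rewrite big_ord0 subr0.
  rewrite big_ord_recr /= opprD addrA; apply/csums_toC.
  move: IH; rewrite /= addn0 [in X in _ -> X]rmorphB; apply: csums_ext => l /=.
  by rewrite addSnnS.
by apply: rsums_ext (S n.+1).
Qed.

Lemma diag_inv (F : fieldType) n (d : 'rV[F]_n) (u : 'rV[F]_n) j : (forall i, d 0 i != 0) ->
  (u *m invmx (diag_mx d)) 0 j = u 0 j / d 0 j.
Proof.
move=> d0; have du : diag_mx d \in unitmx.
  by rewrite unitmxE det_diag unitfE; apply/prodf_neq0 => i _.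
have := congr1 (fun Y : 'rV_n => Y 0 j) (mulmxKV du u).
by rewrite mul_mx_diag mxE => <-; rewrite mulfK.
Qed.

(** The inverse of [DeltaM] supplies the phase of [res]; the denominator splits into [drift - 1]
    from the residue and [node - 1] from the summation of tails. *)
Lemma c_constE (R : realType) M0 M (A : nat -> 'M[R]_M.+1) (B : nat -> 'M[R]_(M0, M.+1))
    (x0 : 'rV[R]_M0) (xl : nat -> 'rV[R]_M.+1) tau p theta mu v l j
    (w := omega R tau 1) : (0 < tau)%N ->
  derive1 (fun y : R => complex.Re (delta (cmx (Astar A y)))) theta = drift A theta mu v ->
  c_const A B x0 (xl 1%N) tau p theta mu v l 0 j =
  tail_coef theta tau w (res A theta mu v p w (flux_row A B x0 xl)) l j.
Proof.
move=> t0 hd; rewrite /c_const hd summxE; apply: eq_bigr => nu _.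
rewrite mxE omegaE -/w diag_inv => [|i]; last first.
  rewrite mxE invr_eq0 expf_neq0 // expf_neq0 // -nc_eq0 /w nc_omega // oner_eq0 //.
set wn := w ^+ nu; rewrite !mxE /res /node -/wn.
have -> : flux theta v p w (flux_row A B x0 xl) nu =
   \sum_j0 (flux_row A B x0 xl (real_complex R theta * wn) *m DeltaM p wn) 0 j0 * cmx v j0 0.
  by apply: eq_bigr => i _; rewrite /DeltaM mul_mx_diag !mxE mulrA.
rewrite invrK invfM -!mulrA; congr (_ * _); rewrite /flux_row.
set S := \sum_j0 _; by ring.
Qed.

Unset Implicit Arguments.

Theorem theorem3p1 (R : realType) (M0 M : nat) (hM0 : (0 < M0)%N) (hM : (0 < M)%N)
  (A : nat -> 'M[R]_M) (B0 : 'M[R]_M0) (B : nat -> 'M[R]_(M0, M))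
  (C0 : 'M[R]_(M, M0))
  (* nonnegativity *)
  (hA0 : forall k i j, 0 <= A k i j) (hB00 : forall i j, 0 <= B0 i j)
  (hB0 : forall k i j, 0 <= B k i j) (hC00 : forall i j, 0 <= C0 i j)
  (* A = sum_k A(k) is stochastic *)
  (hAcvg : forall i j, rsum_cvg (fun k => A k i j))
  (hAstoch : forall i, \sum_j rsum (fun k => A k i j) = 1)
  (* B(0)e + Be = e, with B = sum_{k>=1} B(k) *)
  (hBcvg : forall i j, rsum_cvg (fun k => B k.+1 i j))
  (hBstoch : forall i, \sum_j B0 i j + \sum_j rsum (fun k => B k.+1 i j) = 1)
  (* rows of level 1 of T sum to one: C(0)e + sum_{k>=1} A(k)e = e *)
  (hCstoch : forall i, \sum_j C0 i j + \sum_j rsum (fun k => A k.+1 i j) = 1)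
  (* pi: pi A = pi, pi e = 1 *)
  (pi0 : 'rV[R]_M)
  (hpiA : pi0 *m (\matrix_(i, j) rsum (fun k => A k i j)) = pi0)
  (hpie : \sum_j pi0 0 j = 1)
  (* Assumption 1 *)
  (hTirr : T_irreducible A B0 B C0)
  (hAirr : mx_irreducible (\matrix_(i, j) rsum (fun k => A k i j)))
  (hrho_cvg : forall i j, rsum_cvg (fun k => k%:R * A k i j))
  (hrho : \sum_i pi0 0 i * \sum_j rsum (fun k => k%:R * A k i j) < 1)
  (hBmean : forall i j, rsum_cvg (fun k => k%:R * B k.+1 i j))
  (* Assumption 2 *)
  (hrA : (1%:E < conv_radius A)%E)
  (hrB : (1%:E < conv_radius (Bext B))%E)
  (* Assumption 3 *)
  (theta : R) (htheta1 : 1 < theta) (hthetaA : (theta%:E < conv_radius A)%E)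
  (hthetadelta : delta (cmx (Astar A theta)) = (theta%:C)%C)
  (* additional hypothesis theta < r_B *)
  (hthetaB : (theta%:E < conv_radius (Bext B))%E)
  (* stationary probability vector x = (x(0), x(1), ...) ; xl k = x(k) for k >= 1 *)
  (x0 : 'rV[R]_M0) (xl : nat -> 'rV[R]_M)
  (hx00 : forall j, 0 <= x0 0 j) (hxl0 : forall k j, (1 <= k)%N -> 0 <= xl k 0 j)
  (hxlev0 : x0 = x0 *m B0 + xl 1%N *m C0)
  (hxlev : forall k, (1 <= k)%N ->
     xl k = x0 *m B k + \sum_(1 <= i < k.+2) xl i *m A (k.+1 - i)%N)
  (hxcvg : forall j, rsum_cvg (fun k => xl k.+1 0 j))
  (hxnorm : \sum_j x0 0 j + \sum_j rsum (fun k => xl k.+1 0 j) = 1)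
  (* Perron-Frobenius eigenvectors of Gamma_A^*(theta) = theta^-1 A^*(theta) *)
  (mu : 'rV[R]_M) (v : 'cV[R]_M)
  (hmu_pos : forall j, 0 < mu 0 j) (hv_pos : forall j, 0 < v j 0)
  (hmu : mu *m (theta^-1 *: Astar A theta) = mu)
  (hv : (theta^-1 *: Astar A theta) *m v = v)
  (hmue : \sum_j mu 0 j = 1) (hmuv : (mu *m v) 0 0 = 1)
  (* period tau and the function p *)
  (tau : nat) (htau : MAP_period A tau)
  (p : 'I_M -> nat) (hp : period_fun A tau p) :
  exists eps0 : R, 0 < eps0 /\
    (forall l, (l < tau)%N ->
      exists K : R, exists N : nat, forall n, (N <= n)%N -> forall j,
        `| ((xbar xl (n * tau + l)%N 0 j)%:C)%C
           - ((theta%:C)%C ^- (n * tau + l)%N) * c_const A B x0 (xl 1%N) tau p theta mu v l 0 j |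
        <= ((K * (theta + eps0) ^- (n * tau + l)%N)%:C)%C) /\
    (forall l, (l < tau)%N -> forall j,
      0 < c_const A B x0 (xl 1%N) tau p theta mu v l 0 j).
Proof.
(* Period 0 leaves no index [l], and both claims are vacuous. *)
case: tau htau hp => [|t] htau hp.
  by exists 1; split=> //; split=> l; rewrite ltn0.
case: M => [//|m] in A B C0 xl hM hA0 hB0 hC00 hAcvg hAstoch hBcvg hBstoch hCstoch pi0 hpiA hpie
  hTirr hAirr hrho_cvg hrho hBmean hrA hrB hthetaA hthetadelta hthetaB hxl0 hxlev0 hxlev
  hxcvg hxnorm mu v hmu_pos hv_pos hmu hv hmue hmuv p htau hp *.
set tau := t.+1 in htau hp *; have tau0 : (0 < tau)%N by [].
have [rA thA A1] := conv_radius_l1 hA0 hthetaA.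
have Bx0 k i j : 0 <= Bext B k i j by rewrite /Bext; case: eqP => _; rewrite ?mxE.
have [rB thB B1] := conv_radius_l1 Bx0 hthetaB.
have th0 : 0 < theta by exact: lt_trans htheta1.
(* A common radius of absolute convergence for [A] and [B], still beyond [theta]. *)
pose r1 := Num.min rA rB; have thr1 : theta < r1 by rewrite lt_min thA.
have r10 : 0 <= r1 by apply/ltW; exact: lt_trans thr1.
have Al1 i j : l1 (fun k => real_complex R (A k i j)) r1.
  by apply: l1_le (A1 i j); rewrite // ge_min lexx.
have Bl1 i j : l1 (fun k => real_complex R (Bext B k i j)) r1.
  by apply: l1_le (B1 i j); rewrite // ge_min lexx orbT.
have As1 : Astar A 1 = \matrix_(i, j) rsum (fun k => A k i j).
  apply/matrixP => i j; rewrite !mxE; congr rsum; apply: funext => k.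
  by rewrite expr1n mul1r.
have Airr : mx_irreducible (Astar A 1) by rewrite As1.
have stoch i : \sum_j Astar A 1 i j = 1.
  by rewrite As1 -[RHS](hAstoch i); apply: eq_bigr => j _; rewrite mxE.
have muA : mu *m Astar A theta = theta *: mu.
  by rewrite -[in RHS]hmu -scalemxAr scalerA mulfV ?gt_eqF // scale1r.
have Av : Astar A theta *m v = theta *: v.
  by rewrite -[in RHS]hv -scalemxAl scalerA mulfV ?gt_eqF // scale1r.
pose w := omega R tau 1; have wprim : tau.-primitive_root w by exact: omega_prim.
have wnorm : nc w = 1 by exact: nc_omega.
pose f := flux_row A B x0 xl; pose a := lev_coef xl.
have la j : l1 (a j) 1 by exact: lev_coef_l1.
have fan j : an r1 (fun z => f z 0 j) by exact: (flux_row_an A x0 xl Bl1 htheta1 thr1 j).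
have Xan j : an 1 (ps (a j)) by exact: ps_an ler01 (la j).
have XK j z := level_identity hxl0 hxlev hxcvg Al1 Bl1 htheta1 thr1 j (z := z).
have [r thr hS] := expansion hA0 Al1 htheta1 thr1 Airr hmu_pos hv_pos muA Av hmuv stoch htau tau0
  hp wprim wnorm Xan fan XK la (fun j z _ => erefl).
have d1 := drift_gt1 hA0 Al1 htheta1 thr1 hmu_pos hv_pos muA Av hmuv stoch htau tau0.
have hd := derive_delta hA0 Al1 htheta1 thr1 Airr hmu_pos hv_pos muA Av hmuv.
have cE l j := c_constE B x0 xl p l j tau0 hd.
have lev0 k j := levels_ge0 hxl0 k j.
have levT j := level_sums hxcvg j.
have no_decay K : (forall k j, levels xl k 0 j * r ^+ k <= K) -> False.
  have [s [h [kappa [s1 sth h0 k0 Ah]]]] := strictly_superharmonic hA0 Al1 htheta1 thr1 Airr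
    hmu_pos hv_pos muA Av hmuv stoch htau tau0.
  have Ast y i j : 0 <= y -> y <= theta -> rsums (fun k => y ^+ k * A k i j) (Astar A y i j).
    move=> y0 yth; exact: (Astar_rsums Al1 i j y0 (le_trans yth (ltW thr1))).
  move=> hK; apply: (@escape R m A theta s kappa v h hA0 s1 sth k0 hv_pos h0 _ _ Av Ah
    (levels xl) _ lev0 _ _ K r thr hK) => //.
  - by move=> i j; apply: Ast (ltW th0) (lexx _).
  - by move=> i j; apply: Ast; apply: ltW; rewrite // (lt_trans _ s1).
  - move=> k j; exact: (levels_gt0 hA0 hB00 hB0 hC00 hx00 hxl0 hxlev0 hxlev hxnorm hTirr).
  - move=> k j; exact: (levels_super hB0 hx00 hxlev).
(* With this choice [theta + eps0] is the radius [r] that governs the remainder after subtraction of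
   the principal parts. *)
exists (r - theta); rewrite subr_gt0; split=> //; split.
  move=> l _; have [K hK] := tail_expansion htheta1 thr wnorm levT hS.
  exists K, 0%N => n _ j; rewrite [theta + _]addrC subrK norm_nc lecR xbarE // cE.
  have per : tail_coef theta tau w (res A theta mu v p w f) (n * tau + l) j =
      tail_coef theta tau w (res A theta mu v p w f) l j.
    apply: eq_bigr => nu _; congr (_ * _); congr (_^-1).
    by rewrite exprD -exprM mulnA mulnC exprM (prim_expr_order wprim) expr1n mul1r.
  by rewrite -[tail_coef _ _ _ _ l j]per; exact: hK.
move=> l _ j; rewrite cE.
apply: (tail_coef_gt0 htheta1 thr tau0 wprim wnorm lev0 levT hS (fl := fun nu =>
  flux theta v p w f nu / real_complex R (drift A theta mu v - 1)) (m := fun j => mu 0 j) (p := p)) => //.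
Qed.
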